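(* Let $X$ be a CB process with branching mechanism $\Phi$ given by $(\alpha,\beta,\pi)$, with $\pi\neq 0$, and let $x>0$. Let $A$ be a Borel set with $A\subset(a,\infty)$ for some $a>0$, and let $\tau_A=\inf\{s>0:\Delta X_s\in A\}$. Then for any $t\in(0,\infty)$, $$\mathbf{P}_x[\tau_A>t]=\mathbf{E}_x\left[\exp\left(-\pi(A)\int_0^t X^A_s\,ds\right)\right],$$ where $X^A$ is a CB process (with $X^A_0=x$ under $\mathbf{P}_x$) with branching mechanism $$\Phi^A(\lambda)=\left(\alpha+\int_A\theta\,\pi(d\theta)\right)\lambda+\beta\lambda^2+\int_{(0,\infty)\setminus A}(e^{-\lambda\theta}-1+\lambda\theta)\,\pi(d\theta).$$ Moreover, $$\mathbf{P}_x[\tau_A=\infty]=\mathbf{E}_x\left[\exp\left(-\pi(A)\int_0^\infty X^A_s\,ds\right)\right].$$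
   Context: A branching mechanism is a function $\Phi(\lambda)=\alpha\lambda+\beta\lambda^2+\int_{(0,\infty)}(e^{-\lambda\theta}-1+\lambda\theta)\,\pi(d\theta)$, $\lambda\ge0$, with $\alpha\in\mathbb{R}$, $\beta\ge0$ and $\pi$ a $\sigma$-finite measure on $(0,\infty)$ (the Lévy measure) with $\int_{(0,\infty)}(\theta\wedge\theta^2)\,\pi(d\theta)<\infty$; the case $\Phi\equiv0$ is excluded. A CB process with branching mechanism $\Phi$ is a right-continuous with left limits (rcll) $[0,\infty)$-valued Markov process $X=(X_t)_{t\ge0}$ such that, writing $\mathbf{P}_x$ for its law when $X_0=x$ and $\mathbf{E}_x$ for the expectation, $\mathbf{E}_x[e^{-\lambda X_t}]=e^{-xv_t(\lambda)}$ for $\lambda\ge0$, where $v_t(\lambda)$ is the unique locally bounded nonnegative solution of $v_t(\lambda)=\lambda-\int_0^t\Phi(v_s(\lambda))\,ds$. $\Delta X_s=X_s-X_{s-}$ for $s>0$; $\inf\emptyset=\infty$; $0\cdot\infty=0$. *)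

(* Defs.v *)
From HB Require Import structures.
From mathcomp Require Export all_boot all_order all_algebra.
From mathcomp Require Export all_classical all_reals all_analysis.
From mathcomp Require Export measurable_realfun.
Set Implicit Arguments.
Unset Strict Implicit.
Unset Printing Implicit Defensive.
Import Order.TTheory GRing.Theory Num.Theory.
Import numFieldNormedType.Exports.
Local Open Scope classical_set_scope.
Local Open Scope ring_scope.

Definition branching_mechanism {R : realType} (alpha beta : R)
    (pi : {measure set (measurableTypeR R) -> \bar R}) (lambda : R) : R :=
  alpha * lambda + beta * lambda ^+ 2
  + \int[pi]_(theta in `]0, +oo[)
      (expR (- (lambda * theta)) - 1 + lambda * theta).

(* A measure on (0, oo) is encoded as a measure on R that does not charge
   ]-oo, 0]. *)
Record branching_parameters {R : realType} (alpha beta : R)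
    (pi : {measure set (measurableTypeR R) -> \bar R}) : Prop := {
  bp_beta_ge0 : 0 <= beta ;
  bp_pi_pos : pi `]-oo, 0]%classic = 0%E ;
  bp_sigma_finite : sigma_finite setT pi ;
  bp_moment :
    (\int[pi]_(theta in `]0%R, +oo[)
       (Num.min theta (theta ^+ 2))%:E < +oo)%E ;
  bp_nontrivial :
    exists2 lambda : R, 0 <= lambda &
      branching_mechanism alpha beta pi lambda <> 0 }.

Definition branching_mechanism_avoiding {R : realType} (alpha beta : R)
    (pi : {measure set (measurableTypeR R) -> \bar R}) (A : set R)
    (lambda : R) : R :=
  (alpha + \int[pi]_(theta in A) theta) * lambda + beta * lambda ^+ 2
  + \int[pi]_(theta in `]0, +oo[ `\` A)
      (expR (- (lambda * theta)) - 1 + lambda * theta).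

(* [u] is the function t |-> v_t(lambda). Measurability is spelled out because
   the library integral is also defined for non-measurable integrands. *)
Record cumulant_solution {R : realType} (Phi : R -> R) (lambda : R)
    (u : R -> R) : Prop := {
  cs_measurable : measurable_fun (`[0, +oo[%classic : set R) u ;
  cs_ge0 : forall t : R, 0 <= t -> 0 <= u t ;
  cs_locally_bounded : forall t : R, 0 <= t -> [bounded u s | s in `[0, t]] ;
  cs_equation : forall t : R, 0 <= t ->
    u t = lambda - \int[lebesgue_measure]_(s in `[0, t]) Phi (u s) }.

Definition rcll {R : realType} (f : R -> R) : Prop :=
  (forall t : R, 0 <= t -> f s @[s --> t^'+] --> f t) /\
  (forall t : R, 0 < t -> cvg (f s @[s --> t^'-])).

Definition natural_filtration {R : realType} {d : measure_display}
    {T : measurableType d} (X : R -> T -> R) (t : R) : set (set T) :=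
  <<s \bigcup_(s in `[0, t]) preimage_set_system setT (X s) measurable >>.

(* Indices t < 0 of [X] and [P x] for x < 0 are irrelevant.
   [cb_markov] says that P_x[X_(s+t) \in B | F_s] = P_(X_s)[X_t \in B].
   [Phi] is not required to be nonzero: the mechanism avoiding [A] can vanish
   identically even when the original one does not. *)
Record cb_process {R : realType} {d : measure_display} {T : measurableType d}
    (Phi : R -> R) (P : R -> probability T R) (X : R -> T -> R) : Prop := {
  cb_measurable : forall t : R, 0 <= t -> measurable_fun setT (X t) ;
  cb_ge0 : forall (t : R) w, 0 <= t -> 0 <= X t w ;
  cb_rcll : forall w, rcll (X ^~ w) ;
  cb_start : forall x : R, 0 <= x -> P x [set w | X 0 w = x] = 1%E ;
  cb_kernel : forall (t : R) (B : set R), 0 <= t -> measurable B ->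
    measurable_fun (`[0, +oo[%classic : set R)
      (fun x => P x [set w | B (X t w)]) ;
  cb_markov : forall (x s t : R) (F : set T) (B : set R),
    0 <= x -> 0 <= s -> 0 <= t ->
    natural_filtration X s F -> measurable B ->
    (P x (F `&` [set w | B (X (s + t)%R w)]) =
     \int[P x]_(w in F) P (X s w) [set w' | B (X t w')])%E ;
  cb_laplace : exists2 v : R -> R -> R,
    forall lambda : R, 0 <= lambda ->
      cumulant_solution Phi lambda (fun t => v t lambda) &
    forall x t lambda : R, 0 <= x -> 0 <= t -> 0 <= lambda ->
      ('E_(P x)[fun w => expR (- (lambda * X t w))] =
       (expR (- (x * v t lambda)))%:E)%E }.

Definition jump {R : realType} (f : R -> R) (s : R) : R :=
  f s - lim (f r @[r --> s^'-]).

Definition first_jump_time {R : realType} {d : measure_display}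
    {T : measurableType d} (X : R -> T -> R) (A : set R) (w : T) : \bar R :=
  ereal_inf [set s%:E | s in [set s : R | 0 < s /\ A (jump (X ^~ w) s)]].

(* Main.v *)
(** For a grid of mesh [h = t / n], write [u_0 = lam],
    [u_(k+1) = u_k - h * Psi u_k] for the Euler scheme of the mechanism
    [Psi u = Phi u - \int_A exp (- u theta) pi (d theta) = Phi^A u - pi A].
    Both sides of the identity, with an extra weight [exp (- lam X_t)], are
    limits of [exp (- x u_n)].

    On the side of [X^A], the time integral is a limit of Riemann sums, and the
    Markov property together with [v_h u = u - h * Phi^A u + O (h ^ 2)] turns one
    step of the grid into one Euler step, up to [O (h ^ 2)] uniformly in the
    space variable (the factor [exp (- lam x)] absorbs polynomials in [x]).

    On the side of [X], let [g] vanish near [0]. Pathwise, the product over the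
    grid of [1 - g (X_((k+1)h) - X_(kh))] converges to the product of
    [1 - g (jump)] over the jumps in [(0, t]].
    In the variable [z = exp (- (X_(s+h) - X_s))], Weierstrass gives
    [g = (1 - z) ^ 2 * p z] up to a small multiple of [(1 - z) ^ 2], so a step of
    the grid reduces to exponential moments, whose second differences produce
    [\int g exp (- u theta) pi (d theta)]. The identity is stable under pointwise
    limits of [g], hence reaches the indicator of [A] through Baire functions.

    It remains to let [lam] tend to [0], then [t] to infinity. *)
Require Import Defs.
From mathcomp Require Import ring lra.
Set Implicit Arguments.
Unset Strict Implicit.
Unset Printing Implicit Defensive.
Import Order.TTheory GRing.Theory Num.Theory.
Import numFieldNormedType.Exports.
Local Open Scope classical_set_scope.
Local Open Scope ring_scope.

(** * Exponential estimates *)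

(** Both sides are compared with one and the same discrete scheme: the convergence of
    [exp (- x u_n)] is a by-product of dominated convergence on each side, and the integral equation
    of the cumulant enters only through its short-time expansion. The weight [exp (- lam X_t)] with
    [lam > 0] makes the estimates uniform. Since [Phi 0 = 0] and killing only lowers the mechanism,
    [Psi u <= C u], so the iterates started from [lam] stay above some [c > 0] up to time [t], while
    [Psi u >= - a u - q] bounds them above. Every error that depends on the state [x] then carries a
    factor [exp (- c x)]. The factor [(1 - z)^2] plays two parts: it turns exponential moments into
    second differences, where the zeroth-order terms and the drift cancel, and it is dominated by
    the minimum of [theta] and [theta^2]. The Gaussian part adds [2 beta p(1)] to these differences,
    which is small because the function approximated by [p] vanishes at [z = 1]. Finally [z] is
    unbounded, but [X >= 0] gives [z <= exp X_s], so the approximation takes place on a compact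
    interval except where [X_s] is large. *)

Lemma subr_expRN_le {R : realType} (z : R) : 1 - expR (- z) <= z.
Proof. by have := expR_ge1Dx (- z); lra. Qed.

Lemma mulr_expRN_le {R : realType} (z : R) : z * expR (- z) <= 1 - expR (- z).
Proof.
have h : (1 + z) * expR (- z) <= 1.
  rewrite expRN ler_pdivrMr ?expR_gt0// mul1r.
  exact: expR_ge1Dx.
by lra.
Qed.

Lemma expRN_remainder_le {R : realType} (z : R) : 0 <= z ->
  expR (- z) - 1 + z <= z ^+ 2.
Proof.
move=> z0; have := mulr_expRN_le z; have := subr_expRN_le z.
move=> h1 h2; have : z * (1 - expR (- z)) <= z * z by rewrite ler_wpM2l.
by rewrite expr2; lra.
Qed.

Lemma expR_taylor1 {R : realType} (w : R) :
  `|expR w - 1 - w| <= w ^+ 2 * expR `|w|.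
Proof.
rewrite ger0_norm; last by have := expR_ge1Dx w; lra.
have [w0|w0] := leP 0 w.
  rewrite ger0_norm//.
  have h : expR w - 1 <= w * expR w.
    have := subr_expRN_le w; rewrite -(ler_pM2r (expR_gt0 w)).
    by rewrite mulrBl mul1r -expRD addNr expR0.
  have : w * (expR w - 1) <= w * (w * expR w) by rewrite ler_wpM2l.
  by rewrite expr2; lra.
have w0' : 0 <= - w by lra.
have := expRN_remainder_le w0'; rewrite opprK sqrrN => h.
apply: (@le_trans _ _ (w ^+ 2)); first by lra.
by rewrite ler_peMr ?sqr_ge0// -expR0 ler_expR.
Qed.

Lemma mulr_expRNM_le {R : realType} (c x : R) : 0 < c ->
  x * expR (- (x * c)) <= c^-1.
Proof.
move=> c0; rewrite -(ler_pM2r c0) mulVf ?gt_eqF//.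
have := mulr_expRN_le (x * c); have := expR_ge0 (- (x * c)); lra.
Qed.

(** The square of [mulr_expRNM_le] at rate [c / 2], whence the constant. *)
Lemma sqr_expRNM_le {R : realType} (c x : R) : 0 < c -> 0 <= x ->
  x ^+ 2 * expR (- (x * c)) <= 4 / c ^+ 2.
Proof.
move=> c0 x0; have c20 : 0 < c / 2 by lra.
have h := mulr_expRNM_le x c20.
have -> : x ^+ 2 * expR (- (x * c)) = (x * expR (- (x * (c / 2)))) ^+ 2.
  rewrite exprMn -expRM_natl; congr (_ * expR _); lra.
have -> : 4 / c ^+ 2 = ((c / 2)^-1) ^+ 2 by field; rewrite gt_eqF.
rewrite ler_sqr ?nnegrE ?invr_ge0 ?(ltW c20)//.
by rewrite mulr_ge0 ?expR_ge0.
Qed.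

(* With [d = u - w], [exp (- (x w))] is [exp (- (x u)) exp (x d)]; half of the
   decay [exp (- (x u))] absorbs the Taylor remainder uniformly in [x]. *)
Lemma expR_perturbation {R : realType} (c M D : R) : 0 < c -> 0 <= M -> 0 <= D ->
  exists2 C : R, 0 <= C & exists2 h0 : R, 0 < h0 &
  forall x u psi w h : R, 0 <= x -> c <= u -> `|psi| <= M -> 0 <= h <= h0 ->
    `|w - (u - h * psi)| <= D * h ^+ 2 ->
    `|expR (- (x * w)) - expR (- (x * u)) * (1 + x * h * psi)| <= C * h ^+ 2.
Proof.
move=> c0 M0 D0; have c20 : 0 < c / 2 by lra.
(* The first term is the second-order Taylor remainder, with [x ^+ 2] absorbed at rate [c / 2]; the
   second is the first-order effect of the error [D * h ^+ 2], with [x] absorbed at rate [c]. *)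
exists ((M + D) ^+ 2 * (4 / (c / 2) ^+ 2) + D * c^-1).
  rewrite addr_ge0// mulr_ge0// ?sqr_ge0// ?invr_ge0 ?ltW//.
  by rewrite divr_gt0 ?exprn_gt0.
(* [h <= 1] gives [h ^+ 2 <= h], hence [|u - w| <= (M + D) * h]; the other bound makes this at most
   [c / 2]. *)
exists (Num.min 1 (c / 2 / (M + D + 1))).
  by rewrite lt_min ltr01 divr_gt0//; lra.
move=> x u psi w h x0 cu psiM /andP[h0]; rewrite le_min => /andP[h1 hc] wh.
pose e := u - w.
have eh : `|e - h * psi| <= D * h ^+ 2.
  by rewrite -normrN; have -> : - (e - h * psi) = w - (u - h * psi) by rewrite /e; ring.
have hh : h ^+ 2 <= h by rewrite expr2 ler_piMr.
have ele : `|e| <= (M + D) * h.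
  have -> : e = (e - h * psi) + h * psi by ring.
  apply: (le_trans (ler_normD _ _)); rewrite normrM (ger0_norm h0).
  have a1 : D * h ^+ 2 <= D * h by rewrite ler_wpM2l.
  have a2 : h * `|psi| <= h * M by rewrite ler_wpM2l.
  by lra.
have ec : `|e| <= c / 2.
  apply: (le_trans ele); move: hc; rewrite ler_pdivlMr; lra.
have -> : expR (- (x * w)) = expR (- (x * u)) * expR (x * e).
  by rewrite -expRD; congr expR; rewrite /e; ring.
have -> : expR (- (x * u)) * expR (x * e) - expR (- (x * u)) * (1 + x * h * psi) =
    expR (- (x * u)) * (expR (x * e) - 1 - x * e) +
    (x * expR (- (x * u))) * (e - h * psi) by ring.
have xuc : expR (- (x * u)) <= expR (- (x * c)).
  by rewrite ler_expR lerN2 ler_wpM2l.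
apply: (le_trans (ler_normD _ _)); rewrite mulrDl lerD// !normrM.
  rewrite (ger0_norm (expR_ge0 _)).
  apply: (@le_trans _ _ (expR (- (x * c)) * ((x * e) ^+ 2 * expR (x * (c / 2))))).
    apply: ler_pM => //; rewrite ?expR_ge0//.
    apply: (le_trans (expR_taylor1 _)); rewrite ler_wpM2l ?sqr_ge0// ler_expR.
    by rewrite normrM (ger0_norm x0) ler_wpM2l.
  have -> : expR (- (x * c)) * ((x * e) ^+ 2 * expR (x * (c / 2))) =
     e ^+ 2 * (x ^+ 2 * expR (- (x * (c / 2)))).
    have -> : - (x * (c / 2)) = - (x * c) + x * (c / 2) by lra.
    rewrite expRD; ring.
  rewrite [leRHS]mulrAC; apply: ler_pM; rewrite ?sqr_ge0//.
  - by rewrite mulr_ge0// ?sqr_ge0 ?expR_ge0.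
  - rewrite -exprMn -[e ^+ 2]real_normK ?num_real//.
    by rewrite ler_sqr ?nnegrE// mulr_ge0// addr_ge0.
  - exact: sqr_expRNM_le.
rewrite (ger0_norm x0) (ger0_norm (expR_ge0 _)).
have -> : D * c^-1 * h ^+ 2 = c^-1 * (D * h ^+ 2) by ring.
apply: ler_pM => //; first by rewrite mulr_ge0 ?expR_ge0.
apply: le_trans (mulr_expRNM_le x c0).
by rewrite ler_wpM2l.
Qed.

(** * Polynomial approximation *)

(* [bernstein n g] evaluated at [x] is the expectation of [g] under the
   binomial law with parameters [n] and [x], conditioned on the first trial. *)
Fixpoint bernstein {R : realType} (n : nat) (g : nat -> R) : {poly R} :=
  if n is m.+1 then (1 - 'X) * bernstein m g + 'X * bernstein m (g \o succn)
  else (g 0%N)%:P.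

Lemma bernsteinS {R : realType} n (g : nat -> R) (x : R) :
  (bernstein n.+1 g).[x] =
  (1 - x) * (bernstein n g).[x] + x * (bernstein n (g \o succn)).[x].
Proof. by rewrite /= !hornerE. Qed.

Lemma le_bernstein {R : realType} n (f g : nat -> R) (x : R) : 0 <= x <= 1 ->
  (forall k, (k <= n)%N -> f k <= g k) -> (bernstein n f).[x] <= (bernstein n g).[x].
Proof.
move=> /andP[x0 x1]; elim: n f g => [|n IH] f g fg.
  by rewrite /= !hornerE fg.
rewrite !bernsteinS lerD// ler_wpM2l ?subr_ge0//; apply: IH => k kn.
  by rewrite fg// leqW.
exact: fg.
Qed.

Lemma bernstein_cst {R : realType} n (c x : R) : (bernstein n (fun=> c)).[x] = c.
Proof.
elim: n => [|n IH]; first by rewrite /= hornerE.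
rewrite bernsteinS.
have -> : (fun=> c) \o succn = (fun=> c) :> (nat -> R) by [].
by rewrite IH; ring.
Qed.

Lemma bernsteinD {R : realType} n (f g : nat -> R) (x : R) :
  (bernstein n (fun k => f k + g k)).[x] = (bernstein n f).[x] + (bernstein n g).[x].
Proof.
elim: n f g => [|n IH] f g; first by rewrite /= !hornerE.
by rewrite !bernsteinS IH (IH (f \o succn) (g \o succn)); ring.
Qed.

Lemma bernsteinZ {R : realType} n c (g : nat -> R) (x : R) :
  (bernstein n (fun k => c * g k)).[x] = c * (bernstein n g).[x].
Proof.
elim: n g => [|n IH] g; first by rewrite /= !hornerE.
by rewrite !bernsteinS IH (IH (g \o succn)); ring.
Qed.

(** The second moment of the binomial law. The shift [c] is general because the recursion replaces
    [k] by [k + 1]; at [c = - n x] the value is the variance. *)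
Lemma bernstein_sqr {R : realType} n (c x : R) :
  (bernstein n (fun k => (k%:R + c) ^+ 2)).[x] =
  (n%:R * x + c) ^+ 2 + n%:R * (x * (1 - x)).
Proof.
elim: n c => [|n IH] c; first by rewrite /= hornerE; ring.
rewrite bernsteinS IH.
have -> : (fun k : nat => (k%:R + c) ^+ 2) \o succn =
          (fun k : nat => (k%:R + (c + 1)) ^+ 2).
  by apply/funext => k /=; rewrite -natr1; ring.
rewrite IH -natr1; ring.
Qed.

Definition bounded_lipschitz {R : realType} (f : R -> R) :=
  exists2 C : R, 0 <= C &
    (forall x, `|f x| <= C) /\ (forall x y, `|f x - f y| <= C * `|x - y|).

Lemma bounded_lipschitzM {R : realType} (f g : R -> R) :
  bounded_lipschitz f -> bounded_lipschitz g ->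
  bounded_lipschitz (fun x => f x * g x).
Proof.
move=> [C C0 [fC fL]] [D D0 [gD gL]]; exists (C * D + (C * D + C * D)).
  by rewrite !addr_ge0// mulr_ge0.
split=> [x|x y].
  rewrite normrM; apply: (@le_trans _ _ (C * D)); first exact: ler_pM.
  by rewrite lerDl addr_ge0// mulr_ge0.
have -> : f x * g x - f y * g y = f x * (g x - g y) + (f x - f y) * g y by ring.
apply: (le_trans (ler_normD _ _)); rewrite !normrM.
apply: (@le_trans _ _ (C * (D * `|x - y|) + (C * `|x - y|) * D)).
  by rewrite lerD// ler_pM.
have : 0 <= C * D * `|x - y| by rewrite !mulr_ge0.
lra.
Qed.

Lemma bounded_lipschitz_onem {R : realType} (f : R -> R) :
  bounded_lipschitz f -> bounded_lipschitz (fun x => 1 - f x).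
Proof.
move=> [C C0 [fC fL]]; exists (1 + C); first lra.
split=> [x|x y].
  by apply: (le_trans (ler_normB _ _)); rewrite normr1 lerD2l.
have -> : 1 - f x - (1 - f y) = f y - f x by ring.
rewrite distrC; apply: (le_trans (fL _ _)); rewrite ler_wpM2r//; lra.
Qed.

Definition clamp01 {R : realType} (x : R) : R := Num.min 1 (Num.max 0 x).

Lemma clamp01_ge0 {R : realType} (x : R) : 0 <= clamp01 x.
Proof. by rewrite le_min ler01 le_max lexx. Qed.

Lemma clamp01_le1 {R : realType} (x : R) : clamp01 x <= 1.
Proof. by rewrite ge_min lexx. Qed.

Lemma clamp01_lipschitz {R : realType} (x y : R) :
  `|clamp01 x - clamp01 y| <= `|x - y|.
Proof.
rewrite /clamp01 /Num.min /Num.max.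
case: (ltP 0 x) => hx; case: (ltP 0 y) => hy; rewrite ?ltr10 ?ltr01;
  case: (ltP 1 x) => h1; case: (ltP 1 y) => h2; rewrite ?ltr10 ?ltr01 ler_norml;
  by have := ler_norm (x - y); have := ler_norm (- (x - y)); rewrite normrN; lra.
Qed.

Lemma clamp01_eq0 {R : realType} (x : R) : x <= 0 -> clamp01 x = 0.
Proof. by move=> x0; rewrite /clamp01 max_l// min_r. Qed.

Lemma clamp01_eq1 {R : realType} (x : R) : 1 <= x -> clamp01 x = 1.
Proof. by move=> x1; rewrite /clamp01 max_r ?min_l// (le_trans ler01). Qed.

Lemma bounded_lipschitz_clamp01 {R : realType} (c r : R) :
  bounded_lipschitz (fun x => clamp01 (c * (r - x))).
Proof.
exists (1 + `|c|); first by rewrite addr_ge0.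
split=> [x|x y].
  rewrite ger0_norm ?clamp01_ge0//; apply: (le_trans (clamp01_le1 _)).
  by rewrite lerDl.
apply: (le_trans (clamp01_lipschitz _ _)).
have -> : c * (r - x) - c * (r - y) = c * (y - x) by ring.
by rewrite normrM distrC ler_wpM2r// lerDr.
Qed.

(** Used to divide by [1 - z] on a region that stays away from [z = 1]. *)
Lemma bounded_lipschitz_inv_max {R : realType} (c : R) : 0 < c ->
  bounded_lipschitz (fun x => (Num.max (1 - x) c)^-1).
Proof.
move=> c0; have m0 x : 0 < Num.max (1 - x) c by rewrite lt_max c0 orbT.
have mc x : c <= Num.max (1 - x) c by rewrite le_max lexx orbT.
have ic x : (Num.max (1 - x) c)^-1 <= c^-1 by rewrite lef_pV2 ?posrE.
have ci0 : 0 < c^-1 by rewrite invr_gt0.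
exists (c^-1 + c^-1 * c^-1).
  by rewrite addr_ge0// ?mulr_ge0// ltW.
split=> [x|x y].
  rewrite ger0_norm; last by rewrite invr_ge0 ltW.
  apply: (le_trans (ic x)).
  by rewrite lerDl mulr_ge0// ltW.
have -> : (Num.max (1 - x) c)^-1 - (Num.max (1 - y) c)^-1 =
   (Num.max (1 - x) c)^-1 * (Num.max (1 - y) c)^-1 *
   (Num.max (1 - y) c - Num.max (1 - x) c).
  by field; rewrite !gt_eqF.
rewrite normrM; apply: ler_pM => //.
  rewrite ger0_norm; last by rewrite mulr_ge0// invr_ge0 ltW.
  apply: (@le_trans _ _ (c^-1 * c^-1)); last by rewrite lerDr ltW.
  by rewrite ler_pM// invr_ge0 ltW.
have := ler_norm (x - y); have := ler_norm (- (x - y)); rewrite normrN => n1 n2.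
by rewrite /Num.max; case: ltP => h1; case: ltP => h2; rewrite ler_norml; lra.
Qed.

(** Chebyshev's argument in pointwise form: a deviation [t] satisfies [t <= eta + t ^+ 2 / eta], so
    the Lipschitz bound is dominated by a quadratic function of the node, whose Bernstein value is
    explicit. Positivity of the Bernstein operator does the rest. *)
Lemma bernstein_approx {R : realType} (f : R -> R) (C e : R) : 0 <= C ->
  (forall x y, `|f x - f y| <= C * `|x - y|) -> 0 < e ->
  exists p : {poly R}, forall x, 0 <= x <= 1 -> `|f x - p.[x]| <= e.
Proof.
move=> C0 fL e0.
have [eta eta0 Ceta] : exists2 eta : R, 0 < eta & C * eta <= e / 2.
  exists (e / 2 / (C + 1)); first by rewrite !divr_gt0//; lra.
  rewrite mulrA ler_pdivrMr; last lra.
  by rewrite mulrDr mulr1 mulrC lerDl; lra.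
set n := Num.bound (C / eta / (e / 2)).
have hn : C / eta / (e / 2) < n%:R.
  by apply: archi_boundP; rewrite !divr_ge0//; lra.
have n0 : (0 : R) < n%:R.
  by apply: le_lt_trans hn; rewrite !divr_ge0//; lra.
exists (bernstein n (fun k => f (k%:R / n%:R))) => x x01.
have [x0 x1] := andP x01.
pose q k : R := C * eta + C / eta / n%:R ^+ 2 * (k%:R + (- (n%:R * x))) ^+ 2.
have fq k : `|f x - f (k%:R / n%:R)| <= q k.
  apply: (le_trans (fL _ _)); rewrite /q.
  set t := `|_|.
  have -> : C / eta / n%:R ^+ 2 * (k%:R + - (n%:R * x)) ^+ 2 = C * (t ^+ 2 / eta).
    rewrite /t -normrX ger0_norm ?sqr_ge0//; field.
    by rewrite !gt_eqF.
  rewrite -mulrDr ler_wpM2l//.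
  have -> : eta + t ^+ 2 / eta = (eta ^+ 2 + t ^+ 2) / eta.
    by field; rewrite gt_eqF.
  rewrite ler_pdivlMr//.
  have : 0 <= (eta - t) ^+ 2 by rewrite sqr_ge0.
  have : 0 <= t * eta by rewrite mulr_ge0 ?normr_ge0 ?(ltW eta0).
  by rewrite sqrrB; lra.
have Bq : (bernstein n q).[x] <= e.
  rewrite /q bernsteinD bernstein_cst bernsteinZ bernstein_sqr subrr.
  have -> : C / eta / n%:R ^+ 2 * (0 ^+ 2 + n%:R * (x * (1 - x))) =
            C / eta / n%:R * (x * (1 - x)).
    by field; rewrite !gt_eqF.
  have h1 : C / eta / n%:R <= e / 2.
    rewrite ler_pdivrMr//; move: hn; rewrite ltr_pdivrMr; last lra.
    by lra.
  have h2 : C / eta / n%:R * (x * (1 - x)) <= C / eta / n%:R * 1.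
    rewrite ler_wpM2l//; last nra.
    by rewrite !divr_ge0// ltW.
  lra.
rewrite ler_norml; apply/andP; split.
- rewrite lerBrDl -lerBrDr opprK -(bernstein_cst n (f x) x).
  apply: (@le_trans _ _ (bernstein n (fun k => f x + q k)).[x]).
    apply: le_bernstein => // k _; have := fq k; rewrite ler_norml => /andP[]; lra.
  by rewrite bernsteinD lerD2l.
- rewrite lerBlDr.
  apply: (@le_trans _ _ (bernstein n (fun k => q k + f (k%:R / n%:R))).[x]).
    rewrite -[leLHS](bernstein_cst n (f x) x).
    by apply: le_bernstein => // k _; have := fq k; rewrite ler_norml => /andP[]; lra.
  by rewrite bernsteinD lerD2r.
Qed.

Lemma polynomial_approx {R : realType} (f : R -> R) (Z e : R) :
  bounded_lipschitz f -> 0 < Z -> 0 < e ->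
  exists p : {poly R}, forall z, 0 <= z <= Z -> `|f z - p.[z]| <= e.
Proof.
move=> [C C0 [_ fL]] Z0 e0.
have CZ : 0 <= C * Z by rewrite mulr_ge0// ltW.
have [|p hp] := @bernstein_approx R (fun x => f (Z * x)) (C * Z) e CZ _ e0.
  move=> x y; apply: (le_trans (fL _ _)).
  by rewrite -mulrBr normrM (gtr0_norm Z0) mulrA.
exists (p \Po (Z^-1 *: 'X)) => z /andP[z0 zZ].
rewrite horner_comp !hornerE.
have := hp (Z^-1 * z); rewrite mulrA divff ?gt_eqF// mul1r; apply.
apply/andP; split; last by rewrite ler_pdivrMl// mulr1.
by rewrite mulr_ge0// invr_ge0 ltW.
Qed.

(** * Regular paths *)

(** Stands in for compactness of [[0, t]], by way of the supremum of the points where [Q] holds. [Q]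
    need not be monotone: the left step starts from a single earlier point [r], which adherence of
    the supremum provides. *)
Lemma real_induction {R : realType} (Q : R -> Prop) (t : R) : 0 <= t -> Q 0 ->
  (forall s, 0 <= s < t -> Q s ->
    exists2 e, 0 < e & forall r, s < r < s + e -> r <= t -> Q r) ->
  (forall s, 0 < s <= t ->
    exists2 e, 0 < e & forall r, 0 <= r -> s - e < r < s -> Q r -> Q s) ->
  Q t.
Proof.
move=> t0 Q0 Qr Ql.
pose S := [set s : R | 0 <= s <= t /\ Q s].
have S0 : S 0 by split; rewrite ?lexx.
have hS : has_sup S.
  split; first by exists 0.
  by exists t => s; case=> /andP[].
have ubS s : S s -> s <= sup S by move=> Ss; apply: ub_le_sup => //; case: hS.
have sup0 : 0 <= sup S by exact: ubS.
have supt : sup S <= t by apply: ge_sup; [by exists 0|by move=> s; case=> /andP[]].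
have Qs : Q (sup S).
  have [->//|s0] := eqVneq (sup S) 0.
  have {}s0 : 0 < sup S by rewrite lt_neqAle eq_sym s0.
  have [|e e0 he] := Ql (sup S); first by rewrite s0.
  have [r [/andP[r0 rt] Qr'] re] := sup_adherent e0 hS.
  have Sr : S r by split; rewrite ?r0.
  have := ubS r Sr; rewrite le_eqVlt => /predU1P[<-//|rs].
  by apply: (he r) => //; rewrite re.
have := supt; rewrite le_eqVlt => /predU1P[<-//|st].
have [|e e0 he] := Qr (sup S) _ Qs; first by rewrite sup0.
pose r := Num.min t (sup S + e / 2).
have e2 : 0 < e / 2 by rewrite divr_gt0.
have sr : sup S < r by rewrite lt_min st ltrDl.
have : r <= sup S.
  apply: ubS; split; first by rewrite ge_min lexx andbT (le_trans sup0)// ltW.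
  apply: he; last by rewrite ge_min lexx.
  rewrite sr/= gt_min; apply/orP; right; rewrite ltrD2l; lra.
by rewrite leNgt sr.
Qed.

Lemma rcll_right {R : realType} (f : R -> R) (t e : R) : rcll f -> 0 <= t -> 0 < e ->
  exists2 d, 0 < d & forall x, t <= x < t + d -> `|f x - f t| < e.
Proof.
move=> [fr _] t0 e0; have /cvgrPdist_lt/(_ e e0) := fr t t0.
move=> [d /= d0 hd]; exists d => // x /andP[].
rewrite le_eqVlt => /predU1P[<-|tx] xd; first by rewrite subrr normr0.
rewrite distrC; apply: hd => //=; rewrite distrC gtr0_norm; lra.
Qed.

Lemma rcll_left {R : realType} (f : R -> R) (t e : R) : rcll f -> 0 < t -> 0 < e ->
  exists2 d, 0 < d &
    forall x, t - d < x < t -> `|f x - lim (f r @[r --> t^'-])| < e.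
Proof.
move=> [_ fl] t0 e0; have /cvgrPdist_lt/(_ e e0) := fl t t0.
move=> [d /= d0 hd]; exists d => // x /andP[dx xt].
by rewrite distrC; apply: hd => //=; rewrite gtr0_norm; lra.
Qed.

Lemma rcll_bounded {R : realType} (f : R -> R) (t : R) : rcll f -> 0 <= t ->
  exists C, forall s, 0 <= s <= t -> `|f s| <= C.
Proof.
move=> rf t0; apply: (@real_induction _
  (fun t => exists C, forall s, 0 <= s <= t -> `|f s| <= C)) => //.
- exists `|f 0| => s /andP[s0 s1]; suff -> : s = 0 by [].
  by apply/le_anti; rewrite s0 s1.
- move=> s /andP[s0 st] [C hC]; have [d d0 hd] := rcll_right rf s0 ltr01.
  exists d => // r /andP[sr rd] _; exists (Num.max C (1 + `|f s|)) => x /andP[x0 xr].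
  rewrite le_max; have [xs|sx] := leP x s; first by rewrite hC// x0.
  apply/orP; right; have -> : f x = (f x - f s) + f s by ring.
  apply: (le_trans (ler_normD _ _)); rewrite lerD2r ltW// hd// ltW//=.
  by apply: le_lt_trans rd.
- move=> s /andP[s0 st]; have [d d0 hd] := rcll_left rf s0 ltr01.
  exists d => // r r0 /andP[sr rs] [C hC].
  set l := lim _ in hd; exists (Num.max C (Num.max (1 + `|l|) `|f s|)) => x /andP[x0 xr].
  rewrite !le_max; have [xs|rx] := leP x r; first by rewrite hC// x0.
  apply/orP; right; move: xr; rewrite le_eqVlt => /predU1P[->|xs].
    by rewrite lexx orbT.
  apply/orP; left; have -> : f x = (f x - l) + l by ring.
  apply: (le_trans (ler_normD _ _)); rewrite lerD2r ltW// hd// xs andbT.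
  exact: lt_trans rx.
Qed.

(** Passing to the left limit would weaken [<] to [<=]; the slack [d] left by the strict bound at
    [q] itself absorbs the distance to the limit. *)
Lemma jump_lt_osc {R : realType} (f : R -> R) (c e p q : R) : rcll f ->
  0 < q -> p < q -> (forall x, p < x <= q -> `|f x - c| < e / 2) -> jump f q < e.
Proof.
move=> rf q0 pq hc.
set l := lim (f r @[r --> q^'-]).
rewrite /jump -/l.
have hq : `|f q - c| < e / 2 by apply: hc; rewrite pq lexx.
pose d := e / 2 - `|f q - c|.
have d0 : 0 < d by rewrite /d subr_gt0.
have [r r0 hr] := rcll_left rf q0 d0.
pose x := Num.max ((p + q) / 2) (q - r / 2).
have xq : x < q by rewrite gt_max; apply/andP; split; lra.
have px : p < x by rewrite lt_max; apply/orP; left; lra.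
have rx : q - r < x by rewrite lt_max; apply/orP; right; lra.
have h1 : `|f x - l| < d by apply: hr; rewrite rx.
have h2 : `|f x - c| < e / 2 by apply: hc; rewrite px ltW.
move: h1 h2; rewrite /d !ltr_norml => /andP[_ h1] /andP[h2 _].
by have := ler_norm (f q - c); lra.
Qed.

(** * Increments along refining grids *)

Lemma near_mesh_lt {R : realType} (t e : R) : 0 < e ->
  \forall n \near \oo, t / n.+1%:R < e.
Proof.
move=> e0; have te0 : 0 < `|t| / e + 1 by rewrite ltr_pwDr// divr_ge0// ltW.
exists (Num.bound (`|t| / e)) => // n /= nb.
rewrite ltr_pdivrMr// (le_lt_trans (ler_norm _))//.
rewrite mulrC -ltr_pdivrMr//.
apply: (lt_le_trans (archi_boundP _)); first by rewrite divr_ge0// ltW.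
by rewrite ler_nat leqW.
Qed.

(** A cell counts as soon as its left end lies before [r]. The product can thus be cut exactly at
    any real [r], on the grid or not, as [real_induction] requires. *)
Definition increment_prod {R : realType} (g f : R -> R) (h : R) (N : nat) (r : R) : R :=
  \prod_(k < N | k%:R * h < r) (1 - g (f (k.+1%:R * h) - f (k%:R * h))).

Lemma increment_prod_split {R : realType} (g f : R -> R) (h : R) N (r s : R) :
  r <= s -> increment_prod g f h N s = increment_prod g f h N r *
   \prod_(k < N | r <= k%:R * h < s) (1 - g (f (k.+1%:R * h) - f (k%:R * h))).
Proof.
move=> rs; rewrite /increment_prod (bigID (fun k : 'I_N => k%:R * h < r))/=.
congr (_ * _); apply: eq_bigl => k; last by rewrite -leNgt andbC.
by case: (ltP (k%:R * h) r) => kr; rewrite ?andbF// andbT (lt_le_trans kr).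
Qed.

(** Cells are open on the left: as the mesh shrinks, the left end tends to [s] strictly from below
    and the right end from above or at [s], so the increment tends to the jump. *)
Lemma exists_grid_cell {R : realType} (h s : R) : 0 < h -> 0 < s ->
  exists k : nat, k%:R * h < s <= k.+1%:R * h.
Proof.
move=> h0 s0.
have ex : exists k : nat, s <= k.+1%:R * h.
  exists (Num.bound (s / h)); rewrite -ler_pdivrMr// ltW//.
  apply: (lt_le_trans (archi_boundP _)); first by rewrite divr_ge0// ltW.
  by rewrite ler_nat.
case: (ex_minnP ex) => k hk kmin; exists k; rewrite hk andbT.
case: k {hk} kmin => [_|k kmin]; first by rewrite mul0r.
by rewrite ltNge; apply/negP => /kmin; rewrite ltnn.
Qed.

Lemma cvg_increment_prod_step {R : realType} (g f : R -> R) (t r s a b : R) :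
  r <= s ->
  increment_prod g f (t / n.+1%:R) n.+1 r @[n --> \oo] --> a ->
  (\prod_(k < n.+1 | r <= k%:R * (t / n.+1%:R) < s)
     (1 - g (f (k.+1%:R * (t / n.+1%:R)) - f (k%:R * (t / n.+1%:R)))))
     @[n --> \oo] --> b ->
  increment_prod g f (t / n.+1%:R) n.+1 s @[n --> \oo] --> a * b.
Proof.
move=> rs ha hb; under eq_fun do rewrite (increment_prod_split _ _ _ _ rs).
exact: cvgM.
Qed.

(** The room [h] beyond [r] is for the last cell, which starts before [r] but may end after it. *)
Lemma prod_increments_eq1 {R : realType} (g f : R -> R) (b c d h s r : R) N :
  (forall y, y <= b -> g y = 0) ->
  (forall x, s <= x < d -> `|f x - c| < b / 2) -> 0 < h -> r + h < d ->
  \prod_(k < N | s <= k%:R * h < r) (1 - g (f (k.+1%:R * h) - f (k%:R * h))) = 1.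
Proof.
move=> g0 hc h0 rd; rewrite big1// => k /andP[sk kr].
rewrite g0 ?subr0//.
have e1 : k.+1%:R * h = k%:R * h + h by rewrite -natr1 mulrDl mul1r.
move: (k%:R * h) (k.+1%:R * h) sk kr e1 => u v su ur ->.
have hu : s <= u < d by rewrite su/=; lra.
have huh : s <= u + h < d by apply/andP; split; lra.
have := hc _ huh; have := hc _ hu; rewrite !ltr_norml => /andP[? ?] /andP[? ?]; lra.
Qed.

(* For small mesh an increment exceeds [b] only across a jump time. *)
Lemma rcll_jumps {R : realType} (f : R -> R) (t b : R) : rcll f -> 0 < t -> 0 < b ->
  exists J : seq R,
  (forall g : R -> R, continuous g -> (forall y, y <= b -> g y = 0) ->
    increment_prod g f (t / n.+1%:R) n.+1 t @[n --> \oo] --> \prod_(y <- J) (1 - g y)) /\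
  (forall B : set R, B `<=` `]b, +oo[ ->
    (exists2 s, 0 < s <= t & B (jump f s)) <-> (exists2 y, y \in J & B y)).
Proof.
move=> rf t0 b0.
have b20 : 0 < b / 2 by rewrite divr_gt0.
have hn0 n : 0 < t / n.+1%:R by rewrite divr_gt0.
pose Q r := r <= t -> exists J : seq R,
  (forall g : R -> R, continuous g -> (forall y, y <= b -> g y = 0) ->
    increment_prod g f (t / n.+1%:R) n.+1 r @[n --> \oo] --> \prod_(y <- J) (1 - g y)) /\
  (forall B : set R, B `<=` `]b, +oo[ ->
    (exists2 s, 0 < s <= r & B (jump f s)) <-> (exists2 y, y \in J & B y)).
suff : Q t by apply.
have nojump B p q c : B `<=` `]b, +oo[ -> 0 < q -> p < q ->
    (forall x, p < x <= q -> `|f x - c| < b / 2) -> ~ B (jump f q).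
  move=> Bb q0 pq hc /Bb; rewrite /= in_itv/= andbT => bj.
  by have := jump_lt_osc rf q0 pq hc; rewrite ltNge (ltW bj).
apply: real_induction; first exact: ltW.
- move=> _; exists [::]; split=> [g _ _|B _]; last first.
    split=> [[s /andP[s0 s1]]|[y]//]; lra.
  rewrite big_nil /increment_prod; under eq_fun.
    move=> n; rewrite big1; first over.
    by move=> k; rewrite ltNge mulr_ge0// ltW.
  exact: cvg_cst.
- move=> s /andP[s0 st] /(_ (ltW st))[J [Jprod Jjump]].
  have [d d0 hd] := rcll_right rf s0 b20.
  exists d => // r /andP[sr rd] rt _; exists J; split=> [g cg g0|B Bb].
    rewrite -[X in _ --> X]mulr1.
    apply: (cvg_increment_prod_step (ltW sr) (Jprod _ cg g0)).
    apply: cvg_near_cst; have sdr : 0 < s + d - r by lra.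
    apply: filterS (near_mesh_lt t sdr) => n hn.
    by apply: (prod_increments_eq1 _ g0 hd (hn0 n)); rewrite -ltrBrDl (lt_le_trans hn)//; lra.
  rewrite -(Jjump B Bb); split=> [] [q /andP[q0 qr] Bq]; last first.
    by exists q => //; rewrite q0 (le_trans qr)// ltW.
  exists q => //; rewrite q0 leNgt; apply/negP => sq; move: Bq.
  apply: (nojump _ s q (f s)) => // x /andP[sx xq].
  by apply: hd; rewrite ltW//= (le_lt_trans xq)// (le_lt_trans qr).
- move=> s /andP[s0 st].
  have [d d0 hd] := rcll_left rf s0 b20; set l := lim _ in hd.
  exists d => // r r0 /andP[dr rs] Qr _.
  have [J [Jprod Jjump]] := Qr (le_trans (ltW rs) st).
  (* The jump at [s] joins the list whatever its size: if it is at most [b], its factor is [1 - 0]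
     and no [B] contains it. *)
  exists (jump f s :: J); split=> [g cg g0|B Bb]; last first.
    split=> [[q /andP[q0 qs] Bq]|[y]].
      have [qr|rq] := leP q r.
        have [|y yJ By] := (Jjump B Bb).1; first by exists q => //; rewrite q0.
        by exists y => //; rewrite inE yJ orbT.
      move: qs; rewrite le_eqVlt => /predU1P[qs|qs].
        by exists (jump f s); rewrite ?inE ?eqxx// -qs.
      exfalso; move: Bq; apply: (nojump _ r q l) => // x /andP[rx xq].
      by apply: hd; rewrite (le_lt_trans xq)// (lt_trans dr).
    rewrite inE => /predU1P[->|yJ] By; first by exists s; rewrite // s0/=.
    have [|q /andP[q0 qr] Bq] := (Jjump B Bb).2; first by exists y.
    by exists q => //; rewrite q0 (le_trans qr)// ltW.
  rewrite big_cons mulrC.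
  apply: (cvg_increment_prod_step (ltW rs) (Jprod _ cg g0)).
  (* Among the cells that start in [[r, s[], the last one contains [s] and its increment tends to
     the jump. The others lie in []s - d, s[], where [f] stays within [b / 2] of its left limit, so
     their factors are 1. *)
  pose h n := t / n.+1%:R.
  have /boolp.choice[k hk] : forall n, exists k : nat, k%:R * h n < s <= k.+1%:R * h n.
    by move=> n; exact: (exists_grid_cell (hn0 n) s0).
  have kN n : (k n < n.+1)%N.
    rewrite -(ltr_nat R) -(ltr_pM2r (hn0 n)); have /andP[hkn _] := hk n.
    by apply: (lt_le_trans hkn); rewrite /h mulrC divfK ?pnatr_eq0.
  have e1 n : (k n).+1%:R * h n = (k n)%:R * h n + h n by rewrite -natr1 mulrDl mul1r.
  have incr : f ((k n).+1%:R * h n) - f ((k n)%:R * h n) @[n --> \oo] --> jump f s.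
    apply: cvgB; apply/cvgrPdist_lt => e e0.
      have [d' d'0 hd'] := rcll_right rf (ltW s0) e0.
      apply: filterS (near_mesh_lt t d'0) => n hn.
      rewrite distrC; apply: hd'; have /andP[h1 h2] := hk n; rewrite h2 e1/=.
      by rewrite -/(h n) in hn; lra.
    have [d' d'0 hd'] := rcll_left rf s0 e0.
    apply: filterS (near_mesh_lt t d'0) => n hn.
    rewrite distrC; apply: hd'; have /andP[h1 h2] := hk n; rewrite h1 andbT.
    by rewrite -/(h n) in hn; move: h2; rewrite e1; lra.
  have : 1 - g (f ((k n).+1%:R * h n) - f ((k n)%:R * h n)) @[n --> \oo]
      --> 1 - g (jump f s).
    apply: cvgB; first exact: cvg_cst.
    exact: (continuous_cvg _ (cg _) incr).
  apply: cvg_trans; apply: near_eq_cvg.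
  have sr0 : 0 < s - r by lra.
  apply: filterS (near_mesh_lt t sr0) => n hn; rewrite -/(h n) in hn *.
  have /andP[h1 h2] := hk n; rewrite e1 in h2.
  rewrite (bigD1 (Ordinal (kN n)))/=; last by rewrite h1 andbT; lra.
  rewrite big1 ?mulr1// => i /andP[/andP[ri isn] ik].
  rewrite g0 ?subr0//.
  have ei : i.+1%:R * h n = i%:R * h n + h n by rewrite -natr1 mulrDl mul1r.
  have is_lt : i.+1%:R * h n < s.
    have ltik : (i < k n)%N.
      have : (i < (k n).+1)%N.
        rewrite -(ltr_nat R) -(ltr_pM2r (hn0 n)) -/(h n).
        by apply: (lt_le_trans isn); rewrite e1.
      rewrite ltnS leq_eqVlt => /predU1P[eik|//]; case/negP: ik.
      by apply/eqP/val_inj.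
    by apply: le_lt_trans h1; rewrite ler_pM2r ?hn0// ler_nat.
  have hi : s - d < i%:R * h n < s by rewrite isn andbT; lra.
  have hi1 : s - d < i.+1%:R * h n < s.
    by rewrite is_lt andbT ei; have := hn0 n; rewrite -/(h n); lra.
  have := hd _ hi; have := hd _ hi1.
  by rewrite !ltr_norml => /andP[? ?] /andP[? ?]; lra.
Qed.

(** Absence of jumps in [A] up to [t] only gives [t <= first_jump_time]. Strictness comes from right
    continuity at [t], which excludes jumps larger than [a] on a whole interval to the right of
    [t]. *)
Lemma lt_first_jump_time {R : realType} {d : measure_display} {T : measurableType d}
    (X : R -> T -> R) (a : R) (A : set R) (w : T) (t : R) :
  rcll (X ^~ w) -> 0 < a -> A `<=` `]a, +oo[ -> 0 < t ->
  (t%:E < first_jump_time X A w)%E <->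
  ~ (exists2 s, 0 < s <= t & A (jump (X ^~ w) s)).
Proof.
move=> rX a0 Aa t0; split=> [tlt [s /andP[s0 st] As]|nj].
  have : (first_jump_time X A w <= s%:E)%E by apply: ereal_inf_lbound; exists s.
  by rewrite leNgt (le_lt_trans _ tlt)// lee_fin.
have a20 : 0 < a / 2 by rewrite divr_gt0.
have [e e0 he] := rcll_right rX (ltW t0) a20.
apply: (@lt_le_trans _ _ (t + e)%:E); first by rewrite lte_fin ltrDl.
apply: le_ereal_inf_tmp => _ [s [s0 As] <-]; rewrite lee_fin leNgt; apply/negP => ste.
apply: nj; exists s => //; rewrite s0 leNgt; apply/negP => ts.
have := Aa _ As; rewrite /= in_itv/= andbT ltNge => /negP; apply; apply: ltW.
apply: (jump_lt_osc rX s0 ts (c := X t w)) => x /andP[tx xs].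
by apply: he; rewrite ltW//= (le_lt_trans xs).
Qed.

(** * Linear operations on integrable real functions *)

Lemma integrableZl_EFin {R : realType} {d : measure_display} {T : measurableType d}
    (mu : {measure set T -> \bar R}) (D : set T) (c : R) (f : T -> R) :
  measurable D -> mu.-integrable D (EFin \o f) ->
  mu.-integrable D (EFin \o (fun x => c * f x)).
Proof.
move=> mD fi; have : mu.-integrable D (fun x => c%:E * (EFin \o f) x)%E.
  exact: integrableZl.
by apply: eq_integrable => // x _ /=; rewrite EFinM.
Qed.

Lemma integrableB_EFin {R : realType} {d : measure_display} {T : measurableType d}
    (mu : {measure set T -> \bar R}) (D : set T) (f g : T -> R) :
  measurable D -> mu.-integrable D (EFin \o f) -> mu.-integrable D (EFin \o g) ->
  mu.-integrable D (EFin \o (fun x => f x - g x)).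
Proof.
move=> mD fi gi; have : mu.-integrable D ((EFin \o f) \- (EFin \o g))%E.
  exact: integrableB.
by apply: eq_integrable => // x _ /=; rewrite EFinB.
Qed.

Lemma integrableD_EFin {R : realType} {d : measure_display} {T : measurableType d}
    (mu : {measure set T -> \bar R}) (D : set T) (f g : T -> R) :
  measurable D -> mu.-integrable D (EFin \o f) -> mu.-integrable D (EFin \o g) ->
  mu.-integrable D (EFin \o (fun x => f x + g x)).
Proof.
move=> mD fi gi; have : mu.-integrable D ((EFin \o f) \+ (EFin \o g))%E.
  exact: integrableD.
by apply: eq_integrable => // x _ /=; rewrite EFinD.
Qed.

(** * Branching mechanisms *)

Definition levy_min {R : realType} (theta : R) : R := Num.min theta (theta ^+ 2).

Lemma levy_min_ge0 {R : realType} (theta : R) : 0 < theta -> 0 <= levy_min theta.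
Proof. by move=> t0; rewrite le_min ltW//= sqr_ge0. Qed.

(** With [z = (u - w) * theta], the difference is [z - exp (- w theta) (1 - exp (- z))]. From
    [z exp (- z) <= 1 - exp (- z)] it is at most [z (1 - exp (- u theta))], and the last factor is
    bounded both by 1 and by [u * theta]: the two branches of [levy_min]. *)
Lemma expRN_remainder_lipschitz {R : realType} (u w L theta : R) :
  0 <= w -> w <= u -> u <= L -> 0 < theta ->
  0 <= (expR (- (u * theta)) - 1 + u * theta) - (expR (- (w * theta)) - 1 + w * theta)
    <= (u - w) * (1 + L) * levy_min theta.
Proof.
move=> w0 wu uL t0; set z := (u - w) * theta.
have z0 : 0 <= z by rewrite mulr_ge0 ?subr_ge0// ltW.
have e1 : expR (- (u * theta)) = expR (- (w * theta)) * expR (- z).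
  by rewrite -expRD; congr expR; rewrite /z; ring.
have e2 : u * theta = w * theta + z by rewrite /z; ring.
have -> : expR (- (u * theta)) - 1 + u * theta - (expR (- (w * theta)) - 1 + w * theta)
    = z - expR (- (w * theta)) * (1 - expR (- z)).
  by rewrite e1 e2; ring.
have h1 := subr_expRN_le z.
have h2 := mulr_expRN_le z.
have ew0 := expR_gt0 (- (w * theta)).
have ew1 : expR (- (w * theta)) <= 1.
  by rewrite -expR0 ler_expR oppr_le0 mulr_ge0// ltW.
have ez1 : expR (- z) <= 1 by rewrite -expR0 ler_expR oppr_le0.
apply/andP; split.
  have : expR (- (w * theta)) * (1 - expR (- z)) <= 1 * (1 - expR (- z)).
    by rewrite ler_wpM2r// subr_ge0.
  lra.
have h3 : z * (expR (- (w * theta)) * expR (- z)) <=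
    expR (- (w * theta)) * (1 - expR (- z)).
  by rewrite mulrCA ler_wpM2l// ltW.
apply: (@le_trans _ _ (z * (1 - expR (- (u * theta))))).
  by rewrite mulrBr mulr1 e1; lra.
have -> : (u - w) * (1 + L) * levy_min theta = (u - w) * ((1 + L) * levy_min theta).
  ring.
rewrite /z -mulrA ler_wpM2l ?subr_ge0//.
have u0 : 0 <= u by exact: le_trans wu.
have a1 : 1 - expR (- (u * theta)) <= 1 by have := expR_gt0 (- (u * theta)); lra.
have a2 := subr_expRN_le (u * theta).
have a3 : theta * (1 - expR (- (u * theta))) <= theta * 1 by rewrite ler_wpM2l// ltW.
have a4 : theta * (1 - expR (- (u * theta))) <= theta * (u * theta).
  by rewrite ler_wpM2l// ltW.
have a5 : u * theta ^+ 2 <= L * theta ^+ 2 by rewrite ler_wpM2r// sqr_ge0.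
have L0 : 0 <= L by lra.
have m0 : 0 <= L * levy_min theta by rewrite mulr_ge0// levy_min_ge0.
have t20 := sqr_ge0 theta.
have Lt0 : 0 <= L * theta by rewrite mulr_ge0// ltW.
rewrite /levy_min /Num.min in m0 *; case: ltP => tt; rewrite ?expr2 in a5 t20 tt *; lra.
Qed.

Lemma sqr_expRN_le_levy_min {R : realType} (theta : R) : 0 < theta ->
  (1 - expR (- theta)) ^+ 2 <= levy_min theta.
Proof.
move=> t0; have h1 := subr_expRN_le theta.
have h2 : 0 <= 1 - expR (- theta) <= 1.
  have := expR_gt0 (- theta); have : expR (- theta) <= 1.
    by rewrite -expR0 ler_expR oppr_le0 ltW.
  lra.
move: (1 - _) h1 h2 => y yt /andP[y0 y1].
rewrite /levy_min le_min; apply/andP; split.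
  by rewrite expr2; have : y * y <= y * 1; [rewrite ler_wpM2l|lra].
by rewrite ler_sqr ?nnegrE// ltW.
Qed.

Section levy_integrals.
Context {R : realType} (pi : {measure set (measurableTypeR R) -> \bar R}).
Hypothesis pi_moment :
  (\int[pi]_(theta in `]0%R, +oo[) (Num.min theta (theta ^+ 2))%:E < +oo)%E.
Local Notation D := (`]0%R, +oo[%classic : set R).

Lemma gt0_in_itv (x : R) : D x -> 0 < x.
Proof. by rewrite /= in_itv/= andbT. Qed.

Definition levy_mass : R := \int[pi]_(theta in D) levy_min theta.

Lemma measurable_levy_min : measurable_fun (setT : set (measurableTypeR R)) (@levy_min R).
Proof. exact: measurable_minr. Qed.

Lemma integrable_levy_min : pi.-integrable D (EFin \o @levy_min R).
Proof.
apply/integrableP; split.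
  by apply/measurable_EFinP; apply: measurable_funS measurable_levy_min.
apply: le_lt_trans pi_moment; apply: ge0_le_integral => //=.
- by apply/measurable_EFinP; apply: measurable_funS (measurableT_comp _ measurable_levy_min).
- by apply/measurable_EFinP; apply: measurable_funS measurable_levy_min.
- move=> x /gt0_in_itv x0; rewrite lee_fin ger0_norm//.
  exact: levy_min_ge0.
Qed.

Lemma levy_mass_ge0 : 0 <= levy_mass.
Proof.
by apply: Rintegral_ge0 => x /gt0_in_itv; exact: levy_min_ge0.
Qed.

Lemma levy_integrable (f : R -> R) (C : R) :
  measurable_fun (setT : set (measurableTypeR R)) f ->
  (forall theta, 0 < theta -> `|f theta| <= C * levy_min theta) ->
  pi.-integrable D (EFin \o f).
Proof.
move=> mf fC.
have : pi.-integrable D (EFin \o (fun x => C * levy_min x)).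
  by apply: (integrableZl_EFin _ _ integrable_levy_min).
apply: le_integrable => //.
  by apply/measurable_EFinP; apply: measurable_funS mf.
move=> x /gt0_in_itv x0; rewrite lee_fin.
by apply: (le_trans (fC _ x0)); exact: ler_norm.
Qed.

Lemma le_levy_integral (f : R -> R) (C : R) :
  measurable_fun (setT : set (measurableTypeR R)) f ->
  (forall theta, 0 < theta -> `|f theta| <= C * levy_min theta) ->
  `|\int[pi]_(theta in D) f theta| <= C * levy_mass.
Proof.
move=> mf fC; have fi := levy_integrable mf fC.
apply: (le_trans (le_normr_Rintegral _ fi)) => //.
rewrite /levy_mass -RintegralZl//; last exact: integrable_levy_min.
apply: le_Rintegral => //.
- exact: (integrable_norm fi).
- exact: (integrableZl_EFin _ _ integrable_levy_min).
- by move=> x /gt0_in_itv; exact: fC.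
Qed.

Lemma measurable_expRN_mul (u : R) :
  measurable_fun (setT : set (measurableTypeR R)) (fun theta : R => expR (- (u * theta))).
Proof.
by apply: measurableT_comp => //; apply: measurableT_comp.
Qed.

Lemma measurable_expRN_remainder (u : R) :
  measurable_fun (setT : set (measurableTypeR R))
    (fun theta : R => expR (- (u * theta)) - 1 + u * theta).
Proof.
apply: measurable_funD; last exact: measurable_funM.
by apply: measurable_funB => //; exact: measurable_expRN_mul.
Qed.

Lemma expRN_remainder_norm_le (u theta : R) : 0 <= u -> 0 < theta ->
  `|expR (- (u * theta)) - 1 + u * theta| <= u * (1 + u) * levy_min theta.
Proof.
move=> u0 t0; have := expRN_remainder_lipschitz (lexx 0) u0 (lexx u) t0.
rewrite !mul0r oppr0 expR0 subrr !addr0 !subr0 => /andP[h1 h2].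
by rewrite ger0_norm.
Qed.

Lemma integrable_expRN_remainder (u : R) : 0 <= u ->
  pi.-integrable D (EFin \o (fun theta => expR (- (u * theta)) - 1 + u * theta)).
Proof.
move=> u0; apply: (levy_integrable (C := u * (1 + u))).
  exact: measurable_expRN_remainder.
by move=> theta; exact: expRN_remainder_norm_le.
Qed.

Lemma branching_mechanism_lipschitz (alpha beta L : R) : 0 <= L ->
  exists2 C : R, 0 <= C & forall u w, 0 <= u <= L -> 0 <= w <= L ->
    `|branching_mechanism alpha beta pi u - branching_mechanism alpha beta pi w|
      <= C * `|u - w|.
Proof.
move=> L0; have mass0 := levy_mass_ge0.
exists (`|alpha| + `|beta| * (2 * L) + (1 + L) * levy_mass).
  by rewrite !addr_ge0 ?mulr_ge0// addr_ge0.
move=> u w; wlog : u w / w <= u.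
  move=> H hu hw; have [wu|uw] := leP w u; first exact: H.
  by rewrite distrC (distrC u); apply: H => //; exact: ltW.
move=> wu /andP[u0 uL] /andP[w0 wL].
rewrite /branching_mechanism.
set I1 := (\int[pi]_(theta in _) (expR (- (u * theta)) - 1 + u * theta)).
set I2 := (\int[pi]_(theta in _) (expR (- (w * theta)) - 1 + w * theta)).
have -> : alpha * u + beta * u ^+ 2 + I1 - (alpha * w + beta * w ^+ 2 + I2) =
  alpha * (u - w) + beta * (u + w) * (u - w) + (I1 - I2) by ring.
have I12 : `|I1 - I2| <= (1 + L) * levy_mass * `|u - w|.
  rewrite /I1 /I2 -RintegralB//; [|exact: integrable_expRN_remainder..].
  rewrite -mulrA [levy_mass * _]mulrC mulrA mulrC.
  have -> : levy_mass * ((1 + L) * `|u - w|) = (`|u - w| * (1 + L)) * levy_mass by ring.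
  apply: le_levy_integral.
    by apply: measurable_funB; exact: measurable_expRN_remainder.
  move=> theta t0; have /andP[h1 h2] := expRN_remainder_lipschitz w0 wu uL t0.
  by rewrite ger0_norm// (@ger0_norm _ (u - w)) ?subr_ge0.
apply: (le_trans (ler_normD _ _)); rewrite [leRHS]mulrDl lerD//.
apply: (le_trans (ler_normD _ _)); rewrite [leRHS]mulrDl !normrM lerD//.
rewrite ler_wpM2r// ler_wpM2l// ger0_norm; lra.
Qed.

Lemma branching_mechanism0 (alpha beta : R) : branching_mechanism alpha beta pi 0 = 0.
Proof.
rewrite /branching_mechanism mulr0 expr0n/= mulr0 !add0r.
under eq_Rintegral => x _ do rewrite !mul0r oppr0 expR0 subrr addr0.
by rewrite /Rintegral integral0.
Qed.

Lemma branching_mechanism_ge (alpha beta u : R) : 0 <= beta -> 0 <= u ->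
  alpha * u <= branching_mechanism alpha beta pi u.
Proof.
move=> b0 u0; rewrite /branching_mechanism -addrA lerDl addr_ge0//.
  by rewrite mulr_ge0// sqr_ge0.
apply: Rintegral_ge0 => x _; have := expR_ge1Dx (- (u * x)); lra.
Qed.

(* The second difference of [exp (- u theta)] in [u] is
   [exp (- u theta) (1 - exp (- theta)) ^+ 2]. *)
Lemma branching_mechanism_second_diff (alpha beta u : R) : 0 <= u ->
  branching_mechanism alpha beta pi u
  - 2 * branching_mechanism alpha beta pi (u + 1)
  + branching_mechanism alpha beta pi (u + 2) =
  2 * beta + \int[pi]_(theta in D) (expR (- (u * theta)) * (1 - expR (- theta)) ^+ 2).
Proof.
move=> u0; rewrite /branching_mechanism.
pose k (v theta : R) := expR (- (v * theta)) - 1 + v * theta.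
have ik v : 0 <= v -> pi.-integrable D (EFin \o k v) by exact: integrable_expRN_remainder.
have i1 := ik _ u0.
have i2 : pi.-integrable D (EFin \o k (u + 1)) by apply: ik; lra.
have i3 : pi.-integrable D (EFin \o k (u + 2)) by apply: ik; lra.
have i2' : pi.-integrable D (EFin \o (fun th => 2 * k (u + 1) th)).
  exact: (integrableZl_EFin _ _ i2).
have -> : \int[pi]_(theta in D) (expR (- (u * theta)) * (1 - expR (- theta)) ^+ 2) =
   \int[pi]_(theta in D) k u theta - 2 * \int[pi]_(theta in D) k (u + 1) theta
   + \int[pi]_(theta in D) k (u + 2) theta.
  rewrite -RintegralZl// -RintegralB// -RintegralD//; last first.
    exact: (integrableB_EFin _ i1 i2').
  apply: eq_Rintegral => th _; rewrite /k.
  have -> : - ((u + 1) * th) = - (u * th) + - th by ring.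
  have -> : - ((u + 2) * th) = - (u * th) + (- th + - th) by ring.
  rewrite !expRD; ring.
rewrite /k; ring.
Qed.

End levy_integrals.

(** * Killing rates *)

Lemma expRN_lipschitz {R : realType} (a b : R) : 0 <= a -> 0 <= b ->
  `|expR (- a) - expR (- b)| <= `|a - b|.
Proof.
wlog : a b / a <= b.
  move=> H a0 b0; have [ab|ba] := leP a b; first exact: H.
  by rewrite distrC (distrC a); apply: H => //; exact: ltW.
move=> ab a0 b0; rewrite (@ler0_norm _ (a - b)) ?subr_le0// opprB.
have -> : expR (- a) - expR (- b) = expR (- a) * (1 - expR (- (b - a))).
  by rewrite mulrBr mulr1 -expRD; congr (_ - expR _); ring.
have h1 := subr_expRN_le (b - a).
have h2 : expR (- a) <= 1 by rewrite -expR0 ler_expR oppr_le0.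
have h3 : 0 <= 1 - expR (- (b - a)).
  by rewrite subr_ge0 -expR0 ler_expR oppr_le0 subr_ge0.
rewrite ger0_norm ?mulr_ge0 ?expR_ge0//.
by apply: le_trans h1; rewrite ler_piMl.
Qed.

(** The bound on [g theta] makes the killing rate finite; the bound on [theta * g theta] makes it
    Lipschitz in [u], where a variation of [u] brings down a factor [theta]. *)
Definition levy_cutoff {R : realType} (B : R) (g : R -> R) :=
  measurable_fun (setT : set (measurableTypeR R)) g /\
  forall theta, 0 < theta ->
    [/\ 0 <= g theta, g theta <= B * levy_min theta &
        theta * g theta <= B * levy_min theta].

Definition killing_rate {R : realType} (pi : {measure set (measurableTypeR R) -> \bar R})
    (g : R -> R) (u : R) : R :=
  \int[pi]_(theta in `]0, +oo[) (g theta * expR (- (u * theta))).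

Section killing.
Context {R : realType} (pi : {measure set (measurableTypeR R) -> \bar R}).
Hypothesis pi_moment :
  (\int[pi]_(theta in `]0%R, +oo[) (Num.min theta (theta ^+ 2))%:E < +oo)%E.
Local Notation D := (`]0%R, +oo[%classic : set R).
Local Notation mass := (levy_mass pi).

Lemma measurable_cutoff_expRN (B : R) (g : R -> R) (u : R) : levy_cutoff B g ->
  measurable_fun (setT : set (measurableTypeR R)) (fun theta : R => g theta * expR (- (u * theta))).
Proof. by move=> [mg _]; apply: measurable_funM => //; exact: measurable_expRN_mul. Qed.

Lemma cutoff_expRN_le (B : R) (g : R -> R) (u theta : R) : levy_cutoff B g ->
  0 <= u -> 0 < theta -> `|g theta * expR (- (u * theta))| <= B * levy_min theta.
Proof.
move=> [_ gB] u0 t0; have [g0 g1 _] := gB _ t0.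
rewrite ger0_norm ?mulr_ge0 ?expR_ge0//; apply: le_trans g1.
by rewrite ler_piMr// -expR0 ler_expR oppr_le0 mulr_ge0// ltW.
Qed.

Lemma integrable_cutoff_expRN (B : R) (g : R -> R) (u : R) : levy_cutoff B g -> 0 <= u ->
  pi.-integrable D (EFin \o (fun theta => g theta * expR (- (u * theta)))).
Proof.
move=> gB u0; apply: (levy_integrable pi_moment (C := B)).
  exact: measurable_cutoff_expRN gB.
by move=> theta t0; exact: cutoff_expRN_le.
Qed.

Lemma killing_rate_ge0 (B : R) (g : R -> R) (u : R) : levy_cutoff B g ->
  0 <= killing_rate pi g u.
Proof.
move=> [_ gB]; apply: Rintegral_ge0 => theta /gt0_in_itv t0.
by rewrite mulr_ge0 ?expR_ge0//; have [] := gB _ t0.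
Qed.

Lemma killing_rate_le (B : R) (g : R -> R) (u : R) : levy_cutoff B g -> 0 <= u ->
  killing_rate pi g u <= B * mass.
Proof.
move=> gB u0; apply: (le_trans (ler_norm _)).
apply: (le_levy_integral pi_moment); first exact: measurable_cutoff_expRN gB.
by move=> theta t0; exact: cutoff_expRN_le.
Qed.

Lemma killing_rate_lipschitz (B : R) (g : R -> R) (u w : R) : levy_cutoff B g ->
  0 <= u -> 0 <= w ->
  `|killing_rate pi g u - killing_rate pi g w| <= B * mass * `|u - w|.
Proof.
move=> gB u0 w0; rewrite /killing_rate -RintegralB//;
  [|exact: integrable_cutoff_expRN gB _..].
have -> : B * mass * `|u - w| = (`|u - w| * B) * mass by ring.
apply: (le_levy_integral pi_moment).
  by apply: measurable_funB; exact: measurable_cutoff_expRN gB.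
move=> theta t0; have [g0 _ g1] := gB.2 _ t0.
rewrite -mulrBr normrM (ger0_norm g0).
have h := expRN_lipschitz (mulr_ge0 u0 (ltW t0)) (mulr_ge0 w0 (ltW t0)).
rewrite -mulrBl normrM (gtr0_norm t0) in h.
apply: (@le_trans _ _ (g theta * (`|u - w| * theta))); first by rewrite ler_wpM2l.
by rewrite mulrCA -mulrA ler_wpM2l// mulrC.
Qed.

(** The bound is uniform in [u], so that pointwise convergence of cutoffs will give uniform
    convergence of the killing rates, by dominated convergence. *)
Lemma killing_rate_dist (B : R) (g g' : R -> R) (u : R) :
  levy_cutoff B g -> levy_cutoff B g' -> 0 <= u ->
  `|killing_rate pi g u - killing_rate pi g' u| <=
    \int[pi]_(theta in D) `|g theta - g' theta|.
Proof.
move=> gB gB' u0; rewrite /killing_rate -RintegralB//;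
  [|exact: integrable_cutoff_expRN gB _|exact: integrable_cutoff_expRN gB' _].
have ii := integrableB_EFin _ (integrable_cutoff_expRN gB u0) (integrable_cutoff_expRN gB' u0).
apply: (le_trans (le_normr_Rintegral _ _)) => //; first exact: ii.
apply: le_Rintegral => //.
- by apply: (integrable_norm (ii _)).
- apply: (levy_integrable pi_moment (C := B + B)).
    by apply: measurableT_comp => //; apply: measurable_funB; [case: gB|case: gB'].
  move=> theta t0; have [g0 g1 _] := gB.2 _ t0; have [g0' g1' _] := gB'.2 _ t0.
  rewrite normr_id ler_norml; apply/andP; split; lra.
- move=> theta /gt0_in_itv t0; rewrite -mulrBl normrM (ger0_norm (expR_ge0 _)).
  by rewrite ler_piMr// -expR0 ler_expR oppr_le0 mulr_ge0// ltW.
Qed.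

(** At [u = 0] the integrand of the killing rate is the indicator itself. *)
Lemma levy_cutoff_indic_fin_num (B : R) (A : set R) : measurable A ->
  levy_cutoff B (\1_A : R -> R) -> A `<=` D -> pi A \is a fin_num.
Proof.
move=> mA gA AD.
have := integrable_fin_num _ (integrable_cutoff_expRN gA (lexx 0)).
move=> /(_ (measurable_itv _)).
rewrite (_ : (fun _ => _) = (EFin \o \1_A)); last first.
  by apply/funext => x /=; rewrite mul0r oppr0 expR0 mulr1.
by rewrite integral_indic//= setIidl.
Qed.

(** On [A], withdrawing the integrand of [Phi] and adding the drift [u * theta] leaves
    [1 - exp (- u theta)]. Its two terms are separately integrable because [\1_A] is a cutoff, and
    give [pi A] and the killing rate. *)
Lemma branching_mechanism_avoidingE (alpha beta B : R) (A : set R) (u : R) :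
  measurable A -> A `<=` D -> levy_cutoff B (\1_A : R -> R) -> 0 <= u ->
  branching_mechanism_avoiding alpha beta pi A u =
  branching_mechanism alpha beta pi u - killing_rate pi \1_A u + fine (pi A).
Proof.
move=> mA AD gA u0; rewrite /branching_mechanism_avoiding /branching_mechanism.
have -> : fine (pi A) = \int[pi]_(theta in D) (\1_A theta : R).
  by rewrite /Rintegral integral_indic// setIidl.
have AE : A = D `&` A by rewrite setIidr.
rewrite [X in \int[pi]_(theta in X) theta]AE Rintegral_mkcondr.
rewrite setDE Rintegral_mkcondr.
set k := fun theta : R => expR (- (u * theta)) - 1 + u * theta.
have i1 : pi.-integrable D (EFin \o (fun theta => theta * \1_A theta)).
  apply: (levy_integrable pi_moment (C := B)).
    by apply: measurable_funM => //; case: gA.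
  move=> theta t0; have [g0 _ g1] := gA.2 _ t0.
  by rewrite ger0_norm// mulr_ge0// ltW.
have i2 : pi.-integrable D (EFin \o (\1_A : R -> R)).
  apply: (levy_integrable pi_moment (C := B)); first by case: gA.
  by move=> theta t0; have [g0 g1 _] := gA.2 _ t0; rewrite ger0_norm.
have i3 := integrable_cutoff_expRN gA u0.
have i4 := integrable_expRN_remainder pi_moment u0.
have i5 : pi.-integrable D (EFin \o (fun theta => u * (theta * \1_A theta))).
  exact: (integrableZl_EFin _ _ i1).
have -> : \int[pi]_(theta in D) (id \_ A) theta = \int[pi]_(theta in D) (theta * \1_A theta).
  apply: eq_Rintegral => theta _; rewrite patchE indicE.
  by case: ifP => _; rewrite ?mulr1 ?mulr0.
have -> : \int[pi]_(theta in D) (k \_ (~` A)) theta =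
   \int[pi]_(theta in D) k theta - \int[pi]_(theta in D) (\1_A theta * expR (- (u * theta)))
   + \int[pi]_(theta in D) \1_A theta
   - u * \int[pi]_(theta in D) (theta * \1_A theta).
  rewrite -RintegralZl// -RintegralB// -RintegralD//; last first.
    exact: (integrableB_EFin _ i4 i3).
  rewrite -RintegralB//; last first.
    exact: (integrableD_EFin _ (integrableB_EFin _ i4 i3) i2).
  apply: eq_Rintegral => theta _; rewrite patchE indicE in_setC.
  (* Off its set, a restricted function takes the default value [point], which is 0 in [R]. *)
  by rewrite (_ : point = 0 :> R)//; case: (theta \in A); rewrite /k/=; ring.
rewrite /killing_rate /k; ring.
Qed.

End killing.

(** * Euler schemes *)

Definition euler {R : realType} (Psi : R -> R) (h u0 : R) (k : nat) : R :=
  iter k (fun u => u - h * Psi u) u0.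

(** A discrete Gronwall bound: one step multiplies by at most [1 + a h <= exp (a h)] and adds at
    most [h q]. The induction runs with [n h] in place of [t]. *)
Lemma euler_le {R : realType} (Psi : R -> R) (a q t lam h : R) (n : nat) :
  0 <= a -> 0 <= q -> 0 < lam -> 0 <= h -> n%:R * h <= t ->
  (forall k, (k < n)%N -> 0 <= euler Psi h lam k) ->
  (forall u, 0 <= u -> - (a * u) - q <= Psi u) ->
  euler Psi h lam n <= (lam + q * t) * expR (a * t).
Proof.
move=> a0 q0 l0 h0 nt pos Psige.
apply: (@le_trans _ _ ((lam + q * (n%:R * h)) * expR (a * (n%:R * h)))); last first.
  apply: ler_pM; rewrite ?expR_ge0//.
  - by rewrite addr_ge0 ?(ltW l0)// !mulr_ge0.
  - by rewrite lerD2l ler_wpM2l.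
  - by rewrite ler_expR ler_wpM2l.
elim: n {nt} pos => [|n IH] pos.
  by rewrite /euler/= mul0r !mulr0 addr0 expR0 mulr1.
have un : euler Psi h lam n <= (lam + q * (n%:R * h)) * expR (a * (n%:R * h)).
  by apply: IH => k kn; apply: pos; exact: leqW.
have u0 := pos _ (ltnSn n).
rewrite /euler iterS -/(euler Psi h lam n).
move: (euler Psi h lam n) un u0 => u un u0.
have h1 : u - h * Psi u <= u * (1 + a * h) + h * q.
  have : h * (- (a * u) - q) <= h * Psi u by rewrite ler_wpM2l// Psige.
  by lra.
apply: (le_trans h1).
have -> : n.+1%:R * h = n%:R * h + h by rewrite -natr1 mulrDl mul1r.
have s0 : 0 <= n%:R * h by rewrite mulr_ge0.
move: (n%:R * h) s0 un => s s0 un.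
rewrite (mulrDr a) expRD.
have e1 : 1 + a * h <= expR (a * h) by exact: expR_ge1Dx.
have ah0 : 0 <= a * h by rewrite mulr_ge0.
have h2 : u * (1 + a * h) <= (lam + q * s) * expR (a * s) * expR (a * h).
  by apply: ler_pM => //; rewrite addr_ge0.
have h3 : h * q <= q * h * (expR (a * s) * expR (a * h)).
  rewrite mulrC ler_peMr ?mulr_ge0// -expRD -expR0 ler_expR addr_ge0// mulr_ge0//.
apply: (le_trans (lerD h2 h3)).
by rewrite le_eqVlt; apply/orP; left; apply/eqP; ring.
Qed.

(** The two bounds depend on each other: the upper one needs the earlier iterates to be nonnegative,
    and the lower one uses [Psi u <= L * u], available only below the upper bound. Hence a strong
    induction that carries both. Downwards, a step multiplies by at least
    [1 - h L >= exp (- 2 h L)]. *)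
Lemma euler_bounds {R : realType} (Psi : R -> R) (a q t lam L h : R) (n : nat) :
  0 <= a -> 0 <= q -> 0 < lam -> 0 <= L -> 0 <= h -> h * L <= 1 / 2 ->
  n%:R * h <= t ->
  (forall u, 0 <= u -> - (a * u) - q <= Psi u) ->
  (forall u, 0 <= u <= (lam + q * t) * expR (a * t) -> Psi u <= L * u) ->
  lam * expR (- (2 * L * t)) <= euler Psi h lam n <= (lam + q * t) * expR (a * t).
Proof.
move=> a0 q0 l0 L0 h0 hL nt Psige Psile.
suff H : forall k, (k <= n)%N ->
    lam * expR (- (2 * L * (k%:R * h))) <= euler Psi h lam k <= (lam + q * t) * expR (a * t).
  have /andP[H1 H2] := H n (leqnn n); rewrite H2 andbT; apply: le_trans H1.
  by rewrite ler_wpM2l ?(ltW l0)// ler_expR lerN2 ler_wpM2l// mulr_ge0.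
have kt k : (k <= n)%N -> k%:R * h <= t.
  by move=> kn; apply: le_trans nt; rewrite ler_wpM2r// ler_nat.
suff H : forall k, (k <= n)%N -> forall j, (j <= k)%N ->
    lam * expR (- (2 * L * (j%:R * h))) <= euler Psi h lam j <= (lam + q * t) * expR (a * t).
  by move=> k kn; exact: (H k kn k).
elim=> [|k IH] kn j jk.
  move: jk; rewrite leqn0 => /eqP ->.
  rewrite mul0r mulr0 oppr0 expR0 mulr1 lexx/=.
  by apply: (@euler_le _ Psi a q t lam h 0) => //; exact: kt.
move: jk; rewrite leq_eqVlt ltnS => /predU1P[->|]; last exact: IH (ltnW kn) j.
have Hk := IH (ltnW kn).
have pos i : (i < k.+1)%N -> 0 <= euler Psi h lam i.
  move=> ik; have /andP[Hi _] := Hk i ik; apply: le_trans Hi.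
  by rewrite mulr_ge0 ?expR_ge0// ltW.
apply/andP; split; last by apply: euler_le => //; exact: kt.
have /andP[lo hi] := Hk k (leqnn k).
rewrite /euler iterS -/(euler Psi h lam k).
have up := Psile (euler Psi h lam k).
rewrite hi (pos k (ltnSn k)) in up; have {}up := up isT.
have -> : k.+1%:R * h = k%:R * h + h by rewrite -natr1 mulrDl mul1r.
move: (euler Psi h lam k) (k%:R * h) lo up (pos k (ltnSn k)) => u s lo up u0.
have h1 : u * (1 - h * L) <= u - h * Psi u.
  have : h * Psi u <= h * (L * u) by rewrite ler_wpM2l.
  lra.
apply: le_trans h1; rewrite (mulrDr (2 * L)) opprD expRD mulrA.
apply: ler_pM; rewrite ?expR_ge0//; first by rewrite mulr_ge0 ?expR_ge0// ltW.
(* [exp (- 2 y) <= 1 / (1 + 2 y) <= 1 - y] for [0 <= y <= 1/2] *)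
have y0 : 0 <= h * L by rewrite mulr_ge0.
have -> : 2 * L * h = 2 * (h * L) by ring.
move: (h * L) y0 hL => y y0 y1.
have := expR_ge1Dx (2 * y); rewrite expRN => e1.
have e0 : 0 < 1 + 2 * y by lra.
apply: (@le_trans _ _ (1 + 2 * y)^-1); first by rewrite lef_pV2// posrE ?expR_gt0.
rewrite -div1r ler_pdivrMr//; nra.
Qed.

(** Discrete Gronwall for the difference of two schemes: a step multiplies it by at most [1 + L h]
    and adds at most [h eta]. *)
Lemma euler_dist {R : realType} (Psi Psi' : R -> R) (c C L eta lam h : R) (n : nat) :
  0 <= L -> 0 <= eta -> 0 <= h ->
  (forall k, (k < n)%N -> c <= euler Psi h lam k <= C) ->
  (forall k, (k < n)%N -> c <= euler Psi' h lam k <= C) ->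
  (forall u w, c <= u <= C -> c <= w <= C -> `|Psi u - Psi' w| <= L * `|u - w| + eta) ->
  `|euler Psi h lam n - euler Psi' h lam n| <= n%:R * h * eta * expR (L * (n%:R * h)).
Proof.
move=> L0 e0 h0; elim: n => [|n IH] b1 b2 HP.
  by rewrite /euler/= subrr normr0 !mul0r.
have {IH} := IH (fun k kn => b1 k (leqW kn)) (fun k kn => b2 k (leqW kn)) HP.
have := HP _ _ (b1 n (ltnSn n)) (b2 n (ltnSn n)).
rewrite /euler !iterS -/(euler Psi h lam n) -/(euler Psi' h lam n).
move: (euler Psi h lam n) (euler Psi' h lam n) => u w HPu.
have -> : n.+1%:R * h = n%:R * h + h by rewrite -natr1 mulrDl mul1r.
have s0 : 0 <= n%:R * h by rewrite mulr_ge0.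
move: (n%:R * h) s0 => s s0 IH.
have -> : u - h * Psi u - (w - h * Psi' w) = (u - w) - h * (Psi u - Psi' w) by ring.
apply: (le_trans (ler_normB _ _)); rewrite normrM (ger0_norm h0).
have h1 : h * `|Psi u - Psi' w| <= h * (L * `|u - w| + eta) by rewrite ler_wpM2l.
have e1 : 1 + L * h <= expR (L * h) by exact: expR_ge1Dx.
have Lh : 0 <= L * h by rewrite mulr_ge0.
have h2 : `|u - w| * (1 + L * h) <= s * eta * expR (L * s) * expR (L * h).
  by apply: ler_pM => //; rewrite addr_ge0.
have h3 : h * eta <= h * eta * (expR (L * s) * expR (L * h)).
  by rewrite ler_peMr ?mulr_ge0// -expRD -expR0 ler_expR addr_ge0// mulr_ge0.
rewrite (mulrDr L) expRD.
have -> : (s + h) * eta * (expR (L * s) * expR (L * h)) =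
  s * eta * expR (L * s) * expR (L * h) + h * eta * (expR (L * s) * expR (L * h)) by ring.
lra.
Qed.

(** * Expectations *)

Lemma eq_of_dist_le_mesh {R : realType} (a b t : R) :
  (forall n, `|a - b| <= t / n.+1%:R) -> a = b.
Proof.
move=> H; apply/eqP/negP => /negP ab.
have : 0 < `|a - b| by rewrite normr_gt0 subr_eq0.
move=> /(near_mesh_lt t)[N _ /(_ N (leqnn N))].
by rewrite ltNge H.
Qed.

(** For [y] in [[0, 1]], this is [y] rounded down to a multiple of [1 / N.+1], written as an average
    of indicators of upper level sets. By linearity, an identity known for events passes to it. *)
Definition layer {R : realType} (N : nat) (y : R) : R :=
  N.+1%:R^-1 * \sum_(i < N.+1) (i.+1%:R / N.+1%:R <= y)%R%:R.

Lemma layer_approx {R : realType} (N : nat) (y : R) : 0 <= y <= 1 ->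
  `|y - layer N y| <= N.+1%:R^-1.
Proof.
move=> /andP[y0 y1].
have count (M : nat) (z : R) : 0 <= z ->
    (M%:R <= z -> \sum_(i < M) (i.+1%:R <= z)%R%:R = M%:R :> R) /\
    (z <= M%:R -> z - 1 <= \sum_(i < M) (i.+1%:R <= z)%R%:R <= z).
  move=> z0; elim: M => [|M [IH1 IH2]].
    by split=> h; rewrite big_ord0//; apply/andP; split; lra.
  rewrite big_ord_recr/=.
  have [hM|hM] := leP M.+1%:R z.
    have Mz : M%:R <= z by apply: le_trans hM; rewrite ler_nat.
    rewrite (IH1 Mz) natr1; split=> // zM.
    by rewrite hM andbT; lra.
  rewrite addr0; split=> [//|_]; have [zM|Mz] := leP z M%:R; first exact: IH2.
  rewrite (IH1 (ltW Mz)); move: hM; rewrite -natr1 => hM.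
  by apply/andP; split; lra.
have N0 : (0 : R) < N.+1%:R by [].
have yN : y * N.+1%:R <= N.+1%:R by rewrite ler_piMl.
have [_ /(_ yN)/andP[h1 h2]] := count N.+1 (y * N.+1%:R) (mulr_ge0 y0 (ltW N0)).
have -> : y = N.+1%:R^-1 * (y * N.+1%:R) by rewrite mulrCA mulVf ?mulr1// gt_eqF.
rewrite /layer -mulrBr normrM ger0_norm ?invr_ge0// ler_piMr ?invr_ge0//.
have -> : N.+1%:R^-1 * (y * N.+1%:R) = y by rewrite mulrCA mulVf ?mulr1// gt_eqF.
under eq_bigr do rewrite ler_pdivrMr//.
by rewrite ler_norml; apply/andP; split; lra.
Qed.

Section expectation.
Context {R : realType} {d : measure_display} {T : measurableType d}.
Variable P : probability T R.
Local Notation "'E' f" := (\int[P]_w f w)%R (at level 10, f at level 8).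

Lemma integrable_bounded_fun (f : T -> R) (C : R) :
  measurable_fun setT f -> (forall w, `|f w| <= C) -> P.-integrable setT (EFin \o f).
Proof.
move=> mf fC; apply: measurable_bounded_integrable => //.
  by apply: (le_lt_trans (probability_le1 P measurableT)); rewrite ltry.
exists C; split; first exact: num_real.
by move=> M CM w _; apply: (le_trans (fC w)); exact: ltW.
Qed.

Lemma expectation_le_cst (f : T -> R) (C : R) :
  P.-integrable setT (EFin \o f) -> (forall w, f w <= C) -> E f <= C.
Proof.
move=> fi fC; have -> : C = \int[P]_(w in setT) C.
  rewrite Rintegral_cst//; have -> : fine (P setT) = 1 by rewrite (probability_setT P).
  by rewrite mulr1.
apply: le_Rintegral => //; apply: (integrable_bounded_fun (C := `|C|)) => //.
Qed.

Lemma expectation_norm_le (f : T -> R) (C : R) :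
  measurable_fun setT f -> (forall w, `|f w| <= C) -> `|E f| <= C.
Proof.
move=> mf fC; have fi := integrable_bounded_fun mf fC.
apply: (le_trans (le_normr_Rintegral _ fi)) => //.
apply: expectation_le_cst fC.
by apply: (integrable_norm fi).
Qed.

Lemma expectation_dist_le (f g : T -> R) (C : R) :
  P.-integrable setT (EFin \o f) -> P.-integrable setT (EFin \o g) ->
  (forall w, `|f w - g w| <= C) -> `|E f - E g| <= C.
Proof.
move=> fi gi fgC; rewrite -RintegralB//.
have di := integrableB_EFin measurableT fi gi.
apply: expectation_norm_le => //.
by apply/measurable_EFinP; case/integrableP: di.
Qed.

Lemma expectation_sum (N : nat) (f : nat -> T -> R) :
  (forall i, P.-integrable setT (EFin \o f i)) ->
  P.-integrable setT (EFin \o (fun w => \sum_(i < N) f i w)) /\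
  E (fun w => \sum_(i < N) f i w) = \sum_(i < N) E (f i).
Proof.
move=> fi; elim: N => [|N [IH1 IH2]].
  rewrite big_ord0; split.
    apply: (integrable_bounded_fun (C := 0)) => [|w]; last by rewrite big_ord0 normr0.
    by under eq_fun do rewrite big_ord0; exact: measurable_cst.
  by under eq_Rintegral do rewrite big_ord0; rewrite Rintegral_cst// mul0r.
rewrite big_ord_recr/= -IH2 -RintegralD//; split; last first.
  by apply: eq_Rintegral => w _; rewrite big_ord_recr.
have := integrableD_EFin measurableT IH1 (fi N).
by apply: eq_integrable => // w _ /=; rewrite big_ord_recr.
Qed.

Lemma measurable_layer_set (Y : T -> R) (r : R) : measurable_fun setT Y ->
  measurable [set w | r <= Y w].
Proof.
move=> mY; have := mY measurableT `[r, +oo[%classic (measurable_itv _).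
by rewrite setTI; congr measurable; apply/seteqP; split=> w /=; rewrite in_itv/= andbT.
Qed.

Lemma expectation_layer (N : nat) (Y f : T -> R) (C : R) :
  measurable_fun setT Y -> measurable_fun setT f -> (forall w, `|f w| <= C) ->
  P.-integrable setT (EFin \o (fun w => layer N (Y w) * f w)) /\
  E (fun w => layer N (Y w) * f w) =
  N.+1%:R^-1 * \sum_(i < N.+1) E (fun w => \1_[set w | i.+1%:R / N.+1%:R <= Y w] w * f w).
Proof.
move=> mY mf fC.
pose F i := [set w | (i.+1%:R / N.+1%:R : R) <= Y w].
have iF i : P.-integrable setT (EFin \o (fun w => \1_(F i) w * f w)).
  apply: (integrable_bounded_fun (C := C)).
    by apply: measurable_funM => //; apply: measurable_indic; exact: measurable_layer_set.
  move=> w; rewrite normrM indicE; apply: le_trans (fC w).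
  by case: (_ \in _); rewrite ?normr1 ?mul1r// normr0 mul0r.
have [i1 e1] := expectation_sum N.+1 iF.
have eq w : layer N (Y w) * f w = N.+1%:R^-1 * \sum_(i < N.+1) (\1_(F i) w * f w).
  rewrite /layer -mulrA mulr_suml; congr (_ * _); apply: eq_bigr => i _.
  congr (_ * _); rewrite indicE; congr (nat_of_bool _)%:R.
  by apply/idP/idP => h; [exact/mem_set|exact: set_mem h].
split.
  have := integrableZl_EFin N.+1%:R^-1 measurableT i1.
  by apply: eq_integrable => // w _ /=; rewrite eq.
by under eq_Rintegral do rewrite eq; rewrite RintegralZl// e1.
Qed.

(** Only level sets of [Y] are tested; they belong to the natural filtration as soon as [Y] is
    adapted. *)
Lemma eq_expectation_of_layers (Y f g : T -> R) :
  measurable_fun setT Y -> (forall w, 0 <= Y w <= 1) ->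
  measurable_fun setT f -> (forall w, `|f w| <= 1) ->
  measurable_fun setT g -> (forall w, `|g w| <= 1) ->
  (forall r : R, E (fun w => \1_[set w | r <= Y w] w * f w) =
             E (fun w => \1_[set w | r <= Y w] w * g w)) ->
  E (fun w => Y w * f w) = E (fun w => Y w * g w).
Proof.
move=> mY Y01 mf f1 mg g1 fg; apply: (@eq_of_dist_le_mesh _ _ _ 2) => N.
have close (h : T -> R) : measurable_fun setT h -> (forall w, `|h w| <= 1) ->
    `|E (fun w => Y w * h w) - E (fun w => layer N (Y w) * h w)| <= N.+1%:R^-1.
  move=> mh h1; have [il _] := expectation_layer N mY mh h1.
  apply: expectation_dist_le => //.
    apply: (integrable_bounded_fun (C := 1)) => [|w]; first exact: measurable_funM.
    have /andP[Y0 Y1] := Y01 w.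
    by rewrite normrM -[1]mulr1 ler_pM// ger0_norm.
  move=> w; rewrite -mulrBl normrM -[leRHS]mulr1 ler_pM//.
  exact: layer_approx.
have e : E (fun w => layer N (Y w) * f w) = E (fun w => layer N (Y w) * g w).
  have [_ ->] := expectation_layer N mY mf f1.
  have [_ ->] := expectation_layer N mY mg g1.
  by congr (_ * _); apply: eq_bigr => i _; exact: fg.
have h1 := close _ mf f1; have h2 := close _ mg g1.
rewrite e in h1; have -> : (2 : R) / N.+1%:R = N.+1%:R^-1 + N.+1%:R^-1.
  by rewrite mulrC mulr_natr mulr2n.
move: (\int[P]_w (layer N (Y w) * g w)) h1 h2 => c h1 h2.
move: (\int[P]_w (Y w * f w)) (\int[P]_w (Y w * g w)) h1 h2 => p q h1 h2.
have -> : p - q = (p - c) - (q - c) by ring.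
by apply: (le_trans (ler_normB _ _)); exact: lerD.
Qed.

End expectation.

(** * The Markov property on exponentials *)

(** Measurability for the natural filtration at time [s], stated on a copy of [T] that carries this
    sigma-algebra, so that the closure properties of measurable functions apply as they are. *)
Definition adapted {R : realType} {d : measure_display} {T : measurableType d}
    (X : R -> T -> R) (s : R) (Y : T -> R) :=
  measurable_fun (setT : set (g_sigma_algebraType
    (\bigcup_(r in `[0, s]) preimage_set_system setT (X r) measurable))) Y.

Section cb_theory.
Context {R : realType} {d : measure_display} {T : measurableType d}.
Context (Phi : R -> R) (P : R -> probability T R) (X : R -> T -> R).
Hypothesis hX : cb_process Phi P X.

Lemma adapted_marginal (s r : R) : 0 <= r <= s -> adapted X s (X r).
Proof.
move=> rs _ B mB; apply: sub_sigma_algebra.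
by exists r; [rewrite /= in_itv|exists B].
Qed.

Lemma natural_filtration_measurable (s : R) (F : set T) :
  natural_filtration X s F -> measurable F.
Proof.
move=> FF; apply: FF; split; first exact: sigma_algebra_measurable.
move=> _ [r /= /[!in_itv]/= /andP[r0 _] [B mB <-]].
exact: (cb_measurable hX r0).
Qed.

Lemma adapted_measurable (s : R) (Y : T -> R) : adapted X s Y -> measurable_fun setT Y.
Proof.
by move=> aY _ B mB; apply: (@natural_filtration_measurable s); exact: aY.
Qed.

Lemma adapted_layer_set (s : R) (Y : T -> R) (r : R) : adapted X s Y ->
  natural_filtration X s [set w | r <= Y w].
Proof.
move=> aY; have := aY measurableT `[r, +oo[%classic (measurable_itv _).
by rewrite setTI; congr (natural_filtration _ _ _); apply/seteqP; split=> w /=;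
  rewrite in_itv/= andbT.
Qed.

Lemma measurable_kernel_marginal (s h : R) (B : set R) : 0 <= s -> 0 <= h ->
  measurable B ->
  measurable_fun setT (fun w => fine (P (X s w) [set w' | B (X h w')])).
Proof.
move=> s0 h0 mB.
apply: (@measurable_comp _ _ _ _ _ _ setT (@fine R)) => //.
apply: (@measurable_comp _ _ _ _ _ _ (`[0, +oo[%classic : set R)
  (fun x => P x [set w | B (X h w)])) => //.
- by move=> _ [w _ <-]; rewrite /= in_itv/= andbT (cb_ge0 hX).
- exact: (cb_kernel hX).
- exact: (cb_measurable hX).
Qed.

Lemma markov_indic (x s h : R) (F : set T) (B : set R) :
  0 <= x -> 0 <= s -> 0 <= h -> natural_filtration X s F -> measurable B ->
  \int[P x]_w (\1_F w * \1_B (X (s + h) w)) =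
  \int[P x]_w (\1_F w * fine (P (X s w) [set w' | B (X h w')])).
Proof.
move=> x0 s0 h0 FF mB; have mF := natural_filtration_measurable FF.
have mX : measurable_fun setT (X (s + h)) by apply: (cb_measurable hX); rewrite addr_ge0.
have mXB : measurable [set w | B (X (s + h) w)].
  by rewrite -[X in measurable X]setTI; exact: mX.
have := cb_markov hX x0 s0 h0 FF mB.
rewrite /Rintegral => e.
have -> : (\int[P x]_w (\1_F w * \1_B (X (s + h) w))%:E)%E =
    P x (F `&` [set w | B (X (s + h) w)]).
  rewrite -[F `&` _]setIT -integral_indic//; last exact: measurableI.
  apply: eq_integral => w _; rewrite indicI/=; congr (_ * _)%:E.
rewrite e; congr fine.
rewrite [LHS]integral_mkcond; apply: eq_integral => w _.
rewrite patchE indicE; case: (w \in F); rewrite ?mul0r// mul1r fineK//.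
by apply: fin_num_measure; rewrite -[X in measurable X]setTI; exact: (cb_measurable hX).
Qed.

Variable v : R -> R -> R.
Hypothesis laplace_v : forall x t l : R, 0 <= x -> 0 <= t -> 0 <= l ->
  \int[P x]_w expR (- (l * X t w)) = expR (- (x * v t l)).
Hypothesis v_ge0 : forall t l : R, 0 <= t -> 0 <= l -> 0 <= v t l.

Lemma measurable_expRN_marginal (t l : R) : 0 <= t ->
  measurable_fun setT (fun w => expR (- (l * X t w))).
Proof.
move=> t0; apply: measurableT_comp => //; apply: measurableT_comp => //.
by apply: measurable_funM => //; exact: (cb_measurable hX).
Qed.

Lemma expRN_marginal_le1 (t l : R) (w : T) : 0 <= t -> 0 <= l ->
  0 <= expR (- (l * X t w)) <= 1.
Proof.
move=> t0 l0; rewrite expR_ge0/= -expR0 ler_expR oppr_le0 mulr_ge0//.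
exact: (cb_ge0 hX).
Qed.

Lemma expRN_marginal_norm_le1 (t l : R) (w : T) : 0 <= t -> 0 <= l ->
  `|expR (- (l * X t w))| <= 1.
Proof.
by move=> t0 l0; have /andP[h0 h1] := expRN_marginal_le1 w t0 l0; rewrite ger0_norm.
Qed.

Lemma indic_norm_le1 (F : set T) (w : T) : `|\1_F w| <= 1 :> R.
Proof. by rewrite indicE; case: (_ \in _); rewrite ?normr1 ?normr0. Qed.

(** The Markov hypothesis concerns events on [X (s + h)], and the layers of [exp (- l X_(s+h))] are
    made of such events. Replaced by their conditional probabilities given [X_s = y], they sum to an
    expectation under [P y] that is within [1 / N.+1] of the Laplace transform. One error arises on
    each side, whence [2 / N.+1]. *)
Lemma markov_exp_indic (x s h l : R) (F : set T) :
  0 <= x -> 0 <= s -> 0 <= h -> 0 <= l -> natural_filtration X s F ->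
  \int[P x]_w (\1_F w * expR (- (l * X (s + h) w))) =
  \int[P x]_w (\1_F w * expR (- (v h l * X s w))).
Proof.
move=> x0 s0 h0 l0 FF; have mF := natural_filtration_measurable FF.
have sh0 : 0 <= s + h by rewrite addr_ge0.
apply: (@eq_of_dist_le_mesh _ _ _ 2) => N.
have m1F : measurable_fun setT (\1_F : T -> R) by exact: measurable_indic.
pose b w := expR (- (l * X (s + h) w)).
pose B (i : nat) := [set y : R | (i.+1%:R / N.+1%:R : R) <= expR (- (l * y))].
have mB i : measurable (B i).
  exact: measurable_layer_set (measurable_expRN_mul l).
pose k (i : nat) (y : R) := fine (P y [set w' | B i (X h w')]).
have mk i : measurable_fun setT (fun w => k i (X s w)).
  exact: measurable_kernel_marginal.
have k01 i w : 0 <= k i (X s w) <= 1.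
  have mXB : measurable [set w' | B i (X h w')].
    by rewrite -[X in measurable X]setTI; exact: (cb_measurable hX).
  by rewrite /k fine_ge0//= -lee_fin fineK ?fin_num_measure// probability_le1.
have [il el] := expectation_layer (P x) N (measurable_expRN_marginal l sh0) m1F (indic_norm_le1 F).
have e1 : \int[P x]_w (layer N (b w) * \1_F w) =
    N.+1%:R^-1 * \sum_(i < N.+1) \int[P x]_w (\1_F w * k i (X s w)).
  rewrite el; congr (_ * _); apply: eq_bigr => i _.
  rewrite -(markov_indic x0 s0 h0 FF (mB i)).
  by apply: eq_Rintegral => w _; rewrite mulrC.
have ik i : (P x).-integrable setT (EFin \o (fun w => \1_F w * k i (X s w))).
  apply: (@integrable_bounded_fun _ _ _ _ _ (1)); first exact: measurable_funM.
  move=> w; rewrite normrM -[1]mulr1 ler_pM// ?indic_norm_le1//.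
  by have /andP[c0 c1] := k01 i w; rewrite ger0_norm.
have [isum es] := expectation_sum N.+1 ik.
have e2 : N.+1%:R^-1 * \sum_(i < N.+1) \int[P x]_w (\1_F w * k i (X s w)) =
    \int[P x]_w (N.+1%:R^-1 * \sum_(i < N.+1) (\1_F w * k i (X s w))).
  by rewrite RintegralZl// es.
have kE y : 0 <= y -> `|expR (- (v h l * y)) - N.+1%:R^-1 * \sum_(i < N.+1) k i y| <= N.+1%:R^-1.
  move=> y0; rewrite [v h l * y]mulrC -laplace_v//.
  have [il' el'] := expectation_layer (P y) N (measurable_expRN_marginal l h0)
     (measurable_cst (1 : R)) (fun=> ltac:(by rewrite normr1)).
  have -> : \sum_(i < N.+1) k i y = \sum_(i < N.+1) \int[P y]_w
     (\1_[set w | i.+1%:R / N.+1%:R <= expR (- (l * X h w))] w * 1).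
    apply: eq_bigr => i _; under eq_Rintegral do rewrite mulr1.
    rewrite /Rintegral integral_indic// ?setIT//.
    by apply: measurable_layer_set; exact: measurable_expRN_marginal.
  rewrite -el'; apply: expectation_dist_le => //.
    apply: (@integrable_bounded_fun _ _ _ _ _ (1)); first exact: measurable_expRN_marginal.
    by move=> w; exact: expRN_marginal_norm_le1.
  by move=> w; rewrite mulr1; apply: layer_approx; exact: expRN_marginal_le1.
have d1 : `|\int[P x]_w (\1_F w * b w) - \int[P x]_w (layer N (b w) * \1_F w)| <= N.+1%:R^-1.
  apply: expectation_dist_le => //.
    apply: (@integrable_bounded_fun _ _ _ _ _ (1)).
      by apply: measurable_funM => //; exact: measurable_expRN_marginal.
    move=> w; rewrite normrM -[1]mulr1 ler_pM// ?indic_norm_le1//.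
    exact: expRN_marginal_norm_le1.
  move=> w; rewrite [layer _ _ * _]mulrC -mulrBr normrM -[leRHS]mul1r.
  by rewrite ler_pM// ?indic_norm_le1// layer_approx// expRN_marginal_le1.
have d2 : `|\int[P x]_w (\1_F w * expR (- (v h l * X s w))) -
    \int[P x]_w (N.+1%:R^-1 * \sum_(i < N.+1) (\1_F w * k i (X s w)))| <= N.+1%:R^-1.
  apply: expectation_dist_le => //.
  - apply: (@integrable_bounded_fun _ _ _ _ _ (1)).
      by apply: measurable_funM => //; exact: measurable_expRN_marginal.
    move=> w; rewrite normrM -[1]mulr1 ler_pM// ?indic_norm_le1//.
    by apply: expRN_marginal_norm_le1 => //; exact: v_ge0.
  - exact: (integrableZl_EFin _ _ isum).
  - move=> w; rewrite -mulr_sumr mulrCA -mulrBr normrM -[leRHS]mul1r.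
    by rewrite ler_pM// ?indic_norm_le1// kE//; exact: (cb_ge0 hX).
rewrite e1 e2 in d1.
have -> : (2 : R) / N.+1%:R = N.+1%:R^-1 + N.+1%:R^-1.
  by rewrite mulrC mulr_natr mulr2n.
move: d1 d2; rewrite /b.
move: (\int[P x]_w _) (\int[P x]_w _) (\int[P x]_w _) => q c p d1 d2.
have -> : p - q = (p - c) - (q - c) by ring.
by apply: (le_trans (ler_normB _ _)); exact: lerD.
Qed.

Lemma markov_exp_le1 (x s h l : R) (Y : T -> R) :
  0 <= x -> 0 <= s -> 0 <= h -> 0 <= l -> adapted X s Y ->
  (forall w, 0 <= Y w <= 1) ->
  \int[P x]_w (Y w * expR (- (l * X (s + h) w))) =
  \int[P x]_w (Y w * expR (- (v h l * X s w))).
Proof.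
move=> x0 s0 h0 l0 aY Y01; have vl := v_ge0 h0 l0.
have sh0 : 0 <= s + h by rewrite addr_ge0.
apply: (@eq_expectation_of_layers _ _ _ (P x) Y (fun w => expR (- (l * X (s + h) w)))
  (fun w => expR (- (v h l * X s w)))).
- exact: adapted_measurable aY.
- exact: Y01.
- exact: measurable_expRN_marginal.
- by move=> w; exact: expRN_marginal_norm_le1.
- exact: measurable_expRN_marginal.
- by move=> w; exact: expRN_marginal_norm_le1.
- by move=> r; apply: markov_exp_indic => //; exact: adapted_layer_set.
Qed.

(** Here [Y] may be unbounded, as [exp (j X_s)] will be. It is truncated at [m.+1], rescaled into
    [[0, 1]], and recovered by monotone convergence. Only the integrand on the right is bounded
    beforehand; integrability on the left follows from the equality of the extended integrals. *)
Lemma markov_exp (x s h l C : R) (Y : T -> R) :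
  0 <= x -> 0 <= s -> 0 <= h -> 0 <= l -> adapted X s Y ->
  (forall w, 0 <= Y w) -> (forall w, Y w * expR (- (v h l * X s w)) <= C) ->
  (P x).-integrable setT (EFin \o (fun w => Y w * expR (- (l * X (s + h) w)))) /\
  \int[P x]_w (Y w * expR (- (l * X (s + h) w))) =
  \int[P x]_w (Y w * expR (- (v h l * X s w))).
Proof.
move=> x0 s0 h0 l0 aY Y0 YC; have vl := v_ge0 h0 l0.
have sh0 : 0 <= s + h by rewrite addr_ge0.
have mY := adapted_measurable aY.
pose Ym (m : nat) w := Num.min (Y w) m.+1%:R.
have Ym0 m w : 0 <= Ym m w by rewrite le_min Y0 ler0n.
have mYm m : measurable_fun setT (Ym m) by exact: measurable_minr.
have eqm m : (\int[P x]_w (Ym m w * expR (- (l * X (s + h) w)))%:E =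
    \int[P x]_w (Ym m w * expR (- (v h l * X s w)))%:E)%E.
  have int (t r : R) : 0 <= t -> 0 <= r ->
      (P x).-integrable setT (EFin \o (fun w => Ym m w * expR (- (r * X t w)))).
    move=> t0 r0; apply: (@integrable_bounded_fun _ _ _ _ _ (m.+1%:R)).
      by apply: measurable_funM => //; exact: measurable_expRN_marginal.
    move=> w; rewrite normrM -[leRHS]mulr1 ler_pM//; last exact: expRN_marginal_norm_le1.
    by rewrite ger0_norm// ge_min lexx orbT.
  rewrite -(fineK (integrable_fin_num measurableT (int _ _ sh0 l0))).
  rewrite -(fineK (integrable_fin_num measurableT (int _ _ s0 vl))).
  apply: (congr1 EFin).
  have := @markov_exp_le1 x s h l (fun w => m.+1%:R^-1 * Ym m w) x0 s0 h0 l0.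
  have aYm : adapted X s (fun w => m.+1%:R^-1 * Ym m w).
    by apply: measurable_funM => //; exact: measurable_minr.
  move=> /(_ aYm); have Y01 w : 0 <= m.+1%:R^-1 * Ym m w <= 1.
    by rewrite mulr_ge0//= ler_pdivrMl// mulr1 ge_min lexx orbT.
  move=> /(_ Y01).
  under eq_Rintegral do rewrite -mulrA.
  under [X in _ = X -> _]eq_Rintegral do rewrite -mulrA.
  rewrite (RintegralZl _ measurableT (int _ _ sh0 l0)).
  rewrite (RintegralZl _ measurableT (int _ _ s0 vl)).
  by apply: mulfI; rewrite invr_eq0.
have lim (t r : R) : 0 <= t -> 0 <= r ->
    ((\int[P x]_w (Ym m w * expR (- (r * X t w)))%:E)%E @[m --> \oo] -->
    (\int[P x]_w (Y w * expR (- (r * X t w)))%:E)%E).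
  move=> t0 r0.
  rewrite (_ : (\int[P x]_w (Y w * expR (- (r * X t w)))%:E)%E =
    (\int[P x]_w limn (fun m => (Ym m w * expR (- (r * X t w)))%:E))%E).
    apply: cvg_monotone_convergence => //.
    - move=> m; apply/measurable_EFinP; apply: measurable_funM => //.
      exact: measurable_expRN_marginal.
    - by move=> m w _; rewrite lee_fin mulr_ge0// expR_ge0.
    - move=> w _ m n mn; rewrite lee_fin ler_wpM2r ?expR_ge0//.
      by rewrite le_min ge_min lexx/= ge_min ler_nat ltnS mn orbT.
  apply: eq_integral => w _; apply/esym/cvg_lim => //.
  apply: cvg_near_cst; exists (Num.bound (Y w)) => // m /= Ym'.
  congr (_ * _)%:E; rewrite /Ym min_l// ltW// (lt_le_trans (archi_boundP (Y0 w)))//.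
  by rewrite ler_nat leqW.
have ee : (\int[P x]_w (Y w * expR (- (l * X (s + h) w)))%:E =
    \int[P x]_w (Y w * expR (- (v h l * X s w)))%:E)%E.
  have h1 := lim _ _ sh0 l0; have h2 := lim _ _ s0 vl.
  rewrite (eq_cvg _ _ eqm) in h1.
  exact: (cvg_unique _ h1 h2).
have ig : (P x).-integrable setT (EFin \o (fun w => Y w * expR (- (v h l * X s w)))).
  apply: (@integrable_bounded_fun _ _ _ _ _ (C)).
    by apply: measurable_funM => //; exact: measurable_expRN_marginal.
  by move=> w; rewrite ger0_norm ?mulr_ge0 ?expR_ge0.
split; last by rewrite /Rintegral ee.
have mf : measurable_fun setT (fun w => Y w * expR (- (l * X (s + h) w))).
  by apply: measurable_funM => //; exact: measurable_expRN_marginal.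
apply/integrableP; split; first exact/measurable_EFinP.
under eq_integral => w _ do rewrite gee0_abs ?lee_fin ?mulr_ge0 ?expR_ge0//.
by rewrite ee ltey_eq (integrable_fin_num measurableT ig).
Qed.

End cb_theory.

(** * Short-time expansion of the cumulant *)

Definition lipschitz_on_segments {R : realType} (Phi : R -> R) :=
  forall L : R, 0 <= L -> exists2 C : R, 0 <= C &
    forall u w, 0 <= u <= L -> 0 <= w <= L -> `|Phi u - Phi w| <= C * `|u - w|.

Lemma lipschitz_continuous {R : realType} (f : R -> R) (C : R) : 0 <= C ->
  (forall x y, `|f x - f y| <= C * `|x - y|) -> continuous f.
Proof.
move=> C0 fL x; apply/cvgrPdist_lt => e e0.
have C1 : 0 < C + 1 by rewrite ltr_wpDl.
exists (e / (C + 1)) => /=; first by rewrite divr_gt0.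
move=> y; rewrite /= ltr_pdivlMr// => xy.
apply: (le_lt_trans (fL _ _)); apply: le_lt_trans xy.
by rewrite mulrC ler_wpM2l// lerDl.
Qed.

Lemma dist_clamp_le {R : realType} (B x y : R) : 0 <= B ->
  `|Num.min B (Num.max 0 x) - Num.min B (Num.max 0 y)| <= `|x - y|.
Proof.
move=> B0; have := ler_norm (x - y); have := ler_norm (- (x - y)); rewrite normrN => n1 n2.
rewrite ler_norml /Num.min /Num.max.
by case: (ltP 0 x) => hx; case: (ltP 0 y) => hy;
  case: (ltP B x) => h1; case: (ltP B y) => h2; case: (ltP B 0) => h3; lra.
Qed.

Lemma Rintegral_itv0_cst {R : realType} (h c : R) : 0 <= h ->
  \int[lebesgue_measure]_(s in `[0, h]) c = c * h.
Proof.
move=> h0; rewrite Rintegral_cst//.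
rewrite -[fine _]/(fine (lebesgue_measure `[0, h]%classic)) lebesgue_measure_itv/= lte_fin.
have [_|h0'] := ltP; first by rewrite oppr0 adde0.
by congr (_ * _); apply/eqP; rewrite eq_le h0 h0'.
Qed.

Lemma itv_integral_norm_le {R : realType} (f : R -> R) (h M : R) : 0 <= h ->
  measurable_fun (`[0, h] : set R) f -> (forall s, 0 <= s <= h -> `|f s| <= M) ->
  lebesgue_measure.-integrable `[0, h] (EFin \o f) /\
  `|\int[lebesgue_measure]_(s in `[0, h]) f s| <= M * h.
Proof.
move=> h0 mf fM.
have bi (g : R -> R) : measurable_fun (`[0, h] : set R) g -> (forall s, 0 <= s <= h -> `|g s| <= M) ->
    lebesgue_measure.-integrable `[0, h] (EFin \o g).
  move=> mg gM; apply: measurable_bounded_integrable => //.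
    rewrite -[X in (X < _)%E]/(lebesgue_measure `[0, h]%classic) lebesgue_measure_itv/=.
    by case: ifP => _; rewrite ?oppr0 ?adde0 ltry.
  exists M; split; first exact: num_real.
  move=> N MN s /=; rewrite in_itv/= => sh.
  by apply: (le_trans (gM s sh)); exact: ltW.
have fi := bi f mf fM; split=> //.
apply: (le_trans (le_normr_Rintegral _ fi)) => //.
apply: (@le_trans _ _ (\int[lebesgue_measure]_(s in `[0, h]) M)).
  apply: le_Rintegral => //; first by apply: (integrable_norm fi).
    apply: bi => // s _; rewrite ger0_norm// (le_trans _ (fM 0 _))//.
    by rewrite lexx.
by rewrite Rintegral_itv0_cst.
Qed.

(** Local boundedness is given for each [lambda] separately. Uniformity over [u] in [[0, L]] comes
    from monotonicity of [v t] in its argument, read off the Laplace transform at [x = 1]. The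
    integral equation is then used twice: first for [|v s u - u| <= N * h], then with this bound
    inserted in the integral. *)
Lemma cb_cumulant {R : realType} {d : measure_display} {T : measurableType d}
    (Phi : R -> R) (P : R -> probability T R) (X : R -> T -> R) :
  lipschitz_on_segments Phi -> cb_process Phi P X ->
  exists v : R -> R -> R,
    [/\ forall x t l : R, 0 <= x -> 0 <= t -> 0 <= l ->
          \int[P x]_w expR (- (l * X t w)) = expR (- (x * v t l)),
        forall t l : R, 0 <= t -> 0 <= l -> 0 <= v t l &
        forall L : R, 0 <= L -> exists2 C : R, 0 <= C &
          forall u h : R, 0 <= u <= L -> 0 <= h <= 1 ->
            `|v h u - (u - h * Phi u)| <= C * h ^+ 2].
Proof.
move=> Plip hX; have [v sol lap] := cb_laplace hX; exists v.
have lap' (x t l : R) : 0 <= x -> 0 <= t -> 0 <= l ->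
    \int[P x]_w expR (- (l * X t w)) = expR (- (x * v t l)).
  by move=> x0 t0 l0; have := lap x t l x0 t0 l0; rewrite unlock /Rintegral => ->.
have mono t u w : 0 <= t -> 0 <= u -> u <= w -> v t u <= v t w.
  move=> t0 u0 uw; have w0 : 0 <= w by exact: le_trans uw.
  rewrite -lerN2 -ler_expR -[v t w]mul1r -[v t u]mul1r -!lap'//.
  have ib l : 0 <= l -> (P 1).-integrable setT (EFin \o (fun w => expR (- (l * X t w)))).
    move=> l0; apply: (@integrable_bounded_fun _ _ _ _ _ 1).
      exact: (measurable_expRN_marginal hX).
    by move=> z; exact: (expRN_marginal_norm_le1 hX).
  apply: le_Rintegral => //; [exact: ib|exact: ib|].
  by move=> z _; rewrite ler_expR lerN2 ler_wpM2r// (cb_ge0 hX).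
split=> // [t l t0 l0|L L0]; first exact: (cs_ge0 (sol l l0)).
have v0E u : 0 <= u -> v 0 u = u.
  move=> u0; rewrite (cs_equation (sol u u0) (lexx 0)).
  by rewrite set_itv1 Rintegral_set1 subr0.
have [M [_ HM]] := cs_locally_bounded (sol L L0) ler01.
(* Boundedness supplies every bound strictly above [M], hence [M + 1]. *)
pose B := Num.max 0 (M + 1).
have B0 : 0 <= B by rewrite le_max lexx.
have vB u s : 0 <= u <= L -> 0 <= s <= 1 -> 0 <= v s u <= B.
  move=> /andP[u0 uL] /andP[s0 s1]; rewrite (cs_ge0 (sol u u0))//=.
  apply: (le_trans (mono _ _ _ s0 u0 uL)).
  rewrite le_max; apply/orP; right; apply: (le_trans (ler_norm _)).
  by apply: HM; rewrite ?ltrDl//= in_itv/= s0.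
have [C1 C10 HC1] := Plip B B0.
pose N := `|Phi 0| + C1 * B.
have N0 : 0 <= N by rewrite addr_ge0// mulr_ge0.
have PN y : 0 <= y <= B -> `|Phi y| <= N.
  move=> yB; have -> : Phi y = Phi 0 + (Phi y - Phi 0) by ring.
  apply: (le_trans (ler_normD _ _)); rewrite lerD2l.
  have := HC1 y 0 yB; rewrite lexx B0 => /(_ isT); rewrite subr0.
  move/le_trans; apply; rewrite ler_wpM2l//.
  by case/andP: yB => y0 yB; rewrite ger0_norm.
(* [Phi] is controlled on segments of the half-line only. Composed with the projection onto [[0, B]]
   it becomes Lipschitz, hence measurable, on the whole line, and it is unchanged along [v]. *)
pose Phi' y := Phi (Num.min B (Num.max 0 y)).
have mPhi' : measurable_fun setT Phi'.
  apply: continuous_measurable_fun; apply: (lipschitz_continuous C10) => x y.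
  have cB z : 0 <= Num.min B (Num.max 0 z) <= B.
    by rewrite ge_min lexx le_min B0 le_max lexx.
  apply: (le_trans (HC1 _ _ (cB x) (cB y))).
  by rewrite ler_wpM2l// dist_clamp_le.
have PhiE y : 0 <= y <= B -> Phi y = Phi' y.
  by move=> /andP[y0 yB]; rewrite /Phi' max_r// min_r.
have mPv u h : 0 <= u <= L -> 0 <= h <= 1 ->
    measurable_fun (`[0, h] : set R) (fun s => Phi (v s u)).
  move=> uL /andP[h0 h1].
  apply: (@eq_measurable_fun _ _ _ _ _ (Phi' \o (fun s => v s u))).
    move=> s; rewrite inE/= in_itv/= => /andP[s0 sh]; rewrite PhiE// vB// s0.
    exact: le_trans h1.
  apply: measurableT_comp => //.
  have u0 : 0 <= u by case/andP: uL.
  apply: (measurable_funS _ _ (cs_measurable (sol u u0))) => //.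
  by apply: subset_itvl.
exists (C1 * N); first by rewrite mulr_ge0.
move=> u h uL /andP[h0 h1]; have /andP[u0 _] := uL.
have uB : 0 <= u <= B by rewrite -[u]v0E// vB// lexx ler01.
have near_u s : 0 <= s <= h -> `|v s u - u| <= N * h.
  move=> /andP[s0 sh]; rewrite (cs_equation (sol u u0) s0).
  have s1 : 0 <= s <= 1 by rewrite s0 (le_trans sh).
  have [_ H] := itv_integral_norm_le s0 (mPv u s uL s1) (M := N)
    (fun r hr => ltac:(apply: PN; apply: vB => //; case/andP: hr => r0 rs;
       by rewrite r0 (le_trans rs)//; case/andP: s1)).
  have -> : u - \int[lebesgue_measure]_(s0 in `[0, s]) Phi (v s0 u) - u =
    - \int[lebesgue_measure]_(s0 in `[0, s]) Phi (v s0 u) by ring.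
  by rewrite normrN (le_trans H)// ler_wpM2l.
have h01 : 0 <= h <= 1 by rewrite h0.
have mc : measurable_fun (`[0, h] : set R) (fun=> Phi u) by exact: measurable_cst.
have vsB s : 0 <= s <= h -> 0 <= v s u <= B.
  by move=> /andP[s0 sh]; apply: vB => //; rewrite s0 (le_trans sh).
have [i1 _] := itv_integral_norm_le h0 (mPv u h uL h01) (fun r hr => PN _ (vsB r hr)).
have [i2 _] := itv_integral_norm_le h0 mc (fun r hr => PN _ uB).
have [_ H] := itv_integral_norm_le h0 (measurable_funB (mPv u h uL h01) mc) (M := C1 * (N * h))
  (fun s hs => le_trans (HC1 _ _ (vsB s hs) uB) (ler_wpM2l C10 (near_u s hs))).
rewrite RintegralB// Rintegral_itv0_cst// in H.
rewrite (cs_equation (sol u u0) h0).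
have -> : u - \int[lebesgue_measure]_(s in `[0, h]) Phi (v s u) - (u - h * Phi u) =
  - (\int[lebesgue_measure]_(s in `[0, h]) Phi (v s u) - Phi u * h) by ring.
rewrite normrN; apply: (le_trans H).
by rewrite le_eqVlt; apply/orP; left; apply/eqP; ring.
Qed.

(** * One step of the killed process *)

Section one_step.
Context {R : realType} {d : measure_display} {T : measurableType d}.
Context (Phi : R -> R) (P : R -> probability T R) (X : R -> T -> R).
Hypothesis hX : cb_process Phi P X.
Hypothesis Phi_lip : lipschitz_on_segments Phi.
Variable v : R -> R -> R.
Hypothesis laplace_v : forall x t l : R, 0 <= x -> 0 <= t -> 0 <= l ->
  \int[P x]_w expR (- (l * X t w)) = expR (- (x * v t l)).
Hypothesis v_ge0 : forall t l : R, 0 <= t -> 0 <= l -> 0 <= v t l.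
Hypothesis v_expansion : forall L : R, 0 <= L -> exists2 C : R, 0 <= C &
  forall u h : R, 0 <= u <= L -> 0 <= h <= 1 ->
    `|v h u - (u - h * Phi u)| <= C * h ^+ 2.

Lemma lipschitz_on_segments_bounded (L : R) : 0 <= L ->
  exists2 M : R, 0 <= M & forall u, 0 <= u <= L -> `|Phi u| <= M.
Proof.
move=> L0; have [C C0 HC] := Phi_lip L0.
exists (`|Phi 0| + C * L); first by rewrite addr_ge0// mulr_ge0.
move=> u uL; have -> : Phi u = Phi 0 + (Phi u - Phi 0) by ring.
apply: (le_trans (ler_normD _ _)); rewrite lerD2l.
have := HC u 0 uL; rewrite lexx L0 => /(_ isT); rewrite subr0.
move/le_trans; apply; rewrite ler_wpM2l//.
by case/andP: uL => u0 uL; rewrite ger0_norm.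
Qed.

Lemma marginal_expRN_le (c u s : R) (w : T) : 0 < c -> c <= u -> 0 <= s ->
  0 <= X s w * expR (- (u * X s w)) <= c^-1.
Proof.
move=> c0 cu s0; have Xs0 := cb_ge0 hX w s0.
rewrite mulr_ge0 ?expR_ge0//=; apply: le_trans (mulr_expRNM_le (X s w) c0).
by rewrite ler_wpM2l// ler_expR lerN2 [u * _]mulrC ler_wpM2l.
Qed.

Lemma integrable_first_order (x c u s r : R) (Y : T -> R) : 0 < c -> c <= u ->
  0 <= s -> measurable_fun setT Y -> (forall w, 0 <= Y w <= 1) ->
  (P x).-integrable setT
    (EFin \o (fun w => Y w * (expR (- (u * X s w)) * (1 + X s w * r)))).
Proof.
move=> c0 cu s0 mY Y01.
apply: (@integrable_bounded_fun _ _ _ _ _ (1 + c^-1 * `|r|)).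
  apply: measurable_funM => //; apply: measurable_funM.
    exact: (measurable_expRN_marginal hX).
  apply: measurable_funD => //; apply: measurable_funM => //.
  exact: (cb_measurable hX).
move=> w; have /andP[Y0 Y1] := Y01 w.
rewrite normrM (ger0_norm Y0) -[leRHS]mul1r ler_pM//.
have /andP[h1 h2] := marginal_expRN_le w c0 cu s0.
have u0 : 0 <= u by rewrite (le_trans (ltW c0)).
have /andP[e0 e1] := expRN_marginal_le1 hX w s0 u0.
rewrite mulrDr mulr1 mulrA [expR _ * X s w]mulrC.
apply: (le_trans (ler_normD _ _)); rewrite normrM (ger0_norm e0) (ger0_norm h1).
by rewrite lerD// ler_wpM2r.
Qed.

(* Multiplying by [exp (- j (X (s + h) - X s))] shifts [u] by [j] in the
   Laplace transform, so the first-order term is [Phi (u + j)]. *)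
Lemma exp_moment_expansion (c L : R) (j : nat) : 0 < c -> 0 <= L ->
  exists2 C : R, 0 <= C & exists2 h0 : R, 0 < h0 &
  forall (x s h u : R) (Y : T -> R), 0 <= x -> 0 <= s -> 0 <= h <= h0 ->
    c <= u <= L -> adapted X s Y -> (forall w, 0 <= Y w <= 1) ->
    (P x).-integrable setT (EFin \o (fun w =>
       Y w * (expR (- (X (s + h) w - X s w)) ^+ j * expR (- (u * X (s + h) w))))) /\
    `|\int[P x]_w (Y w * (expR (- (X (s + h) w - X s w)) ^+ j * expR (- (u * X (s + h) w))))
      - \int[P x]_w (Y w * (expR (- (u * X s w)) * (1 + X s w * (h * Phi (u + j%:R)))))|
      <= C * h ^+ 2.
Proof.
move=> c0 L0; have Lj0 : 0 <= L + j%:R by rewrite addr_ge0.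
have [D D0 HD] := v_expansion Lj0.
have [M M0 HM] := lipschitz_on_segments_bounded Lj0.
have [C C0 [h0 h00 HC]] := expR_perturbation c0 M0 D0.
exists C => //; exists (Num.min 1 h0); first by rewrite lt_min ltr01.
move=> x s h u Y x0 s0 /andP[hh0]; rewrite le_min => /andP[h1 hh] /andP[cu uL] aY Y01.
have u0 : 0 <= u by rewrite (le_trans (ltW c0)).
have uj0 : 0 <= u + j%:R by rewrite addr_ge0.
have ujL : 0 <= u + j%:R <= L + j%:R by rewrite uj0 lerD2r.
have mY := adapted_measurable hX aY.
have pert w : `|expR (- (X s w * (v h (u + j%:R) - j%:R))) -
    expR (- (X s w * u)) * (1 + X s w * h * Phi (u + j%:R))| <= C * h ^+ 2.
  apply: HC => //; first exact: (cb_ge0 hX).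
  - exact: HM.
  - by rewrite hh0.
  - have -> : v h (u + j%:R) - j%:R - (u - h * Phi (u + j%:R)) =
      v h (u + j%:R) - (u + j%:R - h * Phi (u + j%:R)) by ring.
    by apply: HD; rewrite ?hh0.
have e1 w : Y w * (expR (- (X (s + h) w - X s w)) ^+ j * expR (- (u * X (s + h) w))) =
    Y w * expR (j%:R * X s w) * expR (- ((u + j%:R) * X (s + h) w)).
  rewrite -expRM_natl -!mulrA -!expRD; congr (_ * expR _).
  by ring.
have e2 w : Y w * expR (j%:R * X s w) * expR (- (v h (u + j%:R) * X s w)) =
    Y w * expR (- (X s w * (v h (u + j%:R) - j%:R))).
  rewrite -!mulrA -expRD; congr (_ * expR _); ring.
have aY' : adapted X s (fun w => Y w * expR (j%:R * X s w)).
  apply: measurable_funM => //; apply: measurableT_comp => //.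
  apply: measurable_funM => //; apply: adapted_marginal.
  by rewrite s0 lexx.
have pos w : 0 <= Y w * expR (j%:R * X s w).
  by rewrite mulr_ge0 ?expR_ge0//; have /andP[] := Y01 w.
(* The factor [exp (j X_s)] is unbounded, but after the Markov property the total exponent is
   [v h (u + j) - j], close to [u], and [pert] bounds the product. *)
have bnd w : Y w * expR (j%:R * X s w) * expR (- (v h (u + j%:R) * X s w)) <=
    1 + c^-1 * (h * M) + C * h ^+ 2.
  rewrite e2; have /andP[Y0 Y1] := Y01 w.
  apply: (@le_trans _ _ (expR (- (X s w * (v h (u + j%:R) - j%:R))))).
    by rewrite ler_piMl// expR_ge0.
  have := pert w; rewrite ler_norml lerBlDr => /andP[_] /le_trans; apply.
  rewrite [leRHS]addrC lerD2l [X s w * u]mulrC.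
  have /andP[g1 g2] := marginal_expRN_le w c0 cu s0.
  have /andP[e0 e1'] := expRN_marginal_le1 hX w s0 u0.
  rewrite mulrDr mulr1 lerD//.
  have -> : expR (- (u * X s w)) * (X s w * h * Phi (u + j%:R)) =
    (X s w * expR (- (u * X s w))) * (h * Phi (u + j%:R)) by ring.
  apply: (@le_trans _ _ ((X s w * expR (- (u * X s w))) * (h * M))).
    rewrite ler_wpM2l// ler_wpM2l//; apply: le_trans (HM _ ujL); exact: ler_norm.
  by rewrite ler_wpM2r// mulr_ge0.
have [i1 q1] := markov_exp hX laplace_v v_ge0 x0 s0 hh0 uj0 aY' pos bnd.
split.
  by apply: eq_integrable i1 => // w _; rewrite /= e1.
rewrite (eq_Rintegral _ (fun w _ => e1 w)) q1 (eq_Rintegral _ (fun w _ => e2 w)).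
apply: expectation_dist_le.
- have ib : (P x).-integrable setT (EFin \o (fun w => Y w * expR (j%:R * X s w) *
      expR (- (v h (u + j%:R) * X s w)))).
    apply: (@integrable_bounded_fun _ _ _ _ _ (1 + c^-1 * (h * M) + C * h ^+ 2)).
      apply: measurable_funM; first exact: (adapted_measurable hX aY').
      exact: (measurable_expRN_marginal hX).
    by move=> w; rewrite ger0_norm ?bnd// mulr_ge0// expR_ge0.
  by apply: eq_integrable ib => // w _; rewrite /= e2.
- exact: (integrable_first_order x (h * Phi (u + j%:R)) c0 cu s0 mY Y01).
- move=> w; rewrite -mulrBr normrM; have /andP[Y0 Y1] := Y01 w.
  rewrite (ger0_norm Y0); apply: (le_trans _ (pert w)).
  by rewrite [X s w * u]mulrC mulrA ler_piMl.
Qed.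

End one_step.

Lemma expectation_second_diff {R : realType} {d : measure_display} {T : measurableType d}
    (P : probability T R) (f0 f1 f2 : T -> R) :
  P.-integrable setT (EFin \o f0) -> P.-integrable setT (EFin \o f1) ->
  P.-integrable setT (EFin \o f2) ->
  P.-integrable setT (EFin \o (fun w => f0 w - 2 * f1 w + f2 w)) /\
  \int[P]_w (f0 w - 2 * f1 w + f2 w) =
  \int[P]_w f0 w - 2 * \int[P]_w f1 w + \int[P]_w f2 w.
Proof.
move=> i0 i1 i2; have i1' := integrableZl_EFin 2 measurableT i1.
have i01 := integrableB_EFin measurableT i0 i1'.
split; first exact: integrableD_EFin.
by rewrite (RintegralD measurableT i01 i2) (RintegralB measurableT i0 i1')
  (RintegralZl _ measurableT i1).
Qed.

Lemma expectation_dist_le_fun {R : realType} {d : measure_display} {T : measurableType d}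
    (P : probability T R) (f g b : T -> R) :
  P.-integrable setT (EFin \o f) -> P.-integrable setT (EFin \o g) ->
  P.-integrable setT (EFin \o b) -> (forall w, `|f w - g w| <= b w) ->
  `|\int[P]_w f w - \int[P]_w g w| <= \int[P]_w b w.
Proof.
move=> fi gi bi fgb; rewrite -(RintegralB measurableT fi gi).
have fgi := integrableB_EFin measurableT fi gi.
apply: (le_trans (le_normr_Rintegral measurableT fgi)).
apply: le_Rintegral => //.
exact: (integrable_norm fgi).
Qed.

Section killed_step.
Context {R : realType} (alpha beta : R).
Context (pi : {measure set (measurableTypeR R) -> \bar R}).
Hypothesis pi_moment :
  (\int[pi]_(theta in `]0%R, +oo[) (Num.min theta (theta ^+ 2))%:E < +oo)%E.
Hypothesis beta_ge0 : 0 <= beta.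
Local Notation Phi := (branching_mechanism alpha beta pi).
Local Notation D := (`]0%R, +oo[%classic : set R).
Context {d : measure_display} {T : measurableType d}.
Context (P : R -> probability T R) (X : R -> T -> R).
Hypothesis hX : cb_process Phi P X.
Variable v : R -> R -> R.
Hypothesis laplace_v : forall x t l : R, 0 <= x -> 0 <= t -> 0 <= l ->
  \int[P x]_w expR (- (l * X t w)) = expR (- (x * v t l)).
Hypothesis v_ge0 : forall t l : R, 0 <= t -> 0 <= l -> 0 <= v t l.
Hypothesis v_expansion : forall L : R, 0 <= L -> exists2 C : R, 0 <= C &
  forall u h : R, 0 <= u <= L -> 0 <= h <= 1 ->
    `|v h u - (u - h * Phi u)| <= C * h ^+ 2.

(** This is [Phi u - 2 Phi (u + 1) + Phi (u + 2)]; the term [2 * beta] is the contribution of the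
    quadratic part. *)
Definition second_diff (u : R) : R :=
  2 * beta + \int[pi]_(theta in D) (expR (- (u * theta)) * (1 - expR (- theta)) ^+ 2).

Lemma measurable_sqr_subr_expRN :
  measurable_fun (setT : set (measurableTypeR R)) (fun theta : R => (1 - expR (- theta)) ^+ 2).
Proof.
apply: measurable_funX; apply: measurable_funB => //.
by apply: measurableT_comp.
Qed.

Lemma expRN_sqr_le (u theta : R) : 0 <= u -> 0 < theta ->
  `|expR (- (u * theta)) * (1 - expR (- theta)) ^+ 2| <= 1 * levy_min theta.
Proof.
move=> u0 t0; rewrite normrM ler_pM//.
  by rewrite ger0_norm ?expR_ge0// -expR0 ler_expR oppr_le0 mulr_ge0// ltW.
by rewrite ger0_norm ?sqr_ge0// sqr_expRN_le_levy_min.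
Qed.

Lemma measurable_expRN_sqr (u : R) :
  measurable_fun (setT : set (measurableTypeR R))
    (fun theta : R => expR (- (u * theta)) * (1 - expR (- theta)) ^+ 2).
Proof.
by apply: measurable_funM; [exact: measurable_expRN_mul|exact: measurable_sqr_subr_expRN].
Qed.

Lemma integrable_expRN_sqr (u : R) : 0 <= u -> pi.-integrable D
  (EFin \o (fun theta => expR (- (u * theta)) * (1 - expR (- theta)) ^+ 2)).
Proof.
move=> u0; apply: (levy_integrable pi_moment (C := 1)); first exact: measurable_expRN_sqr.
by move=> theta t0; exact: expRN_sqr_le.
Qed.

Lemma second_diff_bounds (u : R) : 0 <= u ->
  0 <= second_diff u <= 2 * beta + levy_mass pi.
Proof.
move=> u0; apply/andP; split.
  rewrite addr_ge0 ?mulr_ge0//; apply: Rintegral_ge0 => theta _.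
  by rewrite mulr_ge0 ?expR_ge0// sqr_ge0.
rewrite lerD2l -[leRHS]mul1r; apply: (le_trans (ler_norm _)).
apply: (le_levy_integral pi_moment); first exact: measurable_expRN_sqr.
by move=> theta t0; exact: expRN_sqr_le.
Qed.

(** With [z] the exponential of minus the increment, this is the monomial [z ^+ j] weighted by
    [(1 - z) ^+ 2]; expanding the square yields exponential moments of orders [j], [j.+1] and
    [j.+2]. *)
Definition weighted_moment (j : nat) (u s h : R) (w : T) : R :=
  (1 - expR (- (X (s + h) w - X s w))) ^+ 2 *
  (expR (- (X (s + h) w - X s w)) ^+ j * expR (- (u * X (s + h) w))).

(** In the combination 1, -2, 1 of the three moment expansions, the terms of order zero cancel and
    those of order [h] form the second difference of [Phi]. *)
Lemma weighted_moment_expansion (c L : R) (j : nat) : 0 < c -> 0 <= L ->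
  exists2 C : R, 0 <= C & exists2 h0 : R, 0 < h0 &
  forall (x s h u : R) (Y : T -> R), 0 <= x -> 0 <= s -> 0 <= h <= h0 ->
    c <= u <= L -> adapted X s Y -> (forall w, 0 <= Y w <= 1) ->
    (P x).-integrable setT (EFin \o (fun w => Y w * weighted_moment j u s h w)) /\
    `|\int[P x]_w (Y w * weighted_moment j u s h w)
      - h * second_diff (u + j%:R) * \int[P x]_w (Y w * (X s w * expR (- (u * X s w))))|
      <= C * h ^+ 2.
Proof.
move=> c0 L0.
have lip : lipschitz_on_segments Phi by move=> M; exact: branching_mechanism_lipschitz.
have [C0 C00 [k0 k00 H0]] := exp_moment_expansion hX lip laplace_v v_ge0 v_expansion j c0 L0.
have [C1 C10 [k1 k10 H1]] := exp_moment_expansion hX lip laplace_v v_ge0 v_expansion j.+1 c0 L0.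
have [C2 C20 [k2 k20 H2]] := exp_moment_expansion hX lip laplace_v v_ge0 v_expansion j.+2 c0 L0.
exists (C0 + 2 * C1 + C2); first by rewrite !addr_ge0// mulr_ge0.
exists (Num.min k0 (Num.min k1 k2)); first by rewrite !lt_min k00 k10.
move=> x s h u Y x0 s0 /andP[h0]; rewrite !le_min => /and3P[hk0 hk1 hk2] uL aY Y01.
have hh0 : 0 <= h <= k0 by rewrite h0.
have hh1 : 0 <= h <= k1 by rewrite h0.
have hh2 : 0 <= h <= k2 by rewrite h0.
have [i0 e0] := H0 x s h u Y x0 s0 hh0 uL aY Y01.
have [i1 e1] := H1 x s h u Y x0 s0 hh1 uL aY Y01.
have [i2 e2] := H2 x s h u Y x0 s0 hh2 uL aY Y01.
have mY := adapted_measurable hX aY.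
have [cu uL'] := andP uL.
have u0 : 0 <= u by rewrite (le_trans (ltW c0)).
have j0 := integrable_first_order hX x (h * Phi (u + j%:R)) c0 cu s0 mY Y01.
have j1 := integrable_first_order hX x (h * Phi (u + j.+1%:R)) c0 cu s0 mY Y01.
have j2 := integrable_first_order hX x (h * Phi (u + j.+2%:R)) c0 cu s0 mY Y01.
have [iF eF] := expectation_second_diff i0 i1 i2.
have [iG eG] := expectation_second_diff j0 j1 j2.
have FE w : Y w * (expR (- (X (s + h) w - X s w)) ^+ j * expR (- (u * X (s + h) w))) -
     2 * (Y w * (expR (- (X (s + h) w - X s w)) ^+ j.+1 * expR (- (u * X (s + h) w)))) +
     Y w * (expR (- (X (s + h) w - X s w)) ^+ j.+2 * expR (- (u * X (s + h) w))) =
     Y w * weighted_moment j u s h w.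
  by rewrite /weighted_moment !exprS; ring.
have GE w : Y w * (expR (- (u * X s w)) * (1 + X s w * (h * Phi (u + j%:R)))) -
     2 * (Y w * (expR (- (u * X s w)) * (1 + X s w * (h * Phi (u + j.+1%:R))))) +
     Y w * (expR (- (u * X s w)) * (1 + X s w * (h * Phi (u + j.+2%:R)))) =
     h * second_diff (u + j%:R) * (Y w * (X s w * expR (- (u * X s w)))).
  rewrite /second_diff -(branching_mechanism_second_diff pi_moment alpha); last first.
    by rewrite addr_ge0.
  have -> : u + j%:R + 1 = u + j.+1%:R by rewrite -natr1; ring.
  have -> : u + j%:R + 2 = u + j.+2%:R by rewrite -!natr1; ring.
  ring.
rewrite (eq_Rintegral _ (fun w _ => FE w)) in eF.
rewrite (eq_Rintegral _ (fun w _ => GE w)) in eG.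
split; first by apply: eq_integrable iF => // w _; rewrite /= FE.
have iXY : (P x).-integrable setT (EFin \o (fun w => Y w * (X s w * expR (- (u * X s w))))).
  apply: (@integrable_bounded_fun _ _ _ _ _ c^-1).
    apply: measurable_funM => //; apply: measurable_funM.
      exact: (cb_measurable hX).
    exact: (measurable_expRN_marginal hX).
  move=> w; have /andP[Y0 Y1] := Y01 w.
  have /andP[g0 g1] := marginal_expRN_le hX w c0 cu s0.
  rewrite ger0_norm; last by apply: mulr_ge0.
  by apply: le_trans g1; rewrite ler_piMl.
rewrite (RintegralZl _ measurableT iXY) in eG.
rewrite eF eG.
move: e0 e1 e2; move: (\int[P x]_w _) (\int[P x]_w _) (\int[P x]_w _) (\int[P x]_w _)
  (\int[P x]_w _) (\int[P x]_w _).
move=> a0 a1 a2 b0 b1 b2 {H0 H1 H2} e0 e1 e2.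
have -> : b2 - 2 * b0 + a1 - (b1 - 2 * a2 + a0) = (b2 - b1) - 2 * (b0 - a2) + (a1 - a0) by ring.
apply: (le_trans (ler_normD _ _)); apply: (le_trans (lerD (ler_normB _ _) (lexx _))).
by rewrite normrM (@ger0_norm _ 2)//; clear -e0 e1 e2; lra.
Qed.

Lemma weighted_sum_expansion (c L : R) (a : nat -> R) (n : nat) : 0 < c -> 0 <= L ->
  exists2 C : R, 0 <= C & exists2 h0 : R, 0 < h0 &
  forall (x s h u : R) (Y : T -> R), 0 <= x -> 0 <= s -> 0 <= h <= h0 ->
    c <= u <= L -> adapted X s Y -> (forall w, 0 <= Y w <= 1) ->
    (P x).-integrable setT
      (EFin \o (fun w => Y w * \sum_(j < n) a j * weighted_moment j u s h w)) /\
    `|\int[P x]_w (Y w * \sum_(j < n) a j * weighted_moment j u s h w)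
      - h * (\sum_(j < n) a j * second_diff (u + j%:R))
          * \int[P x]_w (Y w * (X s w * expR (- (u * X s w))))|
      <= C * h ^+ 2.
Proof.
move=> c0 L0; elim: n => [|n [C C0 [h0 h00 H]]].
  exists 0 => //; exists 1 => // x s h u Y _ _ _ _ _ _.
  have e w : Y w * \sum_(j < 0) a j * weighted_moment j u s h w = 0.
    by rewrite big_ord0 mulr0.
  rewrite (eq_Rintegral _ (fun w _ => e w)) big_ord0 mulr0 !mul0r.
  rewrite Rintegral_cst// mul0r subr0 normr0; split=> //.
  apply: (@eq_integrable _ _ _ _ _ measurableT (EFin \o (fun=> 0))).
    by move=> w _; rewrite /= e.
  by apply: (@integrable_bounded_fun _ _ _ _ _ 0) => // w; rewrite normr0.
have [C' C'0 [h0' h00' H']] := weighted_moment_expansion n c0 L0.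
exists (C + `|a n| * C'); first by rewrite addr_ge0// mulr_ge0.
exists (Num.min h0 h0'); first by rewrite lt_min h00.
move=> x s h u Y x0 s0 /andP[hh]; rewrite le_min => /andP[hh0 hh0'] uL aY Y01.
have {H}[i1 e1] := H x s h u Y x0 s0 (introT andP (conj hh hh0)) uL aY Y01.
have {H'}[i2 e2] := H' x s h u Y x0 s0 (introT andP (conj hh hh0')) uL aY Y01.
have i2' := integrableZl_EFin (a n) measurableT i2.
have e w : Y w * \sum_(j < n.+1) a j * weighted_moment j u s h w =
   Y w * (\sum_(j < n) a j * weighted_moment j u s h w) + a n * (Y w * weighted_moment n u s h w).
  by rewrite big_ord_recr/=; ring.
split.
  by apply: eq_integrable (integrableD_EFin measurableT i1 i2') => // w _; rewrite /= e.
rewrite (eq_Rintegral _ (fun w _ => e w)) (RintegralD measurableT i1 i2').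
rewrite (RintegralZl _ measurableT i2) big_ord_recr/=.
move: e1 e2; move: (\int[P x]_w _) (\int[P x]_w _) (\int[P x]_w _) (\sum_(j < n) _) (second_diff _).
move=> p q r S D' e1 e2.
have -> : r + a n * p - h * (S + a n * D') * q = (r - h * S * q) + a n * (p - h * D' * q) by ring.
apply: (le_trans (ler_normD _ _)); rewrite normrM mulrDl lerD//.
by rewrite -[leRHS]mulrA ler_wpM2l.
Qed.

(** The quadratic part sees the polynomial only at [z = 1], where it is the sum of the coefficients;
    the jump part sees it at [z = exp (- theta)]. *)
Lemma sum_second_diff (a : nat -> R) (n : nat) (u : R) : 0 <= u ->
  pi.-integrable D (EFin \o (fun theta => (\sum_(j < n) a j * expR (- theta) ^+ j) *
     (expR (- (u * theta)) * (1 - expR (- theta)) ^+ 2))) /\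
  \sum_(j < n) a j * second_diff (u + j%:R) = 2 * beta * (\sum_(j < n) a j) +
  \int[pi]_(theta in D) ((\sum_(j < n) a j * expR (- theta) ^+ j) *
     (expR (- (u * theta)) * (1 - expR (- theta)) ^+ 2)).
Proof.
move=> u0; elim: n => [|n [i1 e1]].
  rewrite !big_ord0; have e theta : (\sum_(j < 0) a j * expR (- theta) ^+ j) *
     (expR (- (u * theta)) * (1 - expR (- theta)) ^+ 2) = 0 by rewrite big_ord0 mul0r.
  under eq_Rintegral do rewrite big_ord0 mul0r.
  rewrite Rintegral_cst// mul0r mulr0 addr0; split=> //.
  apply: (@eq_integrable _ _ _ _ _ _ (EFin \o (fun=> 0))) => //.
    by move=> w _; rewrite /= e.
  apply: (levy_integrable pi_moment (C := 0)) => // theta _.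
  by rewrite normr0 mul0r.
have un0 : 0 <= u + n%:R by rewrite addr_ge0.
have i2 := integrable_expRN_sqr un0.
have i2' : pi.-integrable D (EFin \o (fun theta => a n *
   (expR (- ((u + n%:R) * theta)) * (1 - expR (- theta)) ^+ 2))).
  exact: (integrableZl_EFin _ _ i2).
have e theta : (\sum_(j < n.+1) a j * expR (- theta) ^+ j) *
     (expR (- (u * theta)) * (1 - expR (- theta)) ^+ 2) =
   (\sum_(j < n) a j * expR (- theta) ^+ j) * (expR (- (u * theta)) * (1 - expR (- theta)) ^+ 2)
   + a n * (expR (- ((u + n%:R) * theta)) * (1 - expR (- theta)) ^+ 2).
  rewrite big_ord_recr/=.
  have -> : - ((u + n%:R) * theta) = n%:R * - theta - u * theta by ring.
  rewrite expRD expRM_natl; ring.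
split.
  by apply: eq_integrable (integrableD_EFin _ i1 i2') => // w _; rewrite /= e.
under eq_Rintegral do rewrite e.
rewrite RintegralD// RintegralZl// !big_ord_recr/= e1.
rewrite /second_diff; ring.
Qed.

Variables (B : R) (g k : R -> R).
Hypothesis gB : levy_cutoff B g.
Hypothesis g01 : forall y, 0 <= g y <= 1.
Hypothesis gk : forall y, g y = k (expR (- y)) * (1 - expR (- y)) ^+ 2.
Hypothesis k_lip : bounded_lipschitz k.
Hypothesis k1 : k 1 = 0.

(** Since [k 1 = 0], the value [p(1)] is at most [e] in absolute value and so the quadratic part
    contributes at most [2 * beta * e]: the continuous part of the motion creates no killing. *)
Lemma sum_second_diff_dist (p : {poly R}) (e u : R) : 0 <= u ->
  (forall z, 0 <= z <= 1 -> `|k z - p.[z]| <= e) ->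
  `|\sum_(j < size p) p`_j * second_diff (u + j%:R) - killing_rate pi g u|
    <= e * (2 * beta + levy_mass pi).
Proof.
move=> u0 kp; have [i1 ->] := sum_second_diff (fun j => p`_j) (size p) u0.
have ig := integrable_cutoff_expRN pi_moment gB u0.
rewrite /killing_rate -addrA -RintegralB//.
have -> : e * (2 * beta + levy_mass pi) = e * (2 * beta) + e * levy_mass pi by ring.
apply: (le_trans (ler_normD _ _)); rewrite lerD//.
  rewrite normrM mulrC (@ger0_norm _ (2 * beta)) ?mulr_ge0//.
  rewrite ler_wpM2r ?mulr_ge0//.
  have := kp 1; rewrite k1 sub0r normrN horner_coef ler01 lexx => /(_ isT).
  by under eq_bigr do rewrite expr1n mulr1.
apply: (le_levy_integral pi_moment).
  have m1 : measurable_fun setT (fun theta : measurableTypeR R =>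
      \sum_(j < size p) p`_j * expR (- theta) ^+ j).
    apply: measurable_sum => j; apply: measurable_funM => //.
    by apply: measurable_funX; apply: measurableT_comp.
  apply: measurable_funB; last exact: measurable_cutoff_expRN gB.
  by apply: measurable_funM => //; exact: measurable_expRN_sqr.
move=> theta t0; rewrite gk.
have -> : \sum_(j < size p) p`_j * expR (- theta) ^+ j = p.[expR (- theta)].
  by rewrite horner_coef.
have -> : p.[expR (- theta)] * (expR (- (u * theta)) * (1 - expR (- theta)) ^+ 2) -
    k (expR (- theta)) * (1 - expR (- theta)) ^+ 2 * expR (- (u * theta)) =
  (p.[expR (- theta)] - k (expR (- theta))) *
  (expR (- (u * theta)) * (1 - expR (- theta)) ^+ 2) by ring.
rewrite normrM ler_pM//; last by rewrite -[leRHS]mul1r expRN_sqr_le.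
by rewrite distrC kp// expR_ge0/= -expR0 ler_expR oppr_le0 ltW.
Qed.

Lemma measurable_increment_cutoff (s h u : R) : 0 <= s -> 0 <= h ->
  measurable_fun setT (fun w => g (X (s + h) w - X s w) * expR (- (u * X (s + h) w))).
Proof.
move=> s0 h0; have sh0 : 0 <= s + h by rewrite addr_ge0.
apply: measurable_funM; last exact: (measurable_expRN_marginal hX).
apply: (measurableT_comp (f := g)); first by case: gB.
by apply: measurable_funB; exact: (cb_measurable hX).
Qed.

Lemma integrable_increment_cutoff (x s h u : R) (Y : T -> R) : 0 <= s -> 0 <= h -> 0 <= u ->
  measurable_fun setT Y -> (forall w, 0 <= Y w <= 1) ->
  (P x).-integrable setT
    (EFin \o (fun w => Y w * (g (X (s + h) w - X s w) * expR (- (u * X (s + h) w))))).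
Proof.
move=> s0 h0 u0 mY Y01; have sh0 : 0 <= s + h by rewrite addr_ge0.
apply: (@integrable_bounded_fun _ _ _ _ _ 1).
  by apply: measurable_funM => //; exact: measurable_increment_cutoff.
move=> w; have /andP[Y0 Y1] := Y01 w; have /andP[g0 g1] := g01 (X (s + h) w - X s w).
have /andP[e0 e1] := expRN_marginal_le1 hX w sh0 u0.
rewrite !normrM !ger0_norm// -[leRHS]mulr1 ler_pM// ?mulr_ge0//.
by rewrite -[leRHS]mulr1 ler_pM.
Qed.

Lemma integrable_marginal_expRN (x c u s : R) (Y : T -> R) : 0 < c -> c <= u -> 0 <= s ->
  measurable_fun setT Y -> (forall w, 0 <= Y w <= 1) ->
  (P x).-integrable setT (EFin \o (fun w => Y w * (X s w * expR (- (u * X s w))))).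
Proof.
move=> c0 cu s0 mY Y01; apply: (@integrable_bounded_fun _ _ _ _ _ c^-1).
  apply: measurable_funM => //; apply: measurable_funM.
    exact: (cb_measurable hX).
  exact: (measurable_expRN_marginal hX).
move=> w; have /andP[Y0 Y1] := Y01 w.
have /andP[h0 h1] := marginal_expRN_le hX w c0 cu s0.
rewrite ger0_norm; last by apply: mulr_ge0.
by apply: le_trans h1; rewrite ler_piMl.
Qed.

(** As [X >= 0], [z = exp (- (X_(s+h) - X_s))] is at most [exp X_s]. Where [X_s <= K], [k] is
    replaced by a polynomial on [[0, exp K]], and an error [e1] costs [e1] times a weighted moment
    of order [h]. Where [X_s > K], [k] is only bounded, but the weighted moment is governed by
    [X_s exp (- u X_s)], which is at most [e1] there. *)
Lemma killed_moment (c L e : R) : 0 < c -> 0 <= L -> 0 < e ->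
  exists2 h0 : R, 0 < h0 &
  forall (x s h u : R) (Y : T -> R), 0 <= x -> 0 <= s -> 0 <= h <= h0 ->
    c <= u <= L -> adapted X s Y -> (forall w, 0 <= Y w <= 1) ->
    `|\int[P x]_w (Y w * (g (X (s + h) w - X s w) * expR (- (u * X (s + h) w))))
      - h * killing_rate pi g u * \int[P x]_w (Y w * (X s w * expR (- (u * X s w))))|
      <= e * h.
Proof.
move=> c0 L0 e0.
have [Ck Ck0 [kC _]] := k_lip.
pose m0 := 2 * beta + levy_mass pi.
have m00 : 0 <= m0 by rewrite addr_ge0 ?mulr_ge0// levy_mass_ge0.
pose bm := `|B| * levy_mass pi.
have bm0 : 0 <= bm by rewrite mulr_ge0// levy_mass_ge0.
(* [Q] collects the coefficients of [e1 * h] in the final estimate, and [W] below those of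
   [h ^+ 2]. *)
pose Q := c^-1 * m0 + c^-1 * m0 + Ck * m0 + bm.
have ci0 : 0 < c^-1 by rewrite invr_gt0.
have Q0 : 0 <= Q by rewrite !addr_ge0// mulr_ge0// ltW.
have [e1 e10 e1Q] : exists2 e1 : R, 0 < e1 & e1 * Q <= e / 2.
  exists (e / 2 / (Q + 1)); first by rewrite !divr_gt0// ltr_wpDl.
  rewrite mulrAC ler_pdivrMr ?ltr_wpDl// ler_wpM2l ?lerDl//.
  by rewrite divr_ge0// ltW.
(* From [y ^+ 2 * exp (- u y) <= 4 / c ^+ 2], any [y > K] satisfies [y * exp (- u y) <= e1]. *)
pose K := 4 / c ^+ 2 / e1.
have K0 : 0 < K by rewrite !divr_gt0// exprn_gt0.
have tail y u : K < y -> c <= u -> y * expR (- (u * y)) <= e1.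
  move=> Ky cu; have y0 : 0 < y by exact: lt_trans Ky.
  have := sqr_expRNM_le c0 (ltW y0).
  have h1 : y ^+ 2 * expR (- (u * y)) <= y ^+ 2 * expR (- (y * c)).
    by rewrite ler_wpM2l ?sqr_ge0// ler_expR lerN2 [u * y]mulrC ler_wpM2l// ltW.
  move/(le_trans h1) => h2.
  rewrite -(ler_pM2l y0) mulrA -expr2 (le_trans h2)//.
  by move: Ky; rewrite /K ltr_pdivrMr// => /ltW.
have eK0 : 0 < expR K by exact: expR_gt0.
have [p hp] := polynomial_approx k_lip eK0 e10.
have kp1 z : 0 <= z <= 1 -> `|k z - p.[z]| <= e1.
  move=> /andP[z0 z1]; apply: hp; rewrite z0 (le_trans z1)//.
  by rewrite -expR0 ler_expR ltW.
have [C0 C00 [k0 k00 H0]] := weighted_moment_expansion 0 c0 L0.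
have [C1 C10 [k1' k10 H1]] := weighted_sum_expansion (fun j => p`_j) (size p) c0 L0.
pose W := e1 * C0 + C1 + Ck * C0.
have W0 : 0 <= W by rewrite !addr_ge0// mulr_ge0// ltW.
exists (Num.min (Num.min k0 k1') (e / 2 / (W + 1))).
  by rewrite !lt_min k00 k10/= !divr_gt0// ltr_wpDl.
move=> x s h u Y x0 s0 /andP[h0]; rewrite !le_min => /andP[/andP[hk0 hk1] hW] uL aY Y01.
have [cu _] := andP uL; have u0 : 0 <= u by rewrite (le_trans (ltW c0)).
have mY := adapted_measurable hX aY.
have hh0 : 0 <= h <= k0 by rewrite h0.
have hh1 : 0 <= h <= k1' by rewrite h0.
pose I1 : R -> R := \1_(`]-oo, K]%classic : set R).
pose I2 : R -> R := \1_(`]K, +oo[%classic : set R).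
pose Y1 w := Y w * I1 (X s w); pose Y2 w := Y w * I2 (X s w).
have I1E y : I1 y = (y <= K)%R%:R.
  rewrite /I1 indicE; congr (nat_of_bool _)%:R.
  by apply/idP/idP => [/set_mem|yK]; [|apply/mem_set]; rewrite /= in_itv.
have I2E y : I2 y = (K < y)%R%:R.
  rewrite /I2 indicE; congr (nat_of_bool _)%:R.
  by apply/idP/idP => [/set_mem|yK]; [|apply/mem_set]; rewrite /= in_itv/= andbT.
have as_ : adapted X s (X s) by apply: adapted_marginal; rewrite s0 lexx.
have aY1 : adapted X s Y1.
  by apply: measurable_funM => //; apply: measurableT_comp as_; exact: measurable_indic.
have aY2 : adapted X s Y2.
  by apply: measurable_funM => //; apply: measurableT_comp as_; exact: measurable_indic.
have Y101 w : 0 <= Y1 w <= 1.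
  by rewrite /Y1 I1E; case: (X s w <= K); rewrite /= ?mulr1n ?mulr0n ?mulr1 ?mulr0 ?lexx ?ler01 ?Y01.
have Y201 w : 0 <= Y2 w <= 1.
  by rewrite /Y2 I2E; case: (K < X s w); rewrite /= ?mulr1n ?mulr0n ?mulr1 ?mulr0 ?lexx ?ler01 ?Y01.
have mY1 := adapted_measurable hX aY1.
have mY2 := adapted_measurable hX aY2.
have YE w : Y w = Y1 w + Y2 w.
  by rewrite /Y1 /Y2 I1E I2E; case: leP => _; rewrite /= ?mulr1n ?mulr0n ?mulr1 ?mulr0 ?addr0 ?add0r.
have Y1z w : K < X s w -> Y1 w = 0 by move=> XK; rewrite /Y1 I1E leNgt XK/= mulr0n mulr0.
have Y2z w : X s w <= K -> Y2 w = 0 by move=> XK; rewrite /Y2 I2E ltNge XK/= mulr0n mulr0.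
clearbody Y1 Y2; clear I1 I2 I1E I2E.
have iF1 := integrable_increment_cutoff x s0 h0 u0 mY1 Y101.
have iF2 := integrable_increment_cutoff x s0 h0 u0 mY2 Y201.
have iX1 := integrable_marginal_expRN x c0 cu s0 mY1 Y101.
have iX2 := integrable_marginal_expRN x c0 cu s0 mY2 Y201.
under eq_Rintegral do rewrite YE mulrDl.
under [X in _ - _ * X]eq_Rintegral do rewrite YE mulrDl.
rewrite (RintegralD measurableT iF1 iF2) (RintegralD measurableT iX1 iX2).
have [iS1 eS1] := H1 x s h u Y1 x0 s0 hh1 uL aY1 Y101.
have [iM1 eM1] := H0 x s h u Y1 x0 s0 hh0 uL aY1 Y101.
have [iM2 eM2] := H0 x s h u Y2 x0 s0 hh0 uL aY2 Y201.
have iM1' := integrableZl_EFin e1 measurableT iM1.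
have iM2' := integrableZl_EFin Ck measurableT iM2.
have wm0 w : 0 <= weighted_moment 0 u s h w.
  by rewrite /weighted_moment; apply: mulr_ge0; [exact: sqr_ge0|apply: mulr_ge0; rewrite ?exprn_ge0 ?expR_ge0].
have gE w : g (X (s + h) w - X s w) * expR (- (u * X (s + h) w)) =
    k (expR (- (X (s + h) w - X s w))) * weighted_moment 0 u s h w.
  by rewrite gk /weighted_moment; ring.
have pE w : \sum_(j < size p) p`_j * weighted_moment j u s h w =
    p.[expR (- (X (s + h) w - X s w))] * weighted_moment 0 u s h w.
  rewrite horner_coef mulr_suml; apply: eq_bigr => j _.
  by rewrite /weighted_moment; ring.
have T1 : `|\int[P x]_w (Y1 w * (g (X (s + h) w - X s w) * expR (- (u * X (s + h) w)))) -
    \int[P x]_w (Y1 w * \sum_(j < size p) p`_j * weighted_moment j u s h w)| <=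
    \int[P x]_w (e1 * (Y1 w * weighted_moment 0 u s h w)).
  apply: expectation_dist_le_fun => // w.
  rewrite gE pE -mulrBr -mulrBl normrM normrM (ger0_norm (wm0 w)).
  have /andP[Y10 _] := Y101 w; rewrite (ger0_norm Y10).
  have [XK|XK] := leP (X s w) K; last by rewrite Y1z// !mul0r mulr0.
  rewrite [leRHS]mulrCA ler_wpM2l// ler_wpM2r//.
  apply: hp; rewrite expR_ge0/= ler_expR opprB lerBlDr (le_trans XK)// lerDl.
  by apply: (cb_ge0 hX); rewrite addr_ge0.
have T4 : `|\int[P x]_w (Y2 w * (g (X (s + h) w - X s w) * expR (- (u * X (s + h) w)))) -
    0| <= \int[P x]_w (Ck * (Y2 w * weighted_moment 0 u s h w)).
  have -> : 0 = \int[P x]_w (0 : R) by rewrite Rintegral_cst// mul0r.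
  apply: expectation_dist_le_fun => //.
    by apply: (@integrable_bounded_fun _ _ _ _ _ 0) => // w; rewrite normr0.
  move=> w; rewrite subr0 gE normrM normrM (ger0_norm (wm0 w)).
  have /andP[Y20 _] := Y201 w; rewrite (ger0_norm Y20) mulrCA ler_wpM2r//.
  by rewrite mulr_ge0.
rewrite (RintegralZl _ measurableT iM1) in T1.
rewrite (RintegralZl _ measurableT iM2) subr0 in T4.
have D0b := second_diff_bounds (addr_ge0 u0 (ler0n R 0)).
have Dpk := sum_second_diff_dist u0 kp1.
have kr0 := killing_rate_ge0 pi u gB.
have krb : killing_rate pi g u <= bm.
  apply: (le_trans (killing_rate_le pi_moment gB u0)).
  by rewrite ler_wpM2r ?levy_mass_ge0// ler_norm.
have Z10 : 0 <= \int[P x]_w (Y1 w * (X s w * expR (- (u * X s w)))) <= c^-1.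
  apply/andP; split.
    apply: Rintegral_ge0 => w _; have /andP[Y10 _] := Y101 w.
    by have /andP[? _] := marginal_expRN_le hX w c0 cu s0; rewrite mulr_ge0.
  apply: expectation_le_cst => // w; have /andP[Y10 Y11] := Y101 w.
  have /andP[z0 z1] := marginal_expRN_le hX w c0 cu s0.
  by apply: le_trans z1; rewrite ler_piMl.
have Z20 : 0 <= \int[P x]_w (Y2 w * (X s w * expR (- (u * X s w)))) <= e1.
  apply/andP; split.
    apply: Rintegral_ge0 => w _; have /andP[Y20 _] := Y201 w.
    by have /andP[? _] := marginal_expRN_le hX w c0 cu s0; rewrite mulr_ge0.
  apply: expectation_le_cst => // w; have /andP[Y20 Y21] := Y201 w.
  have [XK|XK] := leP (X s w) K; first by rewrite Y2z// mul0r ltW.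
  have /andP[z0 z1] := marginal_expRN_le hX w c0 cu s0.
  by apply: le_trans (tail _ _ XK cu); rewrite ler_piMl.
have hW' : h * (W + 1) <= e / 2.
  by move: hW; rewrite ler_pdivlMr// ltr_wpDl.
move: (second_diff (u + 0)) D0b eM1 eM2 => D0 /andP[D00 D01] eM1 eM2.
move: (\sum_(j < size p) p`_j * second_diff (u + j%:R)) Dpk eS1 => Dp Dpk eS1.
move: (killing_rate pi g u) kr0 krb Dpk => kr kr0 krb Dpk.
move: (\int[P x]_w (Y1 w * (X s w * expR (- (u * X s w))))) Z10 eS1 eM1 => Z1 /andP[Z10 Z11] eS1 eM1.
move: (\int[P x]_w (Y2 w * (X s w * expR (- (u * X s w))))) Z20 eM2 => Z2 /andP[Z20 Z21] eM2.
move: (\int[P x]_w (Y1 w * weighted_moment 0 u s h w)) eM1 T1 => M1 eM1 T1.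
move: (\int[P x]_w (Y2 w * weighted_moment 0 u s h w)) eM2 T4 => M2 eM2 T4.
move: (\int[P x]_w (Y1 w * \sum_(j < size p) p`_j * weighted_moment j u s h w)) eS1 T1 => S1 eS1 T1.
move: (\int[P x]_w (Y1 w * (g (X (s + h) w - X s w) * expR (- (u * X (s + h) w))))) T1 => F1 T1.
move: (\int[P x]_w (Y2 w * (g (X (s + h) w - X s w) * expR (- (u * X (s + h) w))))) T4 => F2 T4.
have M1b : M1 <= h * (m0 * c^-1) + C0 * h ^+ 2.
  rewrite -[leLHS](subrK (h * D0 * Z1)) [leLHS]addrC lerD//.
    by rewrite -mulrA ler_wpM2l// ler_pM.
  exact: le_trans (ler_norm _) eM1.
have M2b : M2 <= h * (m0 * e1) + C0 * h ^+ 2.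
  rewrite -[leLHS](subrK (h * D0 * Z2)) [leLHS]addrC lerD//.
    by rewrite -mulrA ler_wpM2l// ler_pM.
  exact: le_trans (ler_norm _) eM2.
have b1 : `|F1 - S1| <= e1 * (h * (m0 * c^-1) + C0 * h ^+ 2).
  by apply: (le_trans T1); rewrite ler_wpM2l// ltW.
have b2 : `|F2| <= Ck * (h * (m0 * e1) + C0 * h ^+ 2).
  by apply: (le_trans T4); rewrite ler_wpM2l.
have b3 : `|h * (Dp - kr) * Z1| <= h * (e1 * m0 * c^-1).
  rewrite !normrM (ger0_norm h0) (ger0_norm Z10) -mulrA ler_wpM2l//.
  by rewrite ler_pM.
have b4 : `|h * kr * Z2| <= h * (bm * e1).
  rewrite !normrM (ger0_norm h0) (ger0_norm Z20) (ger0_norm kr0) -mulrA ler_wpM2l//.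
  by rewrite ler_pM.
(* In order: polynomial approximation, moment expansion, second differences against the killing
   rate, and the two contributions of large [X_s]. *)
have -> : F1 + F2 - h * kr * (Z1 + Z2) =
  (F1 - S1) + (S1 - h * Dp * Z1) + h * (Dp - kr) * Z1 + F2 - h * kr * Z2 by ring.
apply: (le_trans (ler_normB _ _)); apply: (le_trans (lerD (ler_normD _ _) b4)).
apply: (le_trans (lerD (lerD (ler_normD _ _) b2) (lexx _))).
apply: (le_trans (lerD (lerD (lerD (ler_normD _ _) b3) (lexx _)) (lexx _))).
apply: (le_trans (lerD (lerD (lerD (lerD b1 eS1) (lexx _)) (lexx _)) (lexx _))).
have -> : e1 * (h * (m0 * c^-1) + C0 * h ^+ 2) + C1 * h ^+ 2 + h * (e1 * m0 * c^-1) +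
   Ck * (h * (m0 * e1) + C0 * h ^+ 2) + h * (bm * e1) = h * (e1 * Q) + h * (h * W).
  by rewrite /Q /W; ring.
have -> : e * h = h * (e / 2) + h * (e / 2) by rewrite -mulrDr -splitr mulrC.
rewrite lerD// ler_wpM2l//; apply: le_trans hW'.
by rewrite ler_wpM2l// lerDl.
Qed.

(* Killing the process at a jump of size [y] with probability [g y] multiplies
   the semigroup over a time [h] by the Euler step of [Phi - killing_rate]. *)
Lemma killed_one_step (c L e : R) : 0 < c -> 0 <= L -> 0 < e ->
  exists2 h0 : R, 0 < h0 &
  forall (x s h u : R) (Y : T -> R), 0 <= x -> 0 <= s -> 0 <= h <= h0 ->
    c <= u <= L -> adapted X s Y -> (forall w, 0 <= Y w <= 1) ->
    `|\int[P x]_w (Y w * ((1 - g (X (s + h) w - X s w)) * expR (- (u * X (s + h) w))))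
      - \int[P x]_w (Y w * expR (- ((u - h * (Phi u - killing_rate pi g u)) * X s w)))|
      <= e * h.
Proof.
move=> c0 L0 e0.
have lip : lipschitz_on_segments Phi by move=> M; exact: branching_mechanism_lipschitz.
have [M M0 HM] := lipschitz_on_segments_bounded lip L0.
pose bm := `|B| * levy_mass pi.
have bm0 : 0 <= bm by rewrite mulr_ge0// levy_mass_ge0.
have [C C0 [h1 h10 H1]] := exp_moment_expansion hX lip laplace_v v_ge0 v_expansion 0 c0 L0.
have e20 : 0 < e / 2 by rewrite divr_gt0.
have [h2 h20 H2] := killed_moment c0 L0 e20.
have [C' C'0 [h3 h30 H3]] := expR_perturbation c0 (addr_ge0 M0 bm0) (lexx 0).
have CC0 : 0 <= C + C' by rewrite addr_ge0.
exists (Num.min (Num.min h1 h2) (Num.min h3 (e / 2 / (C + C' + 1)))).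
  by rewrite !lt_min h10 h20 h30/= divr_gt0// ltr_wpDl.
move=> x s h u Y x0 s0 /andP[h0]; rewrite !le_min => /andP[/andP[hh1 hh2] /andP[hh3 hC]] uL aY Y01.
have [cu uL'] := andP uL; have u0 : 0 <= u by rewrite (le_trans (ltW c0)).
have mY := adapted_measurable hX aY.
have hh1' : 0 <= h <= h1 by rewrite h0.
have hh2' : 0 <= h <= h2 by rewrite h0.
have [i1 e1] := H1 x s h u Y x0 s0 hh1' uL aY Y01.
have e2 := H2 x s h u Y x0 s0 hh2' uL aY Y01.
have iF := integrable_increment_cutoff x s0 h0 u0 mY Y01.
have iX := integrable_marginal_expRN x c0 cu s0 mY Y01.
have sh0 : 0 <= s + h by rewrite addr_ge0.
have iE : (P x).-integrable setT (EFin \o (fun w => Y w * expR (- (u * X (s + h) w)))).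
  by apply: eq_integrable i1 => // w _; rewrite /= expr0 mul1r.
set Psi := Phi u - killing_rate pi g u.
have kr0 := killing_rate_ge0 pi u gB.
have krb : killing_rate pi g u <= bm.
  apply: (le_trans (killing_rate_le pi_moment gB u0)).
  by rewrite ler_wpM2r ?levy_mass_ge0// ler_norm.
have Psib : `|Psi| <= M + bm.
  apply: (le_trans (ler_normB _ _)); rewrite lerD//; first by apply: HM; rewrite u0.
  by rewrite ger0_norm.
have iG r := integrable_first_order hX x (h * r) c0 cu s0 mY Y01.
have pert w : `|expR (- ((u - h * Psi) * X s w)) -
    expR (- (u * X s w)) * (1 + X s w * (h * Psi))| <= C' * h ^+ 2.
  rewrite [u * _]mulrC [(u - _) * _]mulrC mulrA; apply: H3 => //.
  - exact: (cb_ge0 hX).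
  - by rewrite h0.
  - by rewrite subrr normr0 mul0r.
have iL : (P x).-integrable setT (EFin \o (fun w => Y w * expR (- ((u - h * Psi) * X s w)))).
  apply: (@integrable_bounded_fun _ _ _ _ _ (1 + c^-1 * `|h * Psi| + C' * h ^+ 2)).
    by apply: measurable_funM => //; exact: (measurable_expRN_marginal hX).
  move=> w; have /andP[Y0 Y1] := Y01 w.
  rewrite normrM (ger0_norm Y0) -[leRHS]mul1r ler_pM//.
  have pw := pert w; move: pw.
  set A := expR (- ((u - h * Psi) * X s w)); set E := expR (- (u * X s w)) * _ => pw.
  have -> : A = E + (A - E) by ring.
  apply: (le_trans (ler_normD _ _)); rewrite lerD//.
  have /andP[z0 z1] := marginal_expRN_le hX w c0 cu s0.
  have /andP[e0' e1'] := expRN_marginal_le1 hX w s0 u0.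
  rewrite /E mulrDr mulr1 mulrA [expR _ * X s w]mulrC.
  apply: (le_trans (ler_normD _ _)); rewrite normrM (ger0_norm e0') (ger0_norm z0).
  by rewrite lerD// ler_wpM2r.
have e3 : `|\int[P x]_w (Y w * expR (- ((u - h * Psi) * X s w))) -
    \int[P x]_w (Y w * (expR (- (u * X s w)) * (1 + X s w * (h * Psi))))| <= C' * h ^+ 2.
  apply: expectation_dist_le; [exact: iL|exact: (iG Psi)|move=> w].
  have /andP[Y0 Y1] := Y01 w.
  rewrite -mulrBr normrM (ger0_norm Y0); apply: le_trans (pert w).
  by rewrite ler_piMl.
have e4 : \int[P x]_w (Y w * (expR (- (u * X s w)) * (1 + X s w * (h * Psi)))) =
    \int[P x]_w (Y w * (expR (- (u * X s w)) * (1 + X s w * (h * Phi u)))) -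
    h * killing_rate pi g u * \int[P x]_w (Y w * (X s w * expR (- (u * X s w)))).
  have iX' := integrableZl_EFin (h * killing_rate pi g u) measurableT iX.
  rewrite -(RintegralZl _ measurableT iX) -(RintegralB measurableT (iG _) iX').
  by apply: eq_Rintegral => w _; rewrite /Psi; ring.
have e5 : \int[P x]_w (Y w * ((1 - g (X (s + h) w - X s w)) * expR (- (u * X (s + h) w)))) =
    \int[P x]_w (Y w * expR (- (u * X (s + h) w))) -
    \int[P x]_w (Y w * (g (X (s + h) w - X s w) * expR (- (u * X (s + h) w)))).
  rewrite -(RintegralB measurableT iE iF).
  by apply: eq_Rintegral => w _; ring.
rewrite e5; rewrite e4 in e3.
have {}e1 : `|\int[P x]_w (Y w * expR (- (u * X (s + h) w))) -
    \int[P x]_w (Y w * (expR (- (u * X s w)) * (1 + X s w * (h * Phi u))))| <= C * h ^+ 2.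
  move: e1; rewrite addr0; congr (`|_ - _| <= _).
  by apply: eq_Rintegral => w _; rewrite expr0 mul1r.
have hC' : (C + C') * h ^+ 2 <= e / 2 * h.
  rewrite expr2 mulrA ler_wpM2r//; move: hC; rewrite ler_pdivlMr ?ltr_wpDl//.
  by rewrite mulrDr mulr1 mulrC; lra.
move: e1 e2 e3; move: (\int[P x]_w _) (\int[P x]_w _) (\int[P x]_w _)
  (\int[P x]_w _) (\int[P x]_w _).
move=> L5 a2 F1 G1 E1 b1 b2 b3.
have -> : E1 - F1 - L5 = (E1 - G1) - (F1 - h * killing_rate pi g u * a2) -
  (L5 - (G1 - h * killing_rate pi g u * a2)) by ring.
apply: (le_trans (ler_normB _ _)); apply: (le_trans (lerD (ler_normB _ _) b3)).
apply: (le_trans (lerD (lerD b1 b2) (lexx _))).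
rewrite addrAC -mulrDl; apply: (le_trans (lerD hC' (lexx _))).
by rewrite -mulrDl -splitr.
Qed.

End killed_step.

(** * Iteration along a grid *)

Section iteration.
Context {R : realType} {d : measure_display} {T : measurableType d}.
Context (P : R -> probability T R) (X : R -> T -> R).
Variable v : R -> R -> R.
Hypothesis laplace_v : forall x t l : R, 0 <= x -> 0 <= t -> 0 <= l ->
  \int[P x]_w expR (- (l * X t w)) = expR (- (x * v t l)).
Hypothesis v0 : forall l : R, 0 <= l -> v 0 l = l.
Variables (m : R -> R -> T -> R) (Psi : R -> R) (a q : R).
Hypothesis m_adapted : forall h s r : R, 0 <= s -> 0 <= h -> s + h <= r ->
  adapted X r (m h s).
Hypothesis m01 : forall (h s : R) w, 0 <= s -> 0 <= h -> 0 <= m h s w <= 1.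
Hypothesis m_step : forall c L e : R, 0 < c -> 0 <= L -> 0 < e ->
  exists2 h0 : R, 0 < h0 &
  forall (x s h u : R) (Y : T -> R), 0 <= x -> 0 <= s -> 0 <= h <= h0 ->
    c <= u <= L -> adapted X s Y -> (forall w, 0 <= Y w <= 1) ->
    `|\int[P x]_w (Y w * (m h s w * expR (- (u * X (s + h) w))))
      - \int[P x]_w (Y w * expR (- ((u - h * Psi u) * X s w)))| <= e * h.
Hypothesis a_ge0 : 0 <= a.
Hypothesis q_ge0 : 0 <= q.
Hypothesis Psi_ge : forall u, 0 <= u -> - (a * u) - q <= Psi u.
Hypothesis Psi_le : forall L : R, 0 <= L -> exists2 C : R, 0 <= C &
  forall u, 0 <= u <= L -> Psi u <= C * u.

(** A telescoping argument: [A k] keeps the first [k] factors of the product and replaces the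
    remaining [N - k] steps by as many Euler steps from [lam]. Since the iterates stay in [[c, L]],
    one threshold on the mesh serves every step; each costs [(e / t) * h], and [N * h = t]. The
    abstract factor [m] covers both killing and discounting. *)
Lemma cvg_grid_product (x t lam : R) : 0 <= x -> 0 < t -> 0 < lam ->
  \int[P x]_w ((\prod_(k < n.+1) m (t / n.+1%:R) (k%:R * (t / n.+1%:R)) w)
      * expR (- (lam * X t w)))
   - expR (- (x * euler Psi (t / n.+1%:R) lam n.+1)) @[n --> \oo] --> (0 : R).
Proof.
move=> x0 t0 lam0; apply/cvgrPdist_le => e e0.
pose L := (lam + q * t) * expR (a * t).
have L0 : 0 <= L by rewrite mulr_ge0 ?expR_ge0// addr_ge0 ?(ltW lam0)// mulr_ge0// ltW.
have [C C0 HC] := Psi_le L0.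
pose c := lam * expR (- (2 * C * t)).
have c0 : 0 < c by rewrite mulr_gt0// expR_gt0.
have et0 : 0 < e / t by rewrite divr_gt0.
have [h0 h00 Hstep] := m_step c0 L0 et0.
have iC0 : 0 < 1 / 2 / (C + 1) by rewrite !divr_gt0// ltr_wpDl.
near=> n.
have hlt0 : t / n.+1%:R < h0 by near: n; exact: near_mesh_lt.
have hltC : t / n.+1%:R < 1 / 2 / (C + 1) by near: n; exact: near_mesh_lt.
set h := t / n.+1%:R in hlt0 hltC *; set N := n.+1.
have h_gt0 : 0 < h by rewrite divr_gt0.
have hh0 : 0 <= h <= h0.
  by rewrite (ltW h_gt0)/= ltW.
have hC : h * C <= 1 / 2.
  have : h * (C + 1) <= 1 / 2.
    by rewrite -ler_pdivlMr ?ltr_wpDl// ltW.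
  by apply: le_trans; rewrite ler_wpM2l ?(ltW h_gt0)// lerDl.
have Nh : N%:R * h = t by rewrite /h mulrC divfK// pnatr_eq0.
have h_ge0 := ltW h_gt0.
pose u k := euler Psi h lam k.
have ub k : (k <= N)%N -> c <= u k <= L.
  move=> kN; have kt : k%:R * h <= t by rewrite -Nh ler_wpM2r// ler_nat.
  exact: (euler_bounds a_ge0 q_ge0 lam0 C0 h_ge0 hC kt Psi_ge HC).
pose Y k w := \prod_(j < k) m h (j%:R * h) w.
pose A k := \int[P x]_w (Y k w * expR (- (u (N - k)%N * X (k%:R * h) w))).
have aY k : adapted X (k%:R * h) (Y k).
  have : forall i, (i <= k)%N -> adapted X (k%:R * h) (Y i).
    elim=> [|i IH] ik.
      rewrite /Y; have -> : (fun w => \prod_(j < 0) m h (j%:R * h) w) = (fun=> 1).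
        by apply/funext => w; rewrite big_ord0.
      exact: measurable_cst.
    have -> : Y i.+1 = (fun w => Y i w * m h (i%:R * h) w).
      by apply/funext => w; rewrite /Y big_ord_recr.
    apply: measurable_funM; first exact: IH (ltnW ik).
    apply: m_adapted => //; first exact: mulr_ge0.
    have -> : i%:R * h + h = i.+1%:R * h by rewrite -natr1; ring.
    by rewrite ler_wpM2r// ler_nat.
  exact.
have Y01 k w : 0 <= Y k w <= 1.
  elim: k => [|k IH]; first by rewrite /Y big_ord0 ler01 lexx.
  have /andP[m0 m1] := m01 w (mulr_ge0 (ler0n R k) h_ge0) h_ge0.
  have /andP[Y0 Y1] := IH.
  rewrite /Y big_ord_recr/= -/(Y k w) mulr_ge0//= -[leRHS]mulr1.
  exact: ler_pM.
have stepA k : (k < N)%N -> `|A k.+1 - A k| <= e / t * h.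
  move=> kN.
  have := Hstep x (k%:R * h) h (u (N - k.+1)%N) (Y k) x0 (mulr_ge0 (ler0n R k) h_ge0) hh0
    (ub _ (leq_subr _ _)) (aY k) (Y01 k).
  have -> : u (N - k.+1)%N - h * Psi (u (N - k.+1)%N) = u (N - k)%N.
    by have -> : (N - k)%N = (N - k.+1).+1 by rewrite -subSn// subSS.
  rewrite -/(A k); congr (`|_ - _| <= _).
  rewrite /A; apply: eq_Rintegral => w _.
  have -> : k%:R * h + h = k.+1%:R * h by rewrite -natr1; ring.
  by rewrite /Y big_ord_recr/= mulrA.
have AN : `|A N - A 0%N| <= e.
  have : forall k, (k <= N)%N -> `|A k - A 0%N| <= k%:R * (e / t * h).
    elim=> [|k IH] kN; first by rewrite subrr normr0 mul0r.
    have -> : A k.+1 - A 0%N = (A k.+1 - A k) + (A k - A 0%N) by ring.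
    apply: (le_trans (ler_normD _ _)).
    by rewrite -natr1 mulrDl mul1r addrC lerD// ?IH// ?stepA// ltnW.
  move=> /(_ N (leqnn N)); rewrite mulrCA Nh divfK//; exact: lt0r_neq0.
have A0E : A 0%N = expR (- (x * u N)).
  rewrite /A subn0; have uN0 : 0 <= u N.
    by have /andP[cu _] := ub N (leqnn N); rewrite (le_trans (ltW c0)).
  rewrite -[u N in RHS]v0// -laplace_v//; apply: eq_Rintegral => w _.
  by rewrite /Y big_ord0 mul1r mul0r.
have ANE : A N = \int[P x]_w ((\prod_(k < N) m h (k%:R * h) w) * expR (- (lam * X t w))).
  by rewrite /A subnn Nh.
by rewrite sub0r normrN -ANE -A0E.
Unshelve. all: by end_near.
Qed.

End iteration.

Lemma v_expansion_at0 {R : realType} (Phi : R -> R) (v : R -> R -> R) :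
  (forall L : R, 0 <= L -> exists2 C : R, 0 <= C &
    forall u h : R, 0 <= u <= L -> 0 <= h <= 1 ->
      `|v h u - (u - h * Phi u)| <= C * h ^+ 2) ->
  forall l, 0 <= l -> v 0 l = l.
Proof.
move=> H l l0; have [C C0 HC] := H l l0.
have := HC l 0; rewrite l0 !lexx ler01 => /(_ isT isT).
rewrite mul0r subr0 expr0n/= mulr0 normr_le0 subr_eq0 => /eqP//.
Qed.

(** * The killed process on the grid *)

Section killed_mechanism_bounds.
Context {R : realType} (alpha beta : R).
Context (pi : {measure set (measurableTypeR R) -> \bar R}).
Hypothesis pi_moment :
  (\int[pi]_(theta in `]0%R, +oo[) (Num.min theta (theta ^+ 2))%:E < +oo)%E.
Hypothesis beta_ge0 : 0 <= beta.
Local Notation Phi := (branching_mechanism alpha beta pi).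
Variables (B : R) (g : R -> R).
Hypothesis gB : levy_cutoff B g.

Lemma killed_mechanism_ge (u : R) : 0 <= u ->
  - (`|alpha| * u) - `|B| * levy_mass pi <= Phi u - killing_rate pi g u.
Proof.
move=> u0; rewrite lerB//.
  apply: le_trans (branching_mechanism_ge pi alpha beta_ge0 u0).
  by rewrite -mulNr ler_wpM2r// lerNl -normrN ler_norm.
apply: (le_trans (killing_rate_le pi_moment gB u0)).
by rewrite ler_wpM2r ?levy_mass_ge0// ler_norm.
Qed.

(** [Phi] vanishes at 0 and the killing rate is nonnegative, so the bound is linear in [u]; this
    keeps the Euler iterates away from 0. *)
Lemma killed_mechanism_le (L : R) : 0 <= L -> exists2 C : R, 0 <= C &
  forall u, 0 <= u <= L -> Phi u - killing_rate pi g u <= C * u.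
Proof.
move=> L0; have [C C0 HC] := branching_mechanism_lipschitz pi_moment alpha beta L0.
exists C => // u uL; have [u0 _] := andP uL.
have := HC u 0 uL; rewrite lexx L0 branching_mechanism0 !subr0 (ger0_norm u0) => /(_ isT).
have := killing_rate_ge0 pi u gB; have := ler_norm (Phi u); lra.
Qed.

Lemma killed_mechanism_lipschitz (L : R) : 0 <= L -> exists2 C : R, 0 <= C &
  forall u w, 0 <= u <= L -> 0 <= w <= L ->
    `|(Phi u - killing_rate pi g u) - (Phi w - killing_rate pi g w)| <= C * `|u - w|.
Proof.
move=> L0; have [C C0 HC] := branching_mechanism_lipschitz pi_moment alpha beta L0.
exists (C + `|B| * levy_mass pi); first by rewrite addr_ge0// mulr_ge0// levy_mass_ge0.
move=> u w uL wL; have [u0 _] := andP uL; have [w0 _] := andP wL.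
have -> : (Phi u - killing_rate pi g u) - (Phi w - killing_rate pi g w) =
  (Phi u - Phi w) - (killing_rate pi g u - killing_rate pi g w) by ring.
apply: (le_trans (ler_normB _ _)); rewrite mulrDl lerD//; first exact: HC.
apply: (le_trans (killing_rate_lipschitz pi_moment gB u0 w0)).
by rewrite ler_wpM2r// ler_wpM2r ?levy_mass_ge0// ler_norm.
Qed.

Context {d : measure_display} {T : measurableType d}.
Context (P : R -> probability T R) (X : R -> T -> R).
Hypothesis hX : cb_process Phi P X.

Lemma cvg_killed_grid (k : R -> R) (x t lam : R) :
  (forall y, 0 <= g y <= 1) ->
  (forall y, g y = k (expR (- y)) * (1 - expR (- y)) ^+ 2) ->
  bounded_lipschitz k -> k 1 = 0 -> 0 <= x -> 0 < t -> 0 < lam ->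
  \int[P x]_w (increment_prod g (X ^~ w) (t / n.+1%:R) n.+1 t * expR (- (lam * X t w)))
   - expR (- (x * euler (fun u => Phi u - killing_rate pi g u) (t / n.+1%:R) lam n.+1))
   @[n --> \oo] --> (0 : R).
Proof.
move=> g01 gk k_lip k1 x0 t0 lam0.
have lip : lipschitz_on_segments Phi by move=> M; exact: branching_mechanism_lipschitz.
have [v [lap vge0 vexp]] := cb_cumulant lip hX.
have mg : measurable_fun setT g by case: gB.
pose m (h s : R) w := 1 - g (X (s + h) w - X s w).
have mad (h s r : R) : 0 <= s -> 0 <= h -> s + h <= r -> adapted X r (m h s).
  move=> s0 h0 shr; apply: measurable_funB => //.
  apply: (measurableT_comp mg); apply: measurable_funB; apply: adapted_marginal.
    by rewrite addr_ge0.
  by rewrite s0 (le_trans _ shr)// lerDl.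
have m01 (h s : R) w : 0 <= s -> 0 <= h -> 0 <= m h s w <= 1.
  by move=> _ _; rewrite /m; have := g01 (X (s + h) w - X s w); lra.
have := cvg_grid_product lap (v_expansion_at0 vexp) mad m01
  (killed_one_step pi_moment beta_ge0 hX lap vge0 vexp gB g01 gk k_lip k1)
  (normr_ge0 alpha) (mulr_ge0 (normr_ge0 B) (levy_mass_ge0 pi))
  killed_mechanism_ge killed_mechanism_le x0 t0 lam0.
move=> H; apply: cvg_trans H; apply: near_eq_cvg; apply: nearW => n; congr (_ - _).
apply: eq_Rintegral => w _; congr (_ * _).
rewrite /increment_prod; apply: eq_big => [j|j _].
  have hn0 : 0 < t / n.+1%:R by rewrite divr_gt0.
  have Nh : n.+1%:R * (t / n.+1%:R) = t by rewrite mulrC divfK// pnatr_eq0.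
  by apply/esym; rewrite -[X in _ < X]Nh ltr_pM2r// ltr_nat ltn_ord.
rewrite /m; congr (1 - g (X _ w - _)).
by rewrite -natr1; ring.
Qed.

End killed_mechanism_bounds.

(** * The discounted process on the grid *)

Section discounted.
Context {R : realType} {d : measure_display} {T : measurableType d}.
Context (Phi : R -> R) (P : R -> probability T R) (X : R -> T -> R).
Hypothesis hX : cb_process Phi P X.
Hypothesis Phi_lip : lipschitz_on_segments Phi.
Variables (q : R) (Psi : R -> R) (a b : R).
Hypothesis q_ge0 : 0 <= q.
Hypothesis PsiE : forall u, 0 <= u -> Psi u = Phi u - q.
Hypothesis a_ge0 : 0 <= a.
Hypothesis b_ge0 : 0 <= b.
Hypothesis Psi_ge : forall u, 0 <= u -> - (a * u) - b <= Psi u.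
Hypothesis Psi_le : forall L : R, 0 <= L -> exists2 C : R, 0 <= C &
  forall u, 0 <= u <= L -> Psi u <= C * u.

(** The discount is taken at the right end of the step, so it merely shifts [u] to [u + q h] before
    the Markov property applies. Then [v h (u + q h)] is [u + q h - h Phi u] up to
    [(D + C q) h ^+ 2]: [D] from the expansion of [v], [C q] from moving the argument of [Phi] by
    [q h]. *)
Lemma discounted_one_step (v : R -> R -> R) :
  (forall x t l : R, 0 <= x -> 0 <= t -> 0 <= l ->
    \int[P x]_w expR (- (l * X t w)) = expR (- (x * v t l))) ->
  (forall t l : R, 0 <= t -> 0 <= l -> 0 <= v t l) ->
  (forall L : R, 0 <= L -> exists2 C : R, 0 <= C &
    forall u h : R, 0 <= u <= L -> 0 <= h <= 1 ->
      `|v h u - (u - h * Phi u)| <= C * h ^+ 2) ->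
  forall c L e : R, 0 < c -> 0 <= L -> 0 < e ->
  exists2 h0 : R, 0 < h0 &
  forall (x s h u : R) (Y : T -> R), 0 <= x -> 0 <= s -> 0 <= h <= h0 ->
    c <= u <= L -> adapted X s Y -> (forall w, 0 <= Y w <= 1) ->
    `|\int[P x]_w (Y w * (expR (- (q * h * X (s + h) w)) * expR (- (u * X (s + h) w))))
      - \int[P x]_w (Y w * expR (- ((u - h * Psi u) * X s w)))| <= e * h.
Proof.
move=> lap vge0 vexp c L e c0 L0 e0.
have Lq0 : 0 <= L + q by rewrite addr_ge0.
have [D D0 HD] := vexp _ Lq0.
have [C C0 HC] := Phi_lip Lq0.
have [M M0 HM] := lipschitz_on_segments_bounded Phi_lip L0.
have [E E0 [h1 h10 H]] := expR_perturbation c0 (addr_ge0 M0 q_ge0)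
  (addr_ge0 D0 (mulr_ge0 C0 q_ge0)).
(* Both exponentials are compared with the same first-order expression, each at cost
   [E * h ^+ 2]. *)
exists (Num.min (Num.min 1 h1) (e / (E + E + 1))).
  by rewrite !lt_min ltr01 h10/= divr_gt0// ltr_wpDl// addr_ge0.
move=> x s h u Y x0 s0 /andP[hh0]; rewrite !le_min => /andP[/andP[hh1 hhh] hE] uL aY Y01.
have [cu uL'] := andP uL; have u0 : 0 <= u by rewrite (le_trans (ltW c0)).
have uq0 : 0 <= u + q * h by rewrite addr_ge0// mulr_ge0.
have uqL : 0 <= u + q * h <= L + q by rewrite uq0 lerD// ler_piMr.
have uLq : 0 <= u <= L + q by rewrite u0 (le_trans uL')// lerDl.
have mY := adapted_measurable hX aY.
have -> : \int[P x]_w (Y w * (expR (- (q * h * X (s + h) w)) * expR (- (u * X (s + h) w)))) =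
    \int[P x]_w (Y w * expR (- (v h (u + q * h) * X s w))).
  rewrite -(markov_exp_le1 hX lap vge0 x0 s0 hh0 uq0 aY Y01).
  apply: eq_Rintegral => w _; rewrite -expRD; congr (_ * expR _); ring.
have psib : `|Psi u| <= M + q.
  rewrite PsiE//; apply: (le_trans (ler_normB _ _)).
  by rewrite (ger0_norm q_ge0) lerD2r HM// u0.
have vclose : `|v h (u + q * h) - (u - h * Psi u)| <= (D + C * q) * h ^+ 2.
  have -> : v h (u + q * h) - (u - h * Psi u) =
     (v h (u + q * h) - (u + q * h - h * Phi (u + q * h))) -
     h * (Phi (u + q * h) - Phi u) by rewrite PsiE//; ring.
  apply: (le_trans (ler_normB _ _)); rewrite mulrDl lerD//.
    by apply: HD; rewrite ?hh0.
  rewrite normrM (ger0_norm hh0).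
  have := HC _ _ uqL uLq; have -> : u + q * h - u = q * h by ring.
  rewrite (@ger0_norm _ (q * h)) ?mulr_ge0// => HCq.
  have -> : C * q * h ^+ 2 = h * (C * (q * h)) by ring.
  by rewrite ler_wpM2l.
have hh1' : 0 <= h <= h1 by rewrite hh0.
have Xs0 w := cb_ge0 hX w s0.
have p1 w := H (X s w) u (Psi u) _ h (Xs0 w) cu psib hh1' vclose.
have p2 w : `|expR (- (X s w * (u - h * Psi u))) -
    expR (- (X s w * u)) * (1 + X s w * h * Psi u)| <= E * h ^+ 2.
  apply: H => //; rewrite subrr normr0 mulr_ge0 ?sqr_ge0//.
  by rewrite addr_ge0// mulr_ge0.
have close w : `|expR (- (v h (u + q * h) * X s w)) - expR (- ((u - h * Psi u) * X s w))|
    <= e * h.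
  rewrite [v _ _ * _]mulrC [(u - _) * _]mulrC.
  set A := expR (- (X s w * v h (u + q * h))) in p1 *.
  have := p1 w; have := p2 w.
  move: (expR (- (X s w * (u - h * Psi u)))) (expR (- (X s w * u)) * _) => A' G q2 q1.
  have -> : expR (- (X s w * v h (u + q * h))) - A' =
     (expR (- (X s w * v h (u + q * h))) - G) - (A' - G) by ring.
  apply: (le_trans (ler_normB _ _)); apply: (le_trans (lerD q1 q2)).
  rewrite expr2 !mulrA -mulrDl ler_wpM2r//.
  have E1 : 0 < E + E + 1 by rewrite ltr_wpDl// addr_ge0.
  move: hE; rewrite ler_pdivlMr// => hE.
  have : 0 <= h by []; lra.
have vh0 := vge0 h _ hh0 uq0.
have i1 : (P x).-integrable setT (EFin \o (fun w => Y w * expR (- (v h (u + q * h) * X s w)))).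
  apply: (@integrable_bounded_fun _ _ _ _ _ 1).
    by apply: measurable_funM => //; exact: (measurable_expRN_marginal hX).
  move=> w; have /andP[Y0 Y1] := Y01 w.
  rewrite normrM (ger0_norm Y0) -[leRHS]mulr1 ler_pM//.
  exact: (expRN_marginal_norm_le1 hX).
have i2 : (P x).-integrable setT (EFin \o (fun w => Y w * expR (- ((u - h * Psi u) * X s w)))).
  apply: (@integrable_bounded_fun _ _ _ _ _ (1 + e * h)).
    by apply: measurable_funM => //; exact: (measurable_expRN_marginal hX).
  move=> w; have /andP[Y0 Y1] := Y01 w.
  rewrite normrM (ger0_norm Y0) -[leRHS]mul1r ler_pM//.
  rewrite -[X in `|X|](subKr (expR (- (v h (u + q * h) * X s w)))).
  apply: (le_trans (ler_normB _ _)); rewrite lerD//.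
  exact: (expRN_marginal_norm_le1 hX).
apply: expectation_dist_le => // w; have /andP[Y0 Y1] := Y01 w.
rewrite -mulrBr normrM (ger0_norm Y0); apply: le_trans (close w).
by rewrite ler_piMl.
Qed.

Lemma cvg_discounted_grid (x t lam : R) : 0 <= x -> 0 < t -> 0 < lam ->
  \int[P x]_w ((\prod_(k < n.+1) expR (- (q * (t / n.+1%:R) * X (k.+1%:R * (t / n.+1%:R)) w)))
     * expR (- (lam * X t w)))
   - expR (- (x * euler Psi (t / n.+1%:R) lam n.+1)) @[n --> \oo] --> (0 : R).
Proof.
move=> x0 t0 lam0.
have [v [lap vge0 vexp]] := cb_cumulant Phi_lip hX.
pose m (h s : R) w := expR (- (q * h * X (s + h) w)).
have mad (h s r : R) : 0 <= s -> 0 <= h -> s + h <= r -> adapted X r (m h s).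
  move=> s0 h0 shr; apply: measurableT_comp => //; apply: measurableT_comp => //.
  by apply: measurable_funM => //; apply: adapted_marginal; rewrite addr_ge0.
have m01 (h s : R) w : 0 <= s -> 0 <= h -> 0 <= m h s w <= 1.
  move=> s0 h0; rewrite /m expR_ge0/= -expR0 ler_expR oppr_le0 !mulr_ge0//.
  by apply: (cb_ge0 hX); rewrite addr_ge0.
have := cvg_grid_product lap (v_expansion_at0 vexp) mad m01
  (discounted_one_step lap vge0 vexp) a_ge0 b_ge0 Psi_ge Psi_le x0 t0 lam0.
move=> H; apply: cvg_trans H; apply: near_eq_cvg; apply: nearW => n; congr (_ - _).
apply: eq_Rintegral => w _; congr (_ * _).
apply: eq_bigr => j _; rewrite /m; congr (expR (- (_ * X _ w))).
by rewrite -natr1; ring.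
Qed.

End discounted.

(** * Borel jump sets *)

Lemma cvg_expectation {R : realType} {d : measure_display} {T : measurableType d}
    (P : probability T R) (f_ : nat -> T -> R) (f : T -> R) (C : R) :
  (forall n, measurable_fun setT (f_ n)) -> (forall n w, `|f_ n w| <= C) ->
  (forall w, f_ n w @[n --> \oo] --> f w) ->
  measurable_fun setT f /\ \int[P]_w f_ n w @[n --> \oo] --> \int[P]_w f w.
Proof.
move=> mf fC ff; have mlim : measurable_fun setT f.
  by apply: (measurable_fun_cvg mf) => w _; exact: ff.
split=> //; apply: fine_cvg.
have fi : P.-integrable setT (EFin \o f).
  apply: (integrable_bounded_fun P (f := f) mlim (C := C)) => w.
  apply: (cvgr_to_le (cvg_norm (ff w))).
  by apply: nearW => n; exact: fC.
rewrite fineK; last exact: (integrable_fin_num measurableT fi).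
apply: (@dominated_cvg _ _ _ P setT measurableT (fun n w => (f_ n w)%:E)
  (EFin \o f) (cst C%:E)) => //.
- by move=> n; apply/measurable_EFinP; exact: mf.
- by move=> w _; apply: cvg_EFin; [exact: nearW|exact: ff].
- by apply: (integrable_bounded_fun P (C := `|C|)) => // w.
- by move=> n w _; rewrite lee_fin.
Qed.

Lemma cvg_prod_seq {R : realType} (F : nat -> R -> R) (G : R -> R) (J : seq R) :
  (forall y, F n y @[n --> \oo] --> G y) ->
  \prod_(y <- J) F n y @[n --> \oo] --> \prod_(y <- J) G y.
Proof.
move=> FG; elim: J => [|y J IH].
  by rewrite big_nil; under eq_fun do rewrite big_nil; exact: cvg_cst.
by rewrite big_cons; under eq_fun do rewrite big_cons; exact: cvgM.
Qed.

(* Functions of [exp (- y)] have a limit at [+oo], as the polynomial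
   approximation on [0, exp K] requires. *)
Inductive baire {R : realType} : (R -> R) -> Prop :=
| baire_base (kappa : R -> R) : bounded_lipschitz kappa -> (forall z, 0 <= kappa z <= 1) ->
    baire (fun y => kappa (expR (- y)))
| baire_lim (f : nat -> R -> R) (g : R -> R) : (forall n, baire (f n)) ->
    (forall y, f n y @[n --> \oo] --> g y) -> baire g.

Lemma baire_onem {R : realType} (f : R -> R) : baire f -> baire (fun y => 1 - f y).
Proof.
elim=> [kappa kl k01|{}f g _ IH fg].
  apply: (@baire_base _ (fun z => 1 - kappa z)); first exact: bounded_lipschitz_onem.
  by move=> z; have := k01 z; lra.
apply: (baire_lim IH) => y; apply: cvgB; [exact: cvg_cst|exact: fg].
Qed.

Lemma baireM {R : realType} (f g : R -> R) : baire f -> baire g ->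
  baire (fun y => f y * g y).
Proof.
move=> bf; elim: bf g => [kappa kl k01|{}f h _ IH fh] g bg; last first.
  apply: (baire_lim (fun n => IH n g bg)) => y; apply: cvgM; [exact: fh|exact: cvg_cst].
elim: bg => [kappa' kl' k01'|{}g h _ IH gh].
  apply: (@baire_base _ (fun z => kappa z * kappa' z)); first exact: bounded_lipschitzM.
  move=> z; have /andP[? ?] := k01 z; have /andP[? ?] := k01' z.
  by rewrite mulr_ge0//= -[leRHS]mulr1 ler_pM.
apply: (baire_lim IH) => y; apply: cvgM; [exact: cvg_cst|exact: gh].
Qed.

Lemma baire_cst {R : realType} (c : R) : 0 <= c <= 1 -> baire (fun=> c).
Proof.
move=> /andP[c0 c1]; apply: (@baire_base _ (fun=> c)) => [|_]; last by rewrite c0.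
by exists c => //; split=> [_|x y]; rewrite ?subrr ?normr0 ?mulr_ge0// ger0_norm.
Qed.

(** The sets with Baire indicator form a sigma-algebra containing the rays []c, +oo[], whose
    indicators are limits of ever steeper ramps in [exp (- y)]. Closure under products takes care of
    countable unions, disjoint or not, through their complements. *)
Lemma baire_indic {R : realType} (A : set R) : measurable A -> baire (\1_A : R -> R).
Proof.
move=> mA; have {}mA : (@ocitv R).-sigma.-measurable A by [].
rewrite RGenOInfty.measurableE in mA; move: A mA.
pose D := [set A : set R | baire (\1_A : R -> R)].
suff H : (@RGenOInfty.G R).-sigma.-measurable `<=` D by move=> A mA; exact: H.
have DC B : D B -> D (~` B).
  move=> DB; rewrite /D/=; have -> : \1_(~` B) = (fun y => 1 - \1_B y) :> (R -> R).
    apply/funext => y; rewrite !indicE in_setC.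
    by case: (_ \in _); rewrite /= ?subr0 ?subrr.
  exact: baire_onem.
apply: smallest_sub; last first.
  move=> _ [c ->]; rewrite /D/=.
  apply: (@baire_lim _ (fun n y => clamp01 (n%:R * (expR (- c) - expR (- y))))).
    move=> n; apply: (@baire_base _ (fun z => clamp01 (n%:R * (expR (- c) - z)))).
      exact: bounded_lipschitz_clamp01.
    by move=> z; rewrite clamp01_ge0 clamp01_le1.
  move=> y; rewrite indicE; have [yc|cy] := leP y c.
    rewrite memNset/=; last by rewrite in_itv/= andbT ltNge yc.
    apply: cvg_near_cst; apply: nearW => n; apply: clamp01_eq0.
    by rewrite mulr_ge0_le0// subr_le0 ler_expR lerN2.
  rewrite mem_set/=; last by rewrite in_itv/= andbT.
  have e0 : 0 < expR (- c) - expR (- y) by rewrite subr_gt0 ltr_expR ltrN2.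
  apply: cvg_near_cst; exists (Num.bound (expR (- c) - expR (- y))^-1) => // n /= hn.
  apply: clamp01_eq1; rewrite -ler_pdivrMr// div1r.
  apply: ltW; apply: (lt_le_trans (archi_boundP _)); first by rewrite invr_ge0 ltW.
  by rewrite ler_nat.
split.
- by rewrite /D/= indic0; apply: (@baire_cst _ 0); rewrite lexx ler01.
- by move=> B DB; rewrite setTD; exact: DC.
- move=> F DF; rewrite /D/=.
  pose u n y : R := 1 - \prod_(i < n) (1 - \1_(F i) y).
  apply: (@baire_lim _ u) => [n|y].
    apply: baire_onem; elim: n => [|n IH].
      have -> : (fun y => \prod_(i < 0) (1 - \1_(F i) y)) = (fun=> 1) :> (R -> R).
        by apply/funext => y; rewrite big_ord0.
      by apply: baire_cst; rewrite ler01 lexx.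
    have -> : (fun y => \prod_(i < n.+1) (1 - \1_(F i) y)) =
        (fun y => (\prod_(i < n) (1 - \1_(F i) y)) * (1 - \1_(F n) y)) :> (R -> R).
      by apply/funext => y; rewrite big_ord_recr.
    by apply: baireM => //; apply: baire_onem; exact: DF.
  rewrite indicE; have [[i _ Fy]|nF] := pselect ((\bigcup_i F i) y).
    rewrite mem_set/=; last by exists i.
    apply: cvg_near_cst; exists i.+1 => // n /= ni.
    rewrite /u (bigD1 (Ordinal ni))//= indicE mem_set//= subrr mul0r subr0//.
  rewrite memNset//=; apply: cvg_near_cst; apply: nearW => n.
  rewrite /u big1 ?subrr// => i _; rewrite indicE memNset/= ?subr0// => Fy.
  by apply: nF; exists i.
Qed.

Lemma baire_measurable {R : realType} (f : R -> R) : baire f ->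
  measurable_fun (setT : set (measurableTypeR R)) f.
Proof.
elim=> [kappa [C C0 [_ kL]] _|{}f g _ IH fg].
  apply: (measurableT_comp (f := kappa)); last by apply: measurableT_comp.
  by apply: continuous_measurable_fun; exact: lipschitz_continuous kL.
by apply: (measurable_fun_cvg IH) => y _; exact: fg.
Qed.

Lemma baire01 {R : realType} (f : R -> R) : baire f -> forall y, 0 <= f y <= 1.
Proof.
elim=> [kappa _ k01 y|{}f g _ IH fg y]; first exact: k01.
apply/andP; split.
  by apply: (cvgr_to_ge (fg y)); apply: nearW => n; have /andP[] := IH n y.
by apply: (cvgr_to_le (fg y)); apply: nearW => n; have /andP[] := IH n y.
Qed.

(** * Cutoff of small jumps *)

Section cutoff.
Context {R : realType} (a : R).
Hypothesis a_gt0 : 0 < a.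

Definition cutoff_slope : R := (expR (- (a / 2)) - expR (- a))^-1.

(* In the variable [z = exp (- y)]: [1] for [a <= y] and [0] for [y <= a / 2]. *)
Definition exp_cutoff (z : R) : R := clamp01 (cutoff_slope * (expR (- (a / 2)) - z)).

Definition jump_cutoff (y : R) : R := exp_cutoff (expR (- y)).

Lemma cutoff_slope_gt0 : 0 < cutoff_slope.
Proof. by rewrite invr_gt0 subr_gt0 ltr_expR ltrN2 gtr_pMr// invf_lt1// ltr1n. Qed.

Lemma exp_cutoff_eq0 (z : R) : expR (- (a / 2)) <= z -> exp_cutoff z = 0.
Proof.
by move=> hz; apply: clamp01_eq0; rewrite pmulr_rle0 ?cutoff_slope_gt0// subr_le0.
Qed.

Lemma jump_cutoff_eq0 (y : R) : y <= a / 2 -> jump_cutoff y = 0.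
Proof. by move=> ya; apply: exp_cutoff_eq0; rewrite ler_expR lerN2. Qed.

Lemma jump_cutoff_eq1 (y : R) : a <= y -> jump_cutoff y = 1.
Proof.
move=> ay; apply: clamp01_eq1; rewrite -ler_pdivrMl ?cutoff_slope_gt0// mulr1.
by rewrite /cutoff_slope invrK lerB// ler_expR lerN2.
Qed.

Lemma jump_cutoff01 (y : R) : 0 <= jump_cutoff y <= 1.
Proof. by rewrite clamp01_ge0 clamp01_le1. Qed.

Lemma measurable_jump_cutoff :
  measurable_fun (setT : set (measurableTypeR R)) jump_cutoff.
Proof.
apply: (measurableT_comp (f := exp_cutoff)); last by apply: measurableT_comp.
have [C C0 [_ L]] := bounded_lipschitz_clamp01 cutoff_slope (expR (- (a / 2))).
by apply: continuous_measurable_fun; exact: lipschitz_continuous L.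
Qed.

(** Chosen so that both 1 and [y] are at most [cutoff_const * levy_min y] for [y > a / 2]. With
    [i = (a / 2)^-1]: where [levy_min y] is [y ^+ 2], use [1 <= i ^+ 2 * y ^+ 2] and
    [y <= i * y ^+ 2]; where it is [y], then [y >= 1] and the term 1 is enough. *)
Definition cutoff_const : R := 1 + (a / 2)^-1 + (a / 2)^-1 ^+ 2.

Lemma levy_cutoff_jump_cutoff (f : R -> R) :
  measurable_fun (setT : set (measurableTypeR R)) f ->
  (forall y, 0 <= f y <= 1) ->
  levy_cutoff cutoff_const (fun y => jump_cutoff y * f y).
Proof.
move=> mf f01; split; first by apply: measurable_funM => //; exact: measurable_jump_cutoff.
move=> y y0; have /andP[f0 f1] := f01 y; have /andP[c0 c1] := jump_cutoff01 y.
have b0 : 0 < a / 2 by rewrite divr_gt0.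
have B0 : 0 <= cutoff_const by rewrite !addr_ge0 ?sqr_ge0// invr_ge0 ltW.
have m0 := levy_min_ge0 y0.
have [ya|ay] := leP y (a / 2).
  by rewrite jump_cutoff_eq0// mul0r mulr0 lexx; split=> //; exact: mulr_ge0.
have p0 : 0 <= jump_cutoff y * f y by rewrite mulr_ge0.
have p1 : jump_cutoff y * f y <= 1 by rewrite -[leRHS]mulr1 ler_pM.
suff [h1 h2] : 1 <= cutoff_const * levy_min y /\ y <= cutoff_const * levy_min y.
  split=> //; first exact: le_trans h1.
  by apply: le_trans h2; rewrite ler_piMr// ltW.
have i0 : 0 < (a / 2)^-1 by rewrite invr_gt0.
have i1 : 1 <= (a / 2)^-1 * y by rewrite -ler_pdivrMl ?invrK ?mulr1// ltW.
rewrite /cutoff_const; set i := (a / 2)^-1 in i0 i1 *.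
have ii0 : 0 <= i ^+ 2 by exact: sqr_ge0.
have i2 : 1 <= i ^+ 2 * y ^+ 2 by rewrite -exprMn -[1](expr1n _ 2) ler_sqr ?nnegrE ?mulr_ge0// ltW.
rewrite /levy_min /Num.min; case: ltP => [y1|y1].
  have y1' : 1 <= y.
    by rewrite leNgt; apply/negP => ylt; move: y1; rewrite ltNge expr2 ler_piMl// ltW.
  have B1 : 1 <= 1 + i + i ^+ 2 by rewrite -addrA lerDl addr_ge0// ltW.
  split; last by rewrite ler_peMl// ltW.
  by rewrite -[leLHS]mulr1 ler_pM.
have y2 : 0 <= y ^+ 2 by exact: sqr_ge0.
split; rewrite !mulrDl mul1r.
  have : 0 <= i * y ^+ 2 by rewrite mulr_ge0// ltW.
  lra.
have : y <= i * y ^+ 2 by rewrite expr2 mulrA ler_peMl// ltW.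
have : 0 <= i ^+ 2 * y ^+ 2 by rewrite mulr_ge0.
lra.
Qed.

End cutoff.

Lemma ler_dist3 {R : realFieldType} (p q r s e : R) : `|p - q| <= e / 3 ->
  `|q - r| <= e / 3 -> `|r - s| <= e / 3 -> `|p - s| <= e.
Proof.
move=> h1 h2 h3; have -> : p - s = (p - q) + (q - r) + (r - s) by ring.
have -> : e = e / 3 + e / 3 + e / 3 by field.
apply: (le_trans (ler_normD _ _)); rewrite lerD//.
by apply: (le_trans (ler_normD _ _)); rewrite lerD.
Qed.

(** * Survival probabilities *)

Section survival.
Context {R : realType} (alpha beta : R).
Context (pi : {measure set (measurableTypeR R) -> \bar R}).
Hypothesis pi_moment :
  (\int[pi]_(theta in `]0%R, +oo[) (Num.min theta (theta ^+ 2))%:E < +oo)%E.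
Hypothesis beta_ge0 : 0 <= beta.
Local Notation Phi := (branching_mechanism alpha beta pi).
Local Notation D := (`]0%R, +oo[%classic : set R).
Context {d : measure_display} {T : measurableType d}.
Context (P : R -> probability T R) (X : R -> T -> R).
Hypothesis hX : cb_process Phi P X.
Variables (a x t lam : R).
Hypothesis a_gt0 : 0 < a.
Hypothesis x_ge0 : 0 <= x.
Hypothesis t_gt0 : 0 < t.
Hypothesis lam_gt0 : 0 < lam.
Variable J : T -> seq R.
Hypothesis J_limit : forall w (g : R -> R), continuous g ->
  (forall y, y <= a / 2 -> g y = 0) ->
  increment_prod g (X ^~ w) (t / n.+1%:R) n.+1 t @[n --> \oo] -->
    \prod_(y <- J w) (1 - g y).

Definition cut (f : R -> R) (y : R) : R := jump_cutoff a y * f y.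

Definition survival (f : R -> R) (w : T) : R := \prod_(y <- J w) (1 - cut f y).

Definition killed_psi (f : R -> R) (u : R) : R := Phi u - killing_rate pi (cut f) u.

Lemma cut01 (f : R -> R) : (forall y, 0 <= f y <= 1) -> forall y, 0 <= cut f y <= 1.
Proof.
move=> f01 y; have /andP[f0 f1] := f01 y; have /andP[c0 c1] := jump_cutoff01 a y.
by rewrite mulr_ge0//= -[leRHS]mulr1 ler_pM.
Qed.

Lemma prod_onem01 (I : Type) (s : seq I) (f : I -> R) : (forall i, 0 <= f i <= 1) ->
  0 <= \prod_(i <- s) (1 - f i) <= 1.
Proof.
move=> f01; elim: s => [|i s /andP[IH0 IH1]]; first by rewrite big_nil ler01 lexx.
have /andP[f0 f1] := f01 i; rewrite big_cons mulr_ge0 ?subr_ge0//=.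
by rewrite -[leRHS]mulr1 ler_pM ?subr_ge0// lerBlDr lerDl.
Qed.

Lemma mulr_expRN_marginal_norm_le1 (f : T -> R) w : 0 <= f w <= 1 ->
  `|f w * expR (- (lam * X t w))| <= 1.
Proof.
move=> /andP[f0 f1]; rewrite normrM (ger0_norm f0) -[leRHS]mulr1 ler_pM//.
exact: (expRN_marginal_norm_le1 hX w (ltW t_gt0) (ltW lam_gt0)).
Qed.

(** The grid products converge in expectation by dominated convergence, and their expectations
    differ from [exp (- x u_n)] by a vanishing quantity; so the latter converges too. *)
Lemma survival_base (kappa : R -> R) : bounded_lipschitz kappa ->
  (forall z, 0 <= kappa z <= 1) ->
  let f := fun y => kappa (expR (- y)) in
  measurable_fun setT (survival f) /\
  expR (- (x * euler (killed_psi f) (t / n.+1%:R) lam n.+1)) @[n --> \oo] -->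
    \int[P x]_w (survival f w * expR (- (lam * X t w))).
Proof.
move=> kl k01 f; set g := cut f.
pose z2 := expR (- (a / 2)).
have z21 : 0 < 1 - z2.
  by rewrite subr_gt0 -expR0 ltr_expR oppr_lt0 divr_gt0.
(* The quotient of [g] by [(1 - z) ^+ 2]. The cutoff vanishes for [z >= z2], so bounding the
   denominator below by [1 - z2] changes nothing and makes [k] bounded and Lipschitz across
   [z = 1]. *)
pose k z := exp_cutoff a z * kappa z * ((Num.max (1 - z) (1 - z2))^-1 *
   (Num.max (1 - z) (1 - z2))^-1).
have lX : bounded_lipschitz (exp_cutoff a) by exact: bounded_lipschitz_clamp01.
have lk : bounded_lipschitz k.
  apply: bounded_lipschitzM; first exact: bounded_lipschitzM.
  by apply: bounded_lipschitzM; exact: bounded_lipschitz_inv_max.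
have k1 : k 1 = 0.
  rewrite /k exp_cutoff_eq0 ?mul0r//.
  by rewrite -expR0 ler_expR oppr_le0 divr_ge0// ltW.
have gk y : g y = k (expR (- y)) * (1 - expR (- y)) ^+ 2.
  rewrite /g /cut /f /k /jump_cutoff; move: (expR (- y)) => z.
  have [zz|zz] := leP z2 z; first by rewrite exp_cutoff_eq0// !mul0r.
  rewrite max_l; last by rewrite lerD2l lerN2 ltW.
  by field; rewrite gt_eqF// subr_gt0 (lt_trans zz)// -subr_gt0.
have f01 y : 0 <= f y <= 1 by exact: k01.
have g01 := cut01 f01.
have mf : measurable_fun (setT : set (measurableTypeR R)) f.
  exact: baire_measurable (baire_base kl k01).
have gB : levy_cutoff (cutoff_const a) g by exact: levy_cutoff_jump_cutoff.
have cg : continuous g.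
  have [C C0 [_ L]] := bounded_lipschitzM lX kl.
  have -> : g = (fun z => exp_cutoff a z * kappa z) \o (fun y => expR (- y)).
    by apply/funext.
  move=> y; apply: continuous_comp; last exact: (lipschitz_continuous C0 L).
  by apply: continuous_comp; [exact: opp_continuous|exact: continuous_expR].
have g0 y : y <= a / 2 -> g y = 0 by move=> ya; rewrite /g /cut jump_cutoff_eq0// mul0r.
have mX s : 0 <= s -> measurable_fun setT (X s) by exact: (cb_measurable hX).
have mI n : measurable_fun setT (fun w => increment_prod g (X ^~ w) (t / n.+1%:R) n.+1 t).
  rewrite /increment_prod.
  under eq_fun do rewrite big_mkcond/=.
  apply: measurable_prod => i _; case: (i%:R * (t / n.+1%:R) < t) => //.
  apply: measurable_funB => //; apply: (measurableT_comp (f := g)); first by case: gB.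
  by apply: measurable_funB; apply: mX; rewrite mulr_ge0// divr_ge0// ltW.
have I01 n w : 0 <= increment_prod g (X ^~ w) (t / n.+1%:R) n.+1 t <= 1.
  rewrite /increment_prod big_mkcond/=.
  have -> : \prod_(i < n.+1) (if i%:R * (t / n.+1%:R) < t then
       1 - g (X (i.+1%:R * (t / n.+1%:R)) w - X (i%:R * (t / n.+1%:R)) w) else 1) =
    \prod_(i < n.+1) (1 - (if i%:R * (t / n.+1%:R) < t then
       g (X (i.+1%:R * (t / n.+1%:R)) w - X (i%:R * (t / n.+1%:R)) w) else 0)).
    by apply: eq_bigr => i _; case: ifP; rewrite ?subr0.
  by apply: prod_onem01 => i; case: ifP; rewrite ?lexx ?ler01.
have mE := measurable_expRN_marginal hX lam (ltW t_gt0).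
have lim_w w : increment_prod g (X ^~ w) (t / n.+1%:R) n.+1 t @[n --> \oo] --> survival f w.
  exact: J_limit.
split.
  by apply: (measurable_fun_cvg mI) => w _; exact: lim_w.
have [_ E1] := @cvg_expectation _ _ _ (P x)
  (fun n w => increment_prod g (X ^~ w) (t / n.+1%:R) n.+1 t * expR (- (lam * X t w)))
  (fun w => survival f w * expR (- (lam * X t w))) 1
  (fun n => measurable_funM (mI n) mE)
  (fun n w => @mulr_expRN_marginal_norm_le1 (fun w => _) w (I01 n w))
  (fun w => cvgM (lim_w w) (@cvg_cst _ _ _ _ _)).
have E2 := cvg_killed_grid pi_moment beta_ge0 gB hX g01 gk lk k1 x_ge0 t_gt0 lam_gt0.
have H := cvgB E1 E2; rewrite subr0 in H; apply: cvg_trans (H _) => //.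
by apply: near_eq_cvg; apply: nearW => n; exact: subKr.
Qed.

(** An exchange of limits between functions [f m] and meshes [n]. For [n] large, depending on [m],
    the Euler schemes of [f m] and [g] are within [t * eta m * exp (K t)], a bound free of [n];
    [eta m] is the distance of the cutoffs in mean under [pi] and tends to 0 by dominated
    convergence. So [m] is fixed first, then [n] tends to infinity. *)
Lemma baire_survival (f : R -> R) : baire f ->
  measurable_fun setT (survival f) /\
  expR (- (x * euler (killed_psi f) (t / n.+1%:R) lam n.+1)) @[n --> \oo] -->
    \int[P x]_w (survival f w * expR (- (lam * X t w))).
Proof.
elim=> [kappa kl k01|{}f g bf IH fg]; first exact: survival_base.
have bg := baire_lim bf fg.
have cutB h : baire h -> levy_cutoff (cutoff_const a) (cut h).
  move=> bh; apply: levy_cutoff_jump_cutoff => //; first exact: baire_measurable.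
  exact: baire01.
have cutfg y : cut (f m) y @[m --> \oo] --> cut g y.
  by apply: cvgM; [exact: cvg_cst|exact: fg].
have lim_w w : survival (f m) w @[m --> \oo] --> survival g w.
  apply: (@cvg_prod_seq _ (fun m y => 1 - cut (f m) y) (fun y => 1 - cut g y)) => y.
  by apply: cvgB; [exact: cvg_cst|exact: cutfg].
have S01 h w : baire h -> 0 <= survival h w <= 1.
  by move=> bh; apply: prod_onem01; apply: cut01; exact: baire01.
split.
  by apply: (measurable_fun_cvg (fun m => (IH m).1)) => w _; exact: lim_w.
have mE := measurable_expRN_marginal hX lam (ltW t_gt0).
have [_ E1] := @cvg_expectation _ _ _ (P x)
  (fun m w => survival (f m) w * expR (- (lam * X t w)))
  (fun w => survival g w * expR (- (lam * X t w))) 1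
  (fun m => measurable_funM (IH m).1 mE)
  (fun m w => @mulr_expRN_marginal_norm_le1 (survival (f m)) w (S01 _ _ (bf m)))
  (fun w => cvgM (lim_w w) (@cvg_cst _ _ _ _ _)).
pose B := cutoff_const a.
pose q := `|B| * levy_mass pi.
have q0 : 0 <= q by rewrite mulr_ge0// levy_mass_ge0.
pose L := (lam + q * t) * expR (`|alpha| * t).
have L0 : 0 <= L by rewrite mulr_ge0 ?expR_ge0// addr_ge0 ?(ltW lam_gt0)// mulr_ge0// ltW.
have [C C0 HC] := branching_mechanism_lipschitz pi_moment alpha beta L0.
pose eta m := \int[pi]_(theta in D) `|cut (f m) theta - cut g theta|.
have eta0 m : 0 <= eta m by apply: Rintegral_ge0.
have eta_lim : eta m @[m --> \oo] --> (0 : R).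
  have -> : (0 : R) = fine (\int[pi]_(theta in D) (0%:E : \bar R))%E by rewrite integral0.
  apply: fine_cvg; rewrite integral0.
  rewrite -[X in _ --> X](@integral0 _ _ _ pi D).
  apply: (@dominated_cvg _ _ _ pi D (measurable_itv _)
    (fun m theta => (`|cut (f m) theta - cut g theta|)%:E) (cst 0%E)
    (EFin \o (fun theta => (B + B) * levy_min theta))) => //.
  - move=> m; apply/measurable_EFinP; apply: measurable_funTS.
    apply: measurableT_comp => //; apply: measurable_funB.
      by have [] := cutB _ (bf m).
    by have [] := cutB _ bg.
  - move=> y _; apply: cvg_EFin; first exact: nearW.
    rewrite -[X in _ --> X](@normr0 _ R) -[X in `|X|](subrr (cut g y)).
    by apply: cvg_norm; apply: cvgB; [exact: cutfg|exact: cvg_cst].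
  - exact: (integrableZl_EFin _ _ (integrable_levy_min pi_moment)).
  - move=> m y /gt0_in_itv y0; rewrite lee_fin normr_id mulrDl.
    have [g0 g1 _] := (cutB _ (bf m)).2 _ y0; have [g0' g1' _] := (cutB _ bg).2 _ y0.
    rewrite -/B in g1 g1'; rewrite ler_norml; apply/andP; split; lra.
pose K := C + q.
have K0 : 0 <= K by rewrite addr_ge0.
have close m : \forall n \near \oo,
    `|expR (- (x * euler (killed_psi (f m)) (t / n.+1%:R) lam n.+1)) -
      expR (- (x * euler (killed_psi g) (t / n.+1%:R) lam n.+1))| <=
    x * (t * eta m * expR (K * t)).
  have [C1 C10 HC1] := killed_mechanism_le alpha beta pi_moment (cutB _ (bf m)) L0.
  have [C2 C20 HC2] := killed_mechanism_le alpha beta pi_moment (cutB _ bg) L0.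
  have i1 : 0 < 1 / 2 / (C1 + 1) by rewrite !divr_gt0// ltr_wpDl.
  have i2 : 0 < 1 / 2 / (C2 + 1) by rewrite !divr_gt0// ltr_wpDl.
  apply: filterS2 (near_mesh_lt t i1) (near_mesh_lt t i2) => n hn1 hn2.
  have h0 : 0 < t / n.+1%:R by rewrite divr_gt0.
  have Nh : n.+1%:R * (t / n.+1%:R) = t by rewrite mulrC divfK// pnatr_eq0.
  set h := t / n.+1%:R in hn1 hn2 h0 Nh *.
  have hC (c : R) : 0 <= c -> h < 1 / 2 / (c + 1) -> h * c <= 1 / 2.
    move=> c0; rewrite ltr_pdivlMr ?ltr_wpDl// => hc; apply: le_trans (ltW hc).
    by rewrite ler_wpM2l ?(ltW h0)// lerDl.
  have bnd f' C' : baire f' -> 0 <= C' -> h < 1 / 2 / (C' + 1) ->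
      (forall u, 0 <= u <= L -> killed_psi f' u <= C' * u) ->
      forall k, (k <= n.+1)%N -> 0 <= euler (killed_psi f') h lam k <= L.
    move=> bf' C'0 hC' HC' k kn.
    have kt : k%:R * h <= t by rewrite -Nh ler_pM2r// ler_nat.
    have ge u : 0 <= u -> - (`|alpha| * u) - q <= killed_psi f' u.
      exact: (killed_mechanism_ge alpha pi_moment beta_ge0 (cutB _ bf')).
    have /andP[b1 b2] := euler_bounds (normr_ge0 alpha) q0 lam_gt0 C'0 (ltW h0)
      (hC _ C'0 hC') kt ge HC'.
    by rewrite b2 andbT; apply: le_trans b1; rewrite mulr_ge0 ?expR_ge0// ltW.
  have bm := bnd _ _ (bf m) C10 hn1 HC1.
  have bb := bnd _ _ bg C20 hn2 HC2.
  have lipK u w : 0 <= u <= L -> 0 <= w <= L ->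
      `|killed_psi (f m) u - killed_psi g w| <= K * `|u - w| + eta m.
    move=> uL wL; have [u0 _] := andP uL; have [w0 _] := andP wL.
    rewrite /killed_psi; set ku := killing_rate pi (cut (f m)) u.
    set kw := killing_rate pi (cut g) w.
    set kuw := killing_rate pi (cut (f m)) w.
    have -> : Phi u - ku - (Phi w - kw) = (Phi u - Phi w) - (ku - kuw) - (kuw - kw) by ring.
    apply: (le_trans (ler_normB _ _)); rewrite lerD//; last first.
      exact: (killing_rate_dist pi_moment (cutB _ (bf m)) (cutB _ bg) w0).
    apply: (le_trans (ler_normB _ _)); rewrite /K mulrDl lerD//; first exact: HC.
    apply: (le_trans (killing_rate_lipschitz pi_moment (cutB _ (bf m)) u0 w0)).
    by rewrite ler_wpM2r// ler_wpM2r ?levy_mass_ge0// ler_norm.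
  have := euler_dist K0 (eta0 m) (ltW h0) (fun k kn => bm k (ltnW kn))
    (fun k kn => bb k (ltnW kn)) lipK.
  rewrite Nh => dist.
  have /andP[um0 _] := bm n.+1 (leqnn _); have /andP[ug0 _] := bb n.+1 (leqnn _).
  apply: (le_trans (expRN_lipschitz (mulr_ge0 x_ge0 um0) (mulr_ge0 x_ge0 ug0))).
  by rewrite -mulrBr normrM (ger0_norm x_ge0) ler_wpM2l.
apply/cvgrPdist_le => e e0.
have e30 : 0 < e / 3 by rewrite divr_gt0.
have lim_c : x * (t * eta m * expR (K * t)) @[m --> \oo] --> (0 : R).
  rewrite -[X in _ --> X](mulr0 x); apply: cvgM; first exact: cvg_cst.
  rewrite -[X in _ --> X](mul0r (expR (K * t))); apply: cvgM; last exact: cvg_cst.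
  by rewrite -[X in _ --> X](mulr0 t); apply: cvgM; [exact: cvg_cst|exact: eta_lim].
have [m [c1 c2]] : exists m, `|0 - x * (t * eta m * expR (K * t))| <= e / 3 /\
    `|\int[P x]_w (survival g w * expR (- (lam * X t w))) -
      \int[P x]_w (survival (f m) w * expR (- (lam * X t w)))| <= e / 3.
  have /cvgrPdist_le/(_ _ e30)[M1 _ HM1] := lim_c.
  have /cvgrPdist_le/(_ _ e30)[M2 _ HM2] := E1.
  exists (maxn M1 M2); split; [apply: HM1|apply: HM2] => /=.
    exact: leq_maxl.
  exact: leq_maxr.
have /cvgrPdist_le/(_ _ e30) c3 := (IH m).2.
apply: filterS2 c3 (close m) => n d1 d2.
have {}d2 := le_trans d2 (le_trans (ler_norm _) _).
have {d2} d3 : `|expR (- (x * euler (killed_psi (f m)) (t / n.+1%:R) lam n.+1)) -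
      expR (- (x * euler (killed_psi g) (t / n.+1%:R) lam n.+1))| <= e / 3.
  by apply: d2; move: c1; rewrite sub0r normrN.
exact: ler_dist3 c2 d1 d3.
Qed.

End survival.

(** * Time integrals of regular paths *)

(** Values at right ends of left-open cells: they match the discounted product and converge at every
    [s] in []0, t]] by right continuity. *)
Definition right_step {R : realType} (f : R -> R) (h : R) (N : nat) (s : R) : R :=
  \sum_(k < N) f (k.+1%:R * h) * \1_(`]k%:R * h, k.+1%:R * h]%classic : set R) s.

Lemma right_stepE {R : realType} (f : R -> R) (h : R) (N k : nat) (s : R) : 0 < h ->
  (k < N)%N -> k%:R * h < s <= k.+1%:R * h -> right_step f h N s = f (k.+1%:R * h).
Proof.
move=> h0 kN sk; rewrite /right_step (bigD1 (Ordinal kN))//= big1 ?addr0.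
  by rewrite indicE mem_set ?mulr1//= in_itv/=.
move=> i ik; rewrite indicE memNset ?mulr0//= in_itv/= => /andP[si is_].
have /andP[sk1 sk2] := sk; case/negP: ik; apply/eqP/val_inj => /=.
apply/eqP; rewrite eqn_leq -ltnS -(ltr_nat R) -(ltr_pM2r h0) (lt_le_trans si sk2)/=.
by rewrite -ltnS -(ltr_nat R) -(ltr_pM2r h0) (lt_le_trans sk1 is_).
Qed.

Lemma cvg_right_step {R : realType} (f : R -> R) (t s : R) : rcll f -> 0 < s <= t ->
  right_step f (t / n.+1%:R) n.+1 s @[n --> \oo] --> f s.
Proof.
move=> rf /andP[s0 st]; have t0 : 0 < t by exact: lt_le_trans st.
apply/cvgrPdist_lt => e e0; have [d d0 hd] := rcll_right rf (ltW s0) e0.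
apply: filterS (near_mesh_lt t d0) => n hn.
have h0 : 0 < t / n.+1%:R by rewrite divr_gt0.
have Nh : n.+1%:R * (t / n.+1%:R) = t by rewrite mulrC divfK// pnatr_eq0.
move: (t / n.+1%:R) h0 hn Nh => h h0 hn Nh.
have [k /andP[k1 k2]] := exists_grid_cell h0 s0.
have kN : (k < n.+1)%N.
  by rewrite -(ltr_nat R) -(ltr_pM2r h0) Nh (lt_le_trans k1).
rewrite (right_stepE f h0 kN) ?k1// distrC; apply: hd; rewrite k2/=.
by rewrite -natr1 mulrDl mul1r ltrD.
Qed.

Lemma integral_right_step {R : realType} (f : R -> R) (h : R) (N : nat) : 0 < h ->
  (forall s, 0 <= s -> 0 <= f s) ->
  (\int[lebesgue_measure]_(s in `]0%R, (N%:R * h)%R]) (right_step f h N s)%:E =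
   (h * \sum_(k < N) f (k.+1%:R * h))%:E)%E.
Proof.
move=> h0 f0; rewrite /right_step.
have fk0 (k : nat) : 0 <= f (k.+1%:R * h) by apply: f0; rewrite mulr_ge0// ltW.
have mind k : measurable_fun (`]0, N%:R * h] : set R)
    (EFin \o (\1_(`]k%:R * h, k.+1%:R * h]%classic : set R) : R -> R)).
  by apply/measurable_EFinP; apply: measurable_funTS; exact: measurable_indic.
have mterm k : measurable_fun (`]0, N%:R * h] : set R)
    (EFin \o (fun s => f (k.+1%:R * h) * \1_(`]k%:R * h, k.+1%:R * h]%classic : set R) s)).
  apply/measurable_EFinP; apply: measurable_funTS.
  by apply: measurable_funM => //; exact: measurable_indic.
under eq_integral do rewrite -sumEFin.
rewrite ge0_integral_sum//; last 2 first.
- by move=> k; exact: mterm.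
- by move=> k s _; rewrite lee_fin mulr_ge0// indicE.
rewrite mulr_sumr -sumEFin; apply: eq_bigr => k _.
under eq_integral do rewrite EFinM.
rewrite ge0_integralZl_EFin//; last exact: mind.
rewrite integral_indic//= setIidl; last first.
  move=> s /=; rewrite !in_itv/= => /andP[s1 s2]; apply/andP; split.
    by apply: le_lt_trans s1; rewrite mulr_ge0// ltW.
  by rewrite (le_trans s2)// ler_pM2r// ler_nat.
rewrite -[X in (_ * X)%E]/(lebesgue_measure `]k%:R * h, k.+1%:R * h]%classic).
rewrite lebesgue_measure_itv/= lte_fin ltr_pM2r// ltr_nat leqnn -EFinD -EFinM.
by congr EFin; rewrite -natr1; ring.
Qed.

Lemma rcll_measurable {R : realType} (f : R -> R) (t : R) : rcll f ->
  measurable_fun (`]0, t] : set R) f.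
Proof.
move=> rf; have mstep n : measurable_fun (`]0, t] : set R)
    (right_step f (t / n.+1%:R) n.+1).
  apply: measurable_funTS; apply: measurable_sum => k.
  by apply: measurable_funM => //; exact: measurable_indic.
apply: (measurable_fun_cvg mstep) => s; rewrite /= in_itv/= => st.
exact: cvg_right_step.
Qed.

Lemma rcll_measurable_bnd {R : realType} (f : R -> R) (t : R) : rcll f ->
  measurable_fun (`[0, t] : set R) f.
Proof.
move=> rf; have [t0|t0] := leP 0 t; last first.
  by rewrite set_itv_ge ?bnd_simp -?ltNge//; exact: measurable_fun_set0.
rewrite -(setU1itv false) ?bnd_simp//; apply/measurable_funU => //; split.
  exact: measurable_fun_set1.
exact: rcll_measurable.
Qed.

Lemma cvg_riemann_rcll {R : realType} (f : R -> R) (t : R) : rcll f -> 0 < t ->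
  (forall s, 0 <= s -> 0 <= f s) ->
  (\int[lebesgue_measure]_(s in `[0%R, t]) (f s)%:E)%E \is a fin_num /\
  ((t / n.+1%:R * \sum_(k < n.+1) f (k.+1%:R * (t / n.+1%:R)))%:E @[n --> \oo] -->
   \int[lebesgue_measure]_(s in `[0%R, t]) (f s)%:E)%E.
Proof.
move=> rf t0 f0; have [C hC] := rcll_bounded rf (ltW t0).
have C0 : 0 <= C.
  by apply: le_trans (hC 0 _); rewrite // lexx ltW.
have mf : measurable_fun (`[0, t] : set R) f by exact: rcll_measurable_bnd.
have [fi _] := itv_integral_norm_le (ltW t0) mf hC.
split; first by apply: (integrable_fin_num _ fi).
(* The step functions vanish at 0, which lies in no cell, so this point is dropped before passing to
   the limit. *)
have -> : (\int[lebesgue_measure]_(s in `[0%R, t]) (f s)%:E =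
    \int[lebesgue_measure]_(s in `]0%R, t]) (f s)%:E)%E.
  by rewrite integral_itv_obnd_cbnd//; apply/measurable_EFinP; exact: rcll_measurable.
have stepE n : ((t / n.+1%:R * \sum_(k < n.+1) f (k.+1%:R * (t / n.+1%:R)))%:E =
    \int[lebesgue_measure]_(s in `]0%R, t]) (right_step f (t / n.+1%:R) n.+1 s)%:E)%E.
  rewrite -integral_right_step ?divr_gt0//.
  by rewrite [n.+1%:R * _]mulrC divfK// pnatr_eq0.
rewrite (eq_cvg _ _ stepE).
apply: (@dominated_cvg _ _ _ lebesgue_measure (`]0, t] : set R) (measurable_itv _)
  (fun n s => (right_step f (t / n.+1%:R) n.+1 s)%:E) (EFin \o f) (cst C%:E)) => //.
- move=> n; apply/measurable_EFinP; apply: measurable_funTS; apply: measurable_sum => k.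
  by apply: measurable_funM => //; exact: measurable_indic.
- move=> s /=; rewrite in_itv/= => st; apply: cvg_EFin; first exact: nearW.
  exact: cvg_right_step.
- have [ci _] := itv_integral_norm_le (ltW t0) (measurable_cst C : measurable_fun (`[0, t] : set R) _)
    (fun _ _ => ltac:(by rewrite ger0_norm) : `|C| <= C).
  apply: (integrableS _ _ _ ci) => // s /=.
  by rewrite !in_itv/= => /andP[s0 ->]; rewrite ltW.
- move=> n s /=; rewrite in_itv/= => /andP[s0 st]; rewrite lee_fin.
  have h0 : 0 < t / n.+1%:R by rewrite divr_gt0.
  have Nh : n.+1%:R * (t / n.+1%:R) = t by rewrite mulrC divfK// pnatr_eq0.
  move: (t / n.+1%:R) h0 Nh => h h0 Nh.
  have [k /andP[k1 k2]] := exists_grid_cell h0 s0.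
  have kN : (k < n.+1)%N by rewrite -(ltr_nat R) -(ltr_pM2r h0) Nh (lt_le_trans k1).
  rewrite (right_stepE f h0 kN) ?k1//; apply: hC.
  by rewrite mulr_ge0 ?(ltW h0)//= -Nh ler_pM2r// ler_nat.
Qed.

Definition time_integral {R : realType} {T : Type} (X : R -> T -> R) (t : R) (w : T) : R :=
  fine (\int[lebesgue_measure]_(s in `[0%R, t]) (X s w)%:E)%E.

(** * Discounting by the time integral *)

Section cb_time_integral.
Context {R : realType} {d : measure_display} {T : measurableType d}.
Context (Phi : R -> R) (P : R -> probability T R) (X : R -> T -> R).
Hypothesis hX : cb_process Phi P X.

Lemma time_integralE (t : R) (w : T) : 0 < t ->
  (\int[lebesgue_measure]_(s in `[0%R, t]) (X s w)%:E = (time_integral X t w)%:E)%E.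
Proof.
move=> t0; rewrite /time_integral fineK//.
by have [] := cvg_riemann_rcll (cb_rcll hX w) t0 (fun s => @cb_ge0 _ _ _ _ _ _ hX s w).
Qed.

Lemma time_integral_ge0 (t : R) (w : T) : 0 <= time_integral X t w.
Proof.
apply: fine_ge0; apply: integral_ge0 => s /=; rewrite in_itv/= => /andP[s0 _].
by rewrite lee_fin (cb_ge0 hX).
Qed.

Lemma cvg_riemann_time_integral (t : R) (w : T) : 0 < t ->
  t / n.+1%:R * \sum_(k < n.+1) X (k.+1%:R * (t / n.+1%:R)) w @[n --> \oo] -->
  time_integral X t w.
Proof.
move=> t0; apply: (@fine_cvg _ _ _ _ (fun n =>
  (t / n.+1%:R * \sum_(k < n.+1) X (k.+1%:R * (t / n.+1%:R)) w)%:E)).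
rewrite -time_integralE//.
by have [] := cvg_riemann_rcll (cb_rcll hX w) t0 (fun s => @cb_ge0 _ _ _ _ _ _ hX s w).
Qed.

Lemma measurable_time_integral (t : R) : 0 < t -> measurable_fun setT (time_integral X t).
Proof.
move=> t0; pose f n w := t / n.+1%:R * \sum_(k < n.+1) X (k.+1%:R * (t / n.+1%:R)) w.
have mf n : measurable_fun setT (f n).
  apply: measurable_funM => //; apply: measurable_sum => k.
  by apply: (cb_measurable hX); rewrite mulr_ge0// divr_ge0// ltW.
by apply: (measurable_fun_cvg mf) => w _; exact: cvg_riemann_time_integral.
Qed.

Hypothesis Phi_lip : lipschitz_on_segments Phi.
Variables (q : R) (Psi : R -> R) (a b : R).
Hypothesis q_ge0 : 0 <= q.
Hypothesis PsiE : forall u, 0 <= u -> Psi u = Phi u - q.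
Hypothesis a_ge0 : 0 <= a.
Hypothesis b_ge0 : 0 <= b.
Hypothesis Psi_ge : forall u, 0 <= u -> - (a * u) - b <= Psi u.
Hypothesis Psi_le : forall L : R, 0 <= L -> exists2 C : R, 0 <= C &
  forall u, 0 <= u <= L -> Psi u <= C * u.

Lemma cvg_discounted (x t lam : R) : 0 <= x -> 0 < t -> 0 < lam ->
  expR (- (x * euler Psi (t / n.+1%:R) lam n.+1)) @[n --> \oo] -->
  \int[P x]_w (expR (- (q * time_integral X t w)) * expR (- (lam * X t w))).
Proof.
move=> x0 t0 lam0.
have E2 := cvg_discounted_grid hX Phi_lip q_ge0 PsiE a_ge0 b_ge0 Psi_ge Psi_le x0 t0 lam0.
pose F n w := (\prod_(k < n.+1) expR (- (q * (t / n.+1%:R) * X (k.+1%:R * (t / n.+1%:R)) w)))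
     * expR (- (lam * X t w)).
have FE n w : F n w = expR (- (q * (t / n.+1%:R * \sum_(k < n.+1) X (k.+1%:R * (t / n.+1%:R)) w)))
    * expR (- (lam * X t w)).
  rewrite /F -expR_sum; congr (expR _ * _).
  by rewrite sumrN [in RHS]mulrA [in RHS]mulr_sumr.
have mE := measurable_expRN_marginal hX lam (ltW t0).
have grid0 (k n : nat) : 0 <= k%:R * (t / n.+1%:R) by rewrite mulr_ge0// divr_ge0// ltW.
have mF n : measurable_fun setT (F n).
  apply: measurable_funM => //; apply: measurable_prod => k _.
  apply: (measurable_expRN_marginal hX (q * (t / n.+1%:R)) (grid0 k.+1 n)).
have F1 n w : `|F n w| <= 1.
  have S0 : 0 <= t / n.+1%:R * \sum_(k < n.+1) X (k.+1%:R * (t / n.+1%:R)) w.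
    rewrite mulr_ge0 ?divr_ge0// ?(ltW t0)//; apply: sumr_ge0 => k _.
    exact: (cb_ge0 hX).
  rewrite FE normrM -[leRHS]mulr1 ler_pM//; last first.
    exact: (expRN_marginal_norm_le1 hX w (ltW t0) (ltW lam0)).
  by rewrite ger0_norm ?expR_ge0// -[leRHS]expR0 ler_expR oppr_le0 mulr_ge0.
have limF w : F n w @[n --> \oo] -->
    expR (- (q * time_integral X t w)) * expR (- (lam * X t w)).
  rewrite (eq_cvg _ _ (fun n => FE n w)); apply: cvgM; last exact: cvg_cst.
  apply: (continuous_cvg _ (@continuous_expR R _)).
  apply: cvgN; apply: cvgM; first exact: cvg_cst.
  exact: cvg_riemann_time_integral.
have [_ E1] := cvg_expectation (P x) mF F1 limF.
have H := cvgB E1 E2; rewrite subr0 in H; apply: cvg_trans (H _) => //.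
by apply: near_eq_cvg; apply: nearW => n; exact: subKr.
Qed.

Lemma cvg_expectation_lam0 (f : T -> R) (x t : R) : 0 <= t -> measurable_fun setT f ->
  (forall w, 0 <= f w <= 1) ->
  \int[P x]_w (f w * expR (- (n.+1%:R^-1 * X t w))) @[n --> \oo] --> \int[P x]_w f w.
Proof.
move=> t0 mf f01.
have [] // := @cvg_expectation _ _ _ (P x)
  (fun n w => f w * expR (- (n.+1%:R^-1 * X t w))) f 1.
- by move=> n; apply: measurable_funM => //; exact: (measurable_expRN_marginal hX).
- move=> n w; have /andP[f0 f1] := f01 w.
  rewrite normrM (ger0_norm f0) -[leRHS]mulr1 ler_pM//.
  by apply: (expRN_marginal_norm_le1 hX) => //; rewrite invr_ge0.
- move=> w; rewrite -[X in _ --> X]mulr1; apply: cvgM; first exact: cvg_cst.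
  rewrite -[X in _ --> X]expR0; apply: (continuous_cvg _ (@continuous_expR R _)).
  rewrite -oppr0 -[X in _ --> - X](mul0r (X t w)); apply: cvgN.
  by apply: cvgM; [exact: cvg_harmonic|exact: cvg_cst].
Qed.

End cb_time_integral.

(** * The law of the first jump in [A] *)

(** The cutoff equals 1 on [A], so each factor of the product is 0 or 1, and a single jump in [A]
    annihilates it. *)
Lemma survival_indic {R : realType} {d : measure_display} {T : measurableType d} (X : R -> T -> R) (a t : R) (A : set R)
    (J : T -> seq R) (w : T) :
  0 < a -> A `<=` `]a, +oo[ ->
  ((exists2 s, 0 < s <= t & A (jump (X ^~ w) s)) <-> (exists2 y, y \in J w & A y)) ->
  survival a J \1_A w = \1_[set w | ~ (exists2 s, 0 < s <= t & A (jump (X ^~ w) s))] w.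
Proof.
move=> a0 Aa HJ; rewrite /survival [RHS]indicE.
have [nj|j] := pselect (~ exists2 s, 0 < s <= t & A (jump (X ^~ w) s)).
  rewrite mem_set// big1_seq// => y /andP[_ yJ]; rewrite /cut indicE memNset ?mulr0 ?subr0//.
  by move=> Ay; apply: nj; apply/HJ; exists y.
rewrite memNset//; move/contrapT/HJ : j => [y yJ Ay].
rewrite (big_rem y)//= /cut indicE mem_set// jump_cutoff_eq1// ?mul1r ?subrr ?mul0r//.
by have := Aa _ Ay; rewrite /= in_itv/= andbT => /ltW.
Qed.

Section first_jump_law.
Context {R : realType} (alpha beta : R).
Context (pi : {measure set (measurableTypeR R) -> \bar R}).
Hypothesis hparam : branching_parameters alpha beta pi.
Context {d : measure_display} {T : measurableType d}.
Context (P : R -> probability T R) (X : R -> T -> R).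
Hypothesis hX : cb_process (branching_mechanism alpha beta pi) P X.
Variables (a : R) (A : set R).
Hypothesis a_gt0 : 0 < a.
Hypothesis mA : measurable A.
Hypothesis A_sub : A `<=` `]a, +oo[.
Context {d' : measure_display} {T' : measurableType d'}.
Context (PA : R -> probability T' R) (XA : R -> T' -> R).
Hypothesis hXA : cb_process (branching_mechanism_avoiding alpha beta pi A) PA XA.

Lemma cut_indic : cut a \1_A = \1_A.
Proof.
apply/funext => y; rewrite /cut indicE; have [Ay|nAy] := pselect (A y).
  rewrite mem_set// jump_cutoff_eq1 ?mulr1//.
  by have := A_sub Ay; rewrite /= in_itv/= andbT => /ltW.
by rewrite memNset// mulr0.
Qed.

Lemma levy_cutoff_indic : levy_cutoff (cutoff_const a) (\1_A : R -> R).
Proof.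
rewrite -cut_indic; apply: levy_cutoff_jump_cutoff => //.
by move=> y; rewrite indicE; case: (_ \in _); rewrite ?ler01 ?lexx.
Qed.

Lemma A_sub_pos : A `<=` `]0, +oo[.
Proof.
by move=> y /A_sub; rewrite /= !in_itv/= !andbT; exact: lt_trans.
Qed.

Lemma pi_A_fin_num : pi A \is a fin_num.
Proof.
exact: (levy_cutoff_indic_fin_num (bp_moment hparam) mA levy_cutoff_indic A_sub_pos).
Qed.

Let q : R := fine (pi A).

Lemma time_integral_expeR (t : R) w : 0 < t ->
  (expeR (- (pi A * \int[lebesgue_measure]_(s in `[0%R, t]) (XA s w)%:E)) =
   (expR (- (q * time_integral XA t w)))%:E)%E.
Proof.
by move=> t0; rewrite (time_integralE hXA)// -(fineK pi_A_fin_num) -EFinM -EFinN.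
Qed.

Lemma q_ge0 : 0 <= q.
Proof. exact: fine_ge0. Qed.

Lemma discount01 (t : R) w : 0 <= expR (- (q * time_integral XA t w)) <= 1.
Proof.
rewrite expR_ge0/= -expR0 ler_expR oppr_le0 mulr_ge0 ?q_ge0//.
exact: (time_integral_ge0 hXA).
Qed.

Lemma measurable_discount (t : R) : 0 < t ->
  measurable_fun setT (fun w => expR (- (q * time_integral XA t w))).
Proof.
move=> t0; apply: measurableT_comp => //; apply: measurableT_comp => //.
by apply: measurable_funM => //; exact: (measurable_time_integral hXA).
Qed.

(** Measurability of the event is obtained from its representation by [survival], a limit of
    measurable functions; it is recorded for the passage to infinite time. *)
Lemma first_jump_time_law (x t : R) : 0 <= x -> 0 < t ->
  measurable [set w | (t%:E < first_jump_time X A w)%E] /\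
  (P x [set w | t%:E < first_jump_time X A w] =
   \int[PA x]_w
     expeR (- (pi A * \int[lebesgue_measure]_(s in `[0%R, t]) (XA s w)%:E)))%E.
Proof.
move=> x0 t0; set S := [set w | _].
have moment := bp_moment hparam; have beta0 := bp_beta_ge0 hparam.
(* Jumps are listed from the threshold [a / 2], which leaves the interval between [a / 2] and [a]
   for the continuous cutoff to rise from 0 to 1. *)
have b0 : 0 < a / 2 by rewrite divr_gt0.
have Ab : A `<=` `]a / 2, +oo[.
  move=> y /A_sub; rewrite /= !in_itv/= !andbT; apply: lt_trans.
  by rewrite gtr_pMr// invf_lt1// ltr1n.
have /boolp.choice[J HJ] w := rcll_jumps (cb_rcll hX w) t0 b0.
have JL w g : continuous g -> (forall y, y <= a / 2 -> g y = 0) ->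
    increment_prod g (X ^~ w) (t / n.+1%:R) n.+1 t @[n --> \oo] -->
      \prod_(y <- J w) (1 - g y) by case: (HJ w) => H _; exact: H.
have SE : survival a J \1_A = \1_S.
  apply/funext => w; rewrite (survival_indic (X := X) (t := t) a_gt0 A_sub); last first.
    by case: (HJ w) => _; apply.
  congr (\1_ _ w); apply/seteqP; split=> w' /=.
    by move/(lt_first_jump_time (cb_rcll hX w') a_gt0 A_sub t0).
  by move/(lt_first_jump_time (cb_rcll hX w') a_gt0 A_sub t0).
have bA : baire (\1_A : R -> R) by exact: baire_indic.
have surv (lam : R) (lam0 : 0 < lam) := baire_survival moment beta0 hX a_gt0 x0 t0 lam0 JL bA.
have mS : measurable S.
  have [mF _] := surv 1 ltr01.
  (* As [survival] is the indicator of [S], the event is its level set at height 1. *)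
  have := measurable_layer_set 1 mF; congr measurable; apply/seteqP; split=> w /=.
    by rewrite SE indicE; case: (boolP (w \in S)) => [/set_mem//|_]; rewrite ler10.
  by move=> Sw; rewrite SE indicE mem_set.
split=> //.
set Psi := killed_psi alpha beta pi a \1_A.
have gB := levy_cutoff_indic.
have PsiE u : 0 <= u -> Psi u = branching_mechanism_avoiding alpha beta pi A u - q.
  move=> u0; rewrite (branching_mechanism_avoidingE moment alpha beta mA A_sub_pos gB u0).
  by rewrite /Psi /killed_psi cut_indic addrK.
have Alip : lipschitz_on_segments (branching_mechanism_avoiding alpha beta pi A).
  move=> L L0; have [C C0 HC] := killed_mechanism_lipschitz alpha beta moment gB L0.
  exists C => // u w uL wL; have [u0 _] := andP uL; have [w0 _] := andP wL.
  rewrite !(branching_mechanism_avoidingE moment alpha beta mA A_sub_pos gB)//.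
  by rewrite opprD addrACA subrr addr0; exact: HC.
have Pge u : 0 <= u -> - (`|alpha| * u) - `|cutoff_const a| * levy_mass pi <= Psi u.
  by rewrite /Psi /killed_psi cut_indic; exact: (killed_mechanism_ge _ moment beta0 gB).
have Ple L : 0 <= L -> exists2 C : R, 0 <= C & forall u, 0 <= u <= L -> Psi u <= C * u.
  by rewrite /Psi /killed_psi cut_indic; exact: (killed_mechanism_le _ _ moment gB).
have bm0 : 0 <= `|cutoff_const a| * levy_mass pi by rewrite mulr_ge0// levy_mass_ge0.
have disc (lam : R) (lam0 : 0 < lam) := cvg_discounted hXA Alip q_ge0 PsiE (normr_ge0 alpha) bm0
  Pge Ple x0 t0 lam0.
have eq_lam lam : 0 < lam -> \int[P x]_w (\1_S w * expR (- (lam * X t w))) =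
    \int[PA x]_w (expR (- (q * time_integral XA t w)) * expR (- (lam * XA t w))).
  move=> lam0; have [_ E1] := surv _ lam0; rewrite SE in E1.
  exact: (cvg_unique _ E1 (disc _ lam0)).
have S01 w : 0 <= (\1_S w : R) <= 1.
  by rewrite indicE; case: (_ \in _); rewrite ?ler01 ?lexx.
have L1 := cvg_expectation_lam0 hX (x := x) (ltW t0) (measurable_indic mS) S01.
have L2 := cvg_expectation_lam0 hXA (x := x) (ltW t0) (measurable_discount t0) (discount01 t).
rewrite (eq_cvg _ _ (fun n => eq_lam _ (ltac:(by rewrite invr_gt0) : 0 < n.+1%:R^-1))) in L1.
have e : \int[P x]_w (\1_S w : R) = \int[PA x]_w expR (- (q * time_integral XA t w)).
  by apply: (cvg_unique _ L1 L2).
under eq_integral do rewrite time_integral_expeR//.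
have iD : (PA x).-integrable setT (EFin \o (fun w => expR (- (q * time_integral XA t w)))).
  apply: (@integrable_bounded_fun _ _ _ _ _ 1); first exact: measurable_discount.
  by move=> w; have /andP[e0 e1] := discount01 t w; rewrite ger0_norm.
rewrite -(fineK (integrable_fin_num measurableT iD)) -[LHS]fineK ?fin_num_measure//.
congr EFin; rewrite -[RHS]e.
by rewrite /Rintegral integral_indic// setIT.
Qed.

(** Integer times are enough: continuity from above of [P x] on one side, dominated convergence with
    bound 1 on the other. *)
Lemma first_jump_time_infinite_law (x : R) : 0 <= x ->
  (P x [set w | first_jump_time X A w = +oo] =
   \int[PA x]_w
     expeR (- (pi A * \int[lebesgue_measure]_(s in `[0%R, +oo[) (XA s w)%:E)))%E.
Proof.
move=> x0.
pose F (n : nat) := [set w | (n.+1%:R%:E < first_jump_time X A w)%E].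
have FE : [set w | first_jump_time X A w = +oo%E] = \bigcap_n F n.
  apply/seteqP; split=> w /=.
    by move=> e n _; rewrite /F/= e ltry.
  move=> Fw; have {Fw} : forall n : nat, (n.+1%:R%:E < first_jump_time X A w)%E.
    by move=> n; exact: Fw.
  case: (first_jump_time X A w) => [r| |] Fr //; last by have := Fr 0%N.
  have := Fr (Num.bound `|r|); rewrite lte_fin ltNge => /negP; case.
  rewrite (le_trans (ler_norm r))// ltW// (lt_le_trans (archi_boundP _))//.
  by rewrite ler_nat.
have mF n : measurable (F n) by have [] := first_jump_time_law x0 (ltr0Sn R n).
have cP : P x (F n) @[n --> \oo] --> P x (\bigcap_n F n).
  apply: nonincreasing_cvg_mu => //.
  - by rewrite (le_lt_trans (probability_le1 _ _))// ltry.
  - by apply: bigcap_measurable.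
  - apply/nonincreasing_seqP => n; apply/subsetPset => w; rewrite /F/=; apply: lt_trans.
    by rewrite lte_fin ltr_nat.
pose I n w := (\int[lebesgue_measure]_(s in `[0%R, n.+1%:R]) (XA s w)%:E)%E.
pose Ioo w := (\int[lebesgue_measure]_(s in `[0%R, +oo[) (XA s w)%:E)%E.
have cI w : I n w @[n --> \oo] --> Ioo w.
  rewrite /Ioo (_ : `[0, +oo[%classic = \bigcup_n (`[0, n.+1%:R]%classic : set R)).
    apply: (@ge0_nondecreasing_set_cvg_integral _ (measurableTypeR R) R
      (fun n => `[0, n.+1%:R]%classic) (fun s => (XA s w)%:E) lebesgue_measure).
    - apply/nondecreasing_seqP => n; apply/subsetPset => s /=.
      rewrite !in_itv/= => /andP[-> /le_trans]; apply.
      by rewrite ler_nat.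
    - by move=> n; exact: measurable_itv.
    - by move=> n; apply/measurable_EFinP; exact: rcll_measurable_bnd (cb_rcll hXA w).
    - by move=> n s /=; rewrite in_itv/= => /andP[s0 _]; rewrite lee_fin (cb_ge0 hXA).
  apply/seteqP; split=> s /=; rewrite in_itv/= ?andbT.
    move=> s0; exists (Num.bound s) => //=; rewrite in_itv/= s0/=.
    by rewrite ltW// (lt_le_trans (archi_boundP s0))// ler_nat.
  by move=> [n _ /=]; rewrite in_itv/= => /andP[].
have cE w : (expeR (- (pi A * I n w)) @[n --> \oo] --> expeR (- (pi A * Ioo w)))%E.
  (* Finiteness of [pi A] matters when the total integral is infinite; if moreover [pi A = 0], both
     sides are 0 by the convention on [0 * +oo]. *)
  have cq : (pi A * I n w @[n --> \oo] --> pi A * Ioo w)%E.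
    by apply: cvgeZl => //; exact: pi_A_fin_num.
  have In n : (pi A * I n w = (q * time_integral XA n.+1%:R w)%:E)%E.
    by rewrite /I (time_integralE hXA)// -(fineK pi_A_fin_num).
  have Xn n : (expeR (- (pi A * I n w)) = (expR (- (q * time_integral XA n.+1%:R w)))%:E)%E.
    by rewrite /I time_integral_expeR.
  rewrite (eq_cvg _ _ Xn); rewrite (eq_cvg _ _ In) in cq.
  have Ioo0 : (0 <= pi A * Ioo w)%E.
    rewrite mule_ge0// integral_ge0// => s /=; rewrite in_itv/= andbT => s0.
    by rewrite lee_fin (cb_ge0 hXA).
  (* A finite limit is handled by continuity of the exponential; for an infinite one, [y >= e^-1]
     forces [exp (- y) <= e]. *)
  move: (pi A * Ioo w)%E cq Ioo0 => [r| |] cq// _.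
    apply: cvg_EFin; first exact: nearW.
    apply: (continuous_cvg _ (@continuous_expR R _)); apply: cvgN.
    exact: (fine_cvg cq).
  apply/fine_cvgP; split; first exact: nearW.
  apply/cvgrPdist_le => e e0; move/cvgeyPge: cq => /(_ e^-1).
  apply: filterS => n; rewrite lee_fin sub0r normrN ger0_norm ?expR_ge0//= => en.
  have ei0 : 0 < e^-1 by rewrite invr_gt0.
  rewrite expRN -[e]invrK lef_pV2 ?posrE ?expR_gt0// (le_trans en)//.
  by rewrite (le_trans _ (expR_ge1Dx _))// lerDr.
have mE n : measurable_fun setT (fun w => expeR (- (pi A * I n w)))%E.
  rewrite (_ : (fun w => _) = (EFin \o (fun w => expR (- (q * time_integral XA n.+1%:R w))))).
    by apply/measurable_EFinP; exact: measurable_discount.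
  by apply/funext => w; rewrite /I time_integral_expeR.
have cR : (\int[PA x]_w expeR (- (pi A * I n w)) @[n --> \oo] -->
    \int[PA x]_w expeR (- (pi A * Ioo w)))%E.
  apply: (@dominated_cvg _ _ _ (PA x) setT measurableT _ _ (cst 1%E)) => //.
  - by apply: (@integrable_bounded_fun _ _ _ _ _ 1) => // w; rewrite normr1.
  - move=> n w _; rewrite /I time_integral_expeR//=.
    by have /andP[e0 e1] := discount01 n.+1%:R w; rewrite lee_fin ger0_norm.
have PE n : P x (F n) = (\int[PA x]_w expeR (- (pi A * I n w)))%E.
  by have [_ ->] := first_jump_time_law x0 (ltr0Sn R n).
rewrite FE; rewrite (eq_cvg _ _ PE) in cP.
exact: (cvg_unique _ cP cR).
Qed.

End first_jump_law.

Theorem theorem3p1 (R : realType) (alpha beta : R)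
    (pi : {measure set (measurableTypeR R) -> \bar R})
    (hparam : branching_parameters alpha beta pi)
    (hpi : pi setT <> 0%E)
    (d : measure_display) (T : measurableType d)
    (P : R -> probability T R) (X : R -> T -> R)
    (hX : cb_process (branching_mechanism alpha beta pi) P X)
    (a : R) (ha : 0 < a) (A : set R) (hA : measurable A)
    (hAa : A `<=` `]a, +oo[)
    (d' : measure_display) (T' : measurableType d')
    (PA : R -> probability T' R) (XA : R -> T' -> R)
    (hXA : cb_process (branching_mechanism_avoiding alpha beta pi A) PA XA)
    (x : R) (hx : 0 < x) :
  (forall t : R, (0 < t)%R ->
     P x [set w | t%:E < first_jump_time X A w] =
     \int[PA x]_w
       expeR (- (pi A * \int[lebesgue_measure]_(s in `[0%R, t]) (XA s w)%:E)))%E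
  /\
  (P x [set w | first_jump_time X A w = +oo] =
   \int[PA x]_w
     expeR (- (pi A * \int[lebesgue_measure]_(s in `[0%R, +oo[) (XA s w)%:E)))%E.
Proof.
have x0 := ltW hx; split=> [t t0|].
  by have [_ ->] := first_jump_time_law hparam hX ha hA hAa hXA x0 t0.
exact: (first_jump_time_infinite_law hparam hX ha hA hAa hXA x0).
Qed.
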